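(* If $n>0$ with $\gcd(n,6)=1$ and $p>3$ is prime, then $T_p(D^n)$ is a sum of powers $D^k$ with $k\equiv pn\pmod{24}$ and $k\le n$.
   Context: For an odd prime $p$, $T_p:\mathbb{Z}/2[[x]]\to\mathbb{Z}/2[[x]]$ is the map $\sum c_nx^n\mapsto\sum c_{pn}x^n+\sum c_nx^{pn}$. $D=\sum_{n>0,\ \gcd(n,6)=1}x^{n^2}\in\mathbb{Z}/2[[x]]$. *)

(* Defs.v *)
From HB Require Import structures.
From mathcomp Require Import all_boot all_algebra.
From mathcomp Require Import boolp.

Set Implicit Arguments.
Unset Strict Implicit.
Unset Printing Implicit Defensive.

Import GRing.Theory.
Local Open Scope ring_scope.

(* Formal power series R[[x]]. The sequence of coefficients is wrapped in a
   record so that the product is the Cauchy product and not the pointwise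
   product of functions. *)
Record fps (R : comNzRingType) := Fps { fcoef : nat -> R }.

Notation "f .[| i |]" := (fcoef f i)
  (at level 2, left associativity, format "f .[| i |]") : ring_scope.

Section FpsRing.
Variable R : comNzRingType.
Implicit Types f g h : fps R.

HB.instance Definition _ := gen_eqMixin (fps R).
HB.instance Definition _ := gen_choiceMixin (fps R).

Lemma fpsP f g : (forall m, f.[|m|] = g.[|m|]) <-> f = g.
Proof.
split=> [|-> //]; case: f => f; case: g => g /= fg.
by congr Fps; apply: funext.
Qed.

Definition fps_zero : fps R := Fps (fun=> 0).
Definition fps_one : fps R := Fps (fun m => (m == 0%N)%:R).
Definition fps_opp f : fps R := Fps (fun m => - f.[|m|]).
Definition fps_add f g : fps R := Fps (fun m => f.[|m|] + g.[|m|]).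
Definition fps_mul f g : fps R :=
  Fps (fun m => \sum_(i < m.+1) f.[|i|] * g.[|m - i|]).

Fact fps_addA : associative fps_add.
Proof. by move=> f g h; apply/fpsP => m /=; rewrite addrA. Qed.
Fact fps_addC : commutative fps_add.
Proof. by move=> f g; apply/fpsP => m /=; rewrite addrC. Qed.
Fact fps_add0 : left_id fps_zero fps_add.
Proof. by move=> f; apply/fpsP => m /=; rewrite add0r. Qed.
Fact fps_addN : left_inverse fps_zero fps_opp fps_add.
Proof. by move=> f; apply/fpsP => m /=; rewrite addNr. Qed.

HB.instance Definition _ :=
  GRing.isZmodule.Build (fps R) fps_addA fps_addC fps_add0 fps_addN.

Definition fps_trunc n f : {poly R} := \poly_(i < n) f.[|i|].

Lemma coef_trunc_mul n m f g : (m < n)%N ->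
  (fps_trunc n f * fps_trunc n g)`_m = (fps_mul f g).[|m|].
Proof.
move=> mn; rewrite coefM /=; apply: eq_bigr => i _; rewrite !coef_poly.
by rewrite (leq_ltn_trans (leq_ord i) mn) (leq_ltn_trans (leq_subr i m) mn).
Qed.

Fact fps_mulA : associative fps_mul.
Proof.
move=> f g h; apply/fpsP => m.
rewrite -!(@coef_trunc_mul m.+1) //.
transitivity ((fps_trunc m.+1 f * (fps_trunc m.+1 g * fps_trunc m.+1 h))`_m).
  rewrite !coefM; apply: eq_bigr => i _; congr (_ * _).
  have lt_m : (m - i < m.+1)%N by rewrite ltnS leq_subr.
  by rewrite coef_trunc_mul // coef_poly lt_m.
rewrite mulrA !coefM; apply: eq_bigr => i _; congr (_ * _).
by rewrite coef_trunc_mul // coef_poly ltn_ord.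
Qed.

Fact fps_mulC : commutative fps_mul.
Proof.
move=> f g; apply/fpsP => m.
by rewrite -!(@coef_trunc_mul m.+1) // mulrC.
Qed.

Fact fps_mul1 : left_id fps_one fps_mul.
Proof.
move=> f; apply/fpsP => m /=.
rewrite big_ord_recl /= subn0 mul1r big1 ?addr0 // => i _.
by rewrite mul0r.
Qed.

Fact fps_mulDl : left_distributive fps_mul fps_add.
Proof.
move=> f g h; apply/fpsP => m /=; rewrite -big_split /=.
by apply: eq_bigr => i _; rewrite mulrDl.
Qed.

Fact fps_one_neq0 : fps_one != 0.
Proof.
apply/eqP => /(congr1 (fun f : fps R => f.[|0|])) /= /eqP.
by rewrite oner_eq0.
Qed.

HB.instance Definition _ := GRing.Zmodule_isComNzRing.Build (fps R)
  fps_mulA fps_mulC fps_mul1 fps_mulDl fps_one_neq0.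

Lemma fcoefM f g m :
  (f * g).[|m|] = \sum_(i < m.+1) f.[|i|] * g.[|m - i|].
Proof. by []. Qed.

Lemma fcoef1 m : (1 : fps R).[|m|] = (m == 0%N)%:R.
Proof. by []. Qed.

Lemma fcoefD f g m : (f + g).[|m|] = f.[|m|] + g.[|m|].
Proof. by []. Qed.

Lemma fcoef0 m : (0 : fps R).[|m|] = 0.
Proof. by []. Qed.

End FpsRing.

(* sum c_n x^n |-> sum c_(pn) x^n + sum c_n x^(pn), meaningful for p > 0. *)
Definition T (p : nat) (f : fps 'F_2) : fps 'F_2 :=
  Fps (fun m => f.[|p * m|]) +
  Fps (fun m => if (p %| m)%N then f.[|m %/ p|] else 0).

(* The coefficient of x^m counts the k > 0 prime to 6 with k^2 = m; such a k
   is at most m. *)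
Definition D : fps 'F_2 :=
  Fps (fun m => \sum_(1 <= k < m.+1 | coprime k 6 && (k ^ 2 == m)%N) 1).

(* Main.v *)
From HB Require Import structures.
Require Import Defs.
From mathcomp Require Import all_boot all_order all_algebra.
From mathcomp Require Import all_fingroup all_solvable all_field.
From mathcomp Require Import boolp zify ring.

(* Let k be a field of characteristic 2 containing a primitive p^2-th root of
   unity rho, write eta for D over k, and put p = 2h + 1 and
   eta' = eta(r^(p^2)).  In the variable r, where x = r^(p^2), T_p(D^n) is the
   sum of eta_l^n over p + 1 "lines" l, where eta_l is eta(rho^(cp) r^p) for
   some 0 <= c < p, or eta(r^(p^3)).  Each line carries theta series E_l(a) and
   T_l(a), whose addition and duplication formulas only involve the constant
   1/eta'^3, so the ratios z_{l,a} = E_l(a)/T_l(a), 1 <= a <= h, are roots of a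
   division polynomial over F_2[1/eta'].  They are distinct, hence all of its
   roots, and both z_{l,a} and 1/z_{l,a} are integral over F_2[1/eta'].
   The Jacobi triple product turns prod_a T_l(a) into eta'^(h-1) eta_l, so
   u_l = eta_l/eta' is integral and a rational function of z_{l,a}; by Lagrange
   interpolation sum_l u_l^n lies in F_2(1/eta'), and by integrality in
   F_2[1/eta'].  Multiplying by eta'^n, T_p(D^n) is a sum of powers D^(n-i); no
   exponent is negative since T_p(D^n) is a power series.  Finally the powers
   D^k are separated modulo 24 by their supports. *)

Set Implicit Arguments.
Unset Strict Implicit.
Unset Printing Implicit Defensive.

Import Order.TTheory GRing.Theory Num.Theory.
Local Open Scope ring_scope.

(** One division polynomial can serve all lines only if the duplication formula has the same
    constant on each of them. Putting v = u in the addition formula gives nothing: in characteristic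
    2 both [theta_odd 0] and the right-hand side vanish. Summing over positive m only yields a
    substitute, [theta_half]. On every line it sees only multiples of p, where the roots of unity of
    the line become 1, and Jacobi's series for the cube of eta identifies it with eta'^3.

    The division polynomial has degree h(p + 1), the number of pairs (l, a); this is why
    distinctness of the ratios, read off leading terms, suffices for the full factorization.

    Interpolation yields sums over pairs, in which every line occurs h times; for even h an
    unweighted sum is 0 in characteristic 2. Each term therefore carries the weight (1/z_{l,a}) /
    sum_b (1/z_{l,b}), which is rational in z_{l,a} and adds up to 1 on each line. The price is a
    proof that this denominator never vanishes.

    Integrality of 1/z controls u_l because u_l^3 is the product of the 1/z_{l,a}^2. *)

(** Multiplication by c permutes the nonzero classes modulo p up to sign, and 1, ..., h represent
    these. *)
Lemma big_half_residues (T : Type) (idx : T) (op : Monoid.com_law idx)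
    (h p c : nat) (G : nat -> T) :
    p = h.*2.+1 -> prime p -> ~~ (p %| c)%N ->
    (forall a b, (a = b %[mod p] \/ p %| a + b)%N -> G a = G b) ->
  \big[op/idx]_(i < h) G (c * i.+1)%N = \big[op/idx]_(i < h) G i.+1.
Proof.
move=> ph p_pr pc GP.
pose rep x := minn (x %% p) (p - x %% p).
have rep_lt (i : 'I_h) : ((rep (c * i.+1)).-1 < h)%N.
  rewrite /rep; have : (0 < c * i.+1 %% p)%N.
    rewrite lt0n -/(dvdn _ _) Euclid_dvdM // negb_or pc /= gtnNdvd //.
    have := ltn_ord i; lia.
  by have : (c * i.+1 %% p < p)%N; [rewrite ltn_pmod ?prime_gt0 | lia].
have rep_gt0 (i : 'I_h) : (0 < rep (c * i.+1))%N.
  rewrite /rep; have : (0 < c * i.+1 %% p)%N.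
    rewrite lt0n -/(dvdn _ _) Euclid_dvdM // negb_or pc /= gtnNdvd //.
    have := ltn_ord i; lia.
  by have : (c * i.+1 %% p < p)%N; [rewrite ltn_pmod ?prime_gt0 | lia].
have repP x y : rep x = rep y -> (x = y %[mod p] \/ p %| x + y)%N.
  have hx : (x %% p < p)%N by rewrite ltn_pmod ?prime_gt0.
  have hy : (y %% p < p)%N by rewrite ltn_pmod ?prime_gt0.
  rewrite /rep => E.
  have [->|xy] : (x %% p = y %% p \/ x %% p + y %% p = p)%N by lia.
    by left.
  by right; rewrite /dvdn -modnDm xy modnn.
have Grep x : G (rep x) = G x.
  have hx : (x %% p < p)%N by rewrite ltn_pmod ?prime_gt0.
  rewrite /rep; have [le|/ltnW le] := leqP (x %% p) (p - x %% p).
    by apply: GP; left; rewrite modn_mod.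
  apply: GP; right.
  by rewrite /dvdn -modnDmr subnK ?modnn // ltnW.
pose f i := Ordinal (rep_lt i).
have f_inj : injective f.
  move=> i j /(congr1 val) /= E.
  have {}E : rep (c * i.+1) = rep (c * j.+1).
    by rewrite -(prednK (rep_gt0 i)) E prednK.
  have := ltn_ord i; have := ltn_ord j.
  move=> jh ih; have [/eqP E1|E1] := repP _ _ E.
    apply: val_inj => /=.
    wlog ij : i j jh ih E1 {E} / (i <= j)%N.
      move=> W; have [ij|ji] := leqP i j; first exact: W.
      by symmetry; apply: W => //; [rewrite eq_sym | exact: ltnW].
    move: E1; rewrite eq_sym eqn_mod_dvd ?leq_mul //.
    rewrite -mulnBr Euclid_dvdM // (negPf pc) /= subSS.
    have [|ji] := posnP (j - i)%N; first by lia.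
    by rewrite gtnNdvd //; lia.
  by move: E1; rewrite -mulnDr Euclid_dvdM // (negPf pc) /= gtnNdvd //; lia.
rewrite [RHS](reindex f) /=; last by apply: onW_bij; apply: injF_bij.
by apply: eq_bigr => i _; rewrite prednK ?rep_gt0 // Grep.
Qed.

Lemma size_monic_exp (R : idomainType) (q : {poly R}) n : q \is monic ->
  size (q ^+ n) = ((size q).-1 * n).+1.
Proof.
by move=> mq; rewrite -size_exp -polySpred // expf_neq0 // monic_neq0.
Qed.

(** * Division polynomials *)

Section Ladder.
Variables (R : idomainType) (eps : R).

(* The relations satisfied by theta_even and theta_odd at the multiples of a
   point, with eps = 1 / eta ^ 3. *)
Record theta_seq (S : fieldType) (f : {rmorphism R -> S}) (E T : nat -> S) :
    Prop := ThetaSeq {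
  ts_E1 : E 1 != 0;
  ts_T1 : T 1 != 0;
  ts_T2 : forall k, T k.*2 = f eps * T k ^+ 2 * E k ^+ 2;
  ts_E2 : forall k, E k.*2 = E k ^+ 4 + T k ^+ 4;
  ts_TS : forall k, T k.*2.+1 * T 1 = (T k.+1 * E k + E k.+1 * T k) ^+ 2;
  ts_ES : forall k, E k.*2.+1 * E 1 = (E k.+1 * E k + T k.+1 * T k) ^+ 2 }.

(** With z = E 1 / T 1, [e] and [t] give the values at n times the point up to the factor T 1 ^ (n ^
    2). The parity clauses carry the recursion: the zeros at 0 permit the division by E 1 in the odd
    step, and the degrees of [t] keep leading terms from cancelling. *)
Record ladder (n : nat) (e t : {poly R}) : Prop := Ladder {
  lad_e : e \is monic /\ size e = (n ^ 2).+1;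
  lad_odd : odd n -> [/\ t \is monic, size t = (n ^ 2)%N & e.[0] = 0];
  lad_even : ~~ odd n -> (size t < n ^ 2)%N /\ t.[0] = 0;
  lad_eval : forall (S : fieldType) (f : {rmorphism R -> S}) (E T : nat -> S),
    theta_seq f E T ->
    E n = T 1%N ^+ (n ^ 2) * (map_poly f e).[E 1%N / T 1%N] /\
    T n = T 1%N ^+ (n ^ 2) * (map_poly f t).[E 1%N / T 1%N] }.

Lemma ladder1 : ladder 1 'X 1.
Proof.
split=> //.
- by rewrite monicX size_polyX.
- by move=> _; rewrite monic1 size_poly1 hornerX.
move=> S f E T h; rewrite map_polyX rmorph1 hornerX hornerC mulr1 expr1.
by rewrite mulrC divfK ?(ts_T1 h).
Qed.

Lemma ladder_double k e t : (0 < k)%N -> ladder k e t ->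
  ladder k.*2 (e ^+ 4 + t ^+ 4) (eps *: (t ^+ 2 * e ^+ 2)).
Proof.
move=> k0 [[me se] od ev evl].
have e0 : e != 0 by apply: monic_neq0.
have st : (size t <= k ^ 2)%N.
  by case: (boolP (odd k)) => [/od[_ ->]|/ev[/ltnW]].
have se4 : size (e ^+ 4) = (k.*2 ^ 2).+1.
  by rewrite size_monic_exp // se; lia.
have st4 : (size (t ^+ 4) < size (e ^+ 4))%N.
  rewrite se4; apply: (leq_ltn_trans (size_poly_exp_leq _ _)); nia.
split; rewrite ?odd_double //.
- split; first by rewrite monicE lead_coefDl // -monicE monic_exp.
  by rewrite size_polyDl.
- move=> _; split.
    apply: (leq_ltn_trans (size_scale_leq _ _)).
    have [->|t0] := eqVneq t 0; first by rewrite expr0n mul0r size_poly0; lia.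
    rewrite size_mul ?expf_neq0 // (size_monic_exp 2 me) se.
    have := size_poly_exp_leq t 2; have : (0 < size t)%N by rewrite size_poly_gt0.
    nia.
  rewrite hornerZ hornerM !horner_exp.
  case: (boolP (odd k)) => [/od[_ _ ->]|/ev[_ ->]];
    by rewrite expr0n /= ?mul0r !mulr0.
move=> S f E T h; have [hE hT] := evl _ _ _ _ h.
rewrite (ts_E2 h) (ts_T2 h) hE hT rmorphD map_polyZ !(rmorphXn, rmorphM) /=.
rewrite !(hornerD, hornerM, hornerZ, horner_exp).
have -> : (k.*2 ^ 2 = k ^ 2 * 4)%N by lia.
by rewrite exprM; split; ring.
Qed.

(** One of k and k + 1 is odd, and the product containing its [t] dominates. The sum t' e + e' t is
    stated apart from the ladder because for k = h it is the division polynomial, without the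
    square. *)
Lemma ladder_odd k e t e' t' : (0 < k)%N -> ladder k e t -> ladder k.+1 e' t' ->
  [/\ t' * e + e' * t \is monic,
     size (t' * e + e' * t) = (k ^ 2 + k.+1 ^ 2)%N &
     ladder k.*2.+1 ('X * (drop_poly 1 (e' * e + t' * t)) ^+ 2)
       ((t' * e + e' * t) ^+ 2)].
Proof.
move=> k0 [[me se] od ev evl] [[me' se'] od' ev' evl'].
have [mP sP] : t' * e + e' * t \is monic /\
    size (t' * e + e' * t) = (k ^ 2 + k.+1 ^ 2)%N.
  case: (boolP (odd k)) => ok.
    have [mt st _] := od ok; have [st' _] := ev' (ltac:(by rewrite /= ok)).
    have s1 : size (e' * t) = (k ^ 2 + k.+1 ^ 2)%N.
      by rewrite size_monicM ?monic_neq0 // se' st; lia.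
    have s2 : (size (t' * e)%R < size (e' * t)%R)%N.
      rewrite s1; have := size_polyMleq t' e; rewrite se => /leq_ltn_trans.
      by apply; nia.
    rewrite addrC size_polyDl // s1; split=> //.
    by rewrite monicE lead_coefDl // -monicE monicMl.
  have [st _] := ev ok; have [mt' st' _] := od' ok.
  have s1 : size (t' * e) = (k ^ 2 + k.+1 ^ 2)%N.
    by rewrite size_monicM ?monic_neq0 // se st'; lia.
  have s2 : (size (e' * t)%R < size (t' * e)%R)%N.
    rewrite s1; have := size_polyMleq e' t; rewrite se' => /leq_ltn_trans.
    by apply; nia.
  rewrite size_polyDl // s1; split=> //.
  by rewrite monicE lead_coefDl // -monicE monicMl.
split=> //.
(* In each product one factor vanishes at 0. Writing q = X q', the division of q ^ 2 by E 1 leaves X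
   q' ^ 2. *)
set q := e' * e + t' * t.
have [mq sq q0] : [/\ q \is monic, size q = (k ^ 2 + k.+1 ^ 2).+1 & q.[0] = 0].
  have s1 : size (e' * e) = (k ^ 2 + k.+1 ^ 2).+1.
    by rewrite size_monicM ?monic_neq0 // se se'; lia.
  have s2 : (size (t' * t)%R < size (e' * e)%R)%N.
    rewrite s1; have := size_polyMleq t' t.
    have : (size t <= k ^ 2)%N.
      by case: (boolP (odd k)) => [/od[_ ->]|/ev[/ltnW]].
    have : (size t' <= k.+1 ^ 2)%N.
      by case: (boolP (odd k.+1)) => [/od'[_ ->]|/ev'[/ltnW]].
    by lia.
  split.
  - by rewrite monicE lead_coefDl // -monicE monicMl.
  - by rewrite size_polyDl.
  rewrite !hornerE; case: (boolP (odd k)) => ok.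
    have [_ _ ->] := od ok; have [_ ->] := ev' (ltac:(by rewrite /= ok)).
    by rewrite mulr0 mul0r addr0.
  have [_ ->] := ev ok; have [_ _ ->] := od' ok.
  by rewrite mulr0 mul0r addr0.
set q' := drop_poly 1 q.
have qE : q = 'X * q'.
  rewrite -[LHS](poly_take_drop 1) -/q' expr1 mulrC.
  suff -> : take_poly 1 q = 0 by rewrite add0r.
  by apply/polyP => -[|i]; rewrite coef_take_poly coef0 // -horner_coef0.
have q'0 : q' != 0.
  by apply: contraTneq mq => q'0; rewrite qE q'0 mulr0 monicE lead_coef0 eq_sym oner_eq0.
have sq' : size q' = (k ^ 2 + k.+1 ^ 2)%N.
  by apply/eqP; rewrite -eqSS -sq qE mulrC size_mulX.
have mq' : q' \is monic by rewrite -(monicMl q' (monicX R)) -qE.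
split.
- split; first by rewrite monicMl ?monicX ?monic_exp.
  by rewrite mulrC size_mulX ?expf_neq0 // size_monic_exp // sq'; lia.
- move=> _; split; first by rewrite monic_exp.
  + by rewrite size_monic_exp // sP; lia.
  + by rewrite hornerM hornerX mul0r.
- by rewrite /= odd_double.
move=> S f E T h; have [hE hT] := evl _ _ _ _ h; have [hE' hT'] := evl' _ _ _ _ h.
set z := E 1%N / T 1%N in hE hT hE' hT' *.
have z0 : z != 0 by rewrite mulf_neq0 ?invr_eq0 ?(ts_E1 h) ?(ts_T1 h).
have sqE : ((k.*2.+1 ^ 2).+1 = (k ^ 2 + k.+1 ^ 2) * 2)%N by lia.
split.
  apply: (mulIf (ts_E1 h)); rewrite (ts_ES h) hE hE' hT hT'.
  transitivity ((T 1%N ^+ (k ^ 2 + k.+1 ^ 2) * (map_poly f q).[z]) ^+ 2).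
    by congr (_ ^+ 2); rewrite rmorphD !rmorphM /= hornerD !hornerM exprD; ring.
  have -> : E 1%N = z * T 1%N by rewrite divfK ?(ts_T1 h).
  rewrite qE !(rmorphXn, rmorphM) /= map_polyX !(hornerM, hornerX, horner_exp).
  rewrite exprMn -exprM -sqE exprS; ring.
apply: (mulIf (ts_T1 h)); rewrite (ts_TS h) hE hE' hT hT'.
transitivity ((T 1%N ^+ (k ^ 2 + k.+1 ^ 2) *
    (map_poly f (t' * e + e' * t)).[z]) ^+ 2).
  by congr (_ ^+ 2); rewrite rmorphD !rmorphM /= hornerD !hornerM exprD; ring.
by rewrite rmorphXn horner_exp exprMn -exprM -sqE exprS; ring.
Qed.

Lemma ladderP n : (0 < n)%N -> exists e t, ladder n e t.
Proof.
elim/ltn_ind: n => n IH n0.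
have [->|n1] := eqVneq n 1%N; first by exists 'X, 1; apply: ladder1.
pose k := n./2.
have k0 : (0 < k)%N by rewrite /k; lia.
have [e [t L]] : exists e t, ladder k e t by apply: IH => //; rewrite /k; lia.
case: (boolP (odd n)) => on; last first.
  have -> : n = k.*2 by rewrite /k; lia.
  by exists (e ^+ 4 + t ^+ 4), (eps *: (t ^+ 2 * e ^+ 2)); apply: ladder_double.
have [e' [t' L']] : exists e t, ladder k.+1 e t.
  by apply: IH => //; rewrite /k; lia.
have -> : n = k.*2.+1 by rewrite /k; lia.
have [_ _ H] := ladder_odd k0 L L'.
by eexists _, _; exact: H.
Qed.

End Ladder.

(** The rational root theorem: in lowest terms the denominator divides a power of the numerator,
    hence is constant. *)
Lemma integral_fraction_poly (F : fieldType) (S : fieldType)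
    (f : {rmorphism {poly F} -> S}) (c d : {poly F}) (s : S) :
    injective f -> d != 0 -> f d * s = f c -> integralOver f s ->
  exists q, s = f q.
Proof.
move=> f_inj d0 ds [P mP Ps].
pose g := gcdp c d.
have g0 : g != 0 by rewrite gcdp_eq0 negb_and d0 orbT.
pose c' := c %/ g; pose d' := d %/ g.
have cE : c = c' * g by rewrite divpK ?dvdp_gcdl.
have dE : d = d' * g by rewrite divpK ?dvdp_gcdr.
have co : coprimep c' d' by rewrite coprimep_div_gcd ?d0 ?orbT.
have d'0 : d' != 0 by apply: contraNneq d0 => d'0; rewrite dE d'0 mul0r.
have ds' : f d' * s = f c'.
  apply: (mulIf (x := f g)); first by rewrite -(rmorph0 f) (inj_eq f_inj).
  by rewrite mulrAC -!rmorphM -dE -cE.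
pose m := (size P).-1.
have sP : size P = m.+1 by rewrite polySpred // monic_neq0.
have E : \sum_(i < m.+1) P`_i * c' ^+ i * d' ^+ (m - i) = 0.
  apply: f_inj; rewrite rmorph0 rmorph_sum /=.
  transitivity (f d' ^+ m * (map_poly f P).[s]).
    rewrite (@horner_coef_wide _ m.+1); last by rewrite -sP size_poly.
    rewrite mulr_sumr; apply: eq_bigr => i _.
    rewrite !(rmorphXn, rmorphM) /= coef_map -ds' exprMn.
    have -> : f d' ^+ m = f d' ^+ i * f d' ^+ (m - i).
      by rewrite -exprD subnKC // -ltnS.
    by ring.
  by move/rootP: Ps => Ps; rewrite [X in _ * X]Ps mulr0.
have dv : d' %| c' ^+ m.
  move: E; rewrite big_ord_recr /= subnn expr0 mulr1.
  have -> : P`_m = 1 by move/monicP: mP.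
  move/eqP; rewrite mul1r addrC addr_eq0 => /eqP ->.
  rewrite -mulN1r; apply: dvdp_mull.
  have -> : \sum_(i < m) P`_i * c' ^+ i * d' ^+ (m - i) =
            d' * \sum_(i < m) P`_i * c' ^+ i * d' ^+ (m - i).-1.
    rewrite mulr_sumr; apply: eq_bigr => i _.
    by rewrite mulrCA -exprS prednK // subn_gt0.
  exact: dvdp_mulIl.
have : size d' == 1%N.
  rewrite -dvdp1; have : coprimep d' (c' ^+ m) by rewrite coprimep_sym coprimep_expl.
  by move/Gauss_dvdpl => <-; rewrite ?mul1r.
move/size_poly1P => [b b0 d'E].
exists (b^-1 *: c').
have fb0 : f d' != 0 by rewrite -(rmorph0 f) (inj_eq f_inj).
apply: (mulfI fb0); rewrite ds' -rmorphM d'E mul_polyC scalerA mulfV //.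
by rewrite scale1r.
Qed.

(** * Rationality by Lagrange interpolation *)

Section Rational.
Variables (R : idomainType) (S : fieldType) (f : {rmorphism R -> S}).
Variables (I : finType) (z : I -> S) (Phi : {poly R}).
Hypotheses (f_inj : injective f) (z_inj : injective z).
Hypothesis PhiE : map_poly f Phi = \prod_i ('X - (z i)%:P).

Let f_neq0 a : a != 0 -> f a != 0.
Proof. by rewrite -(rmorph0 f) (inj_eq f_inj). Qed.

(* g agrees at the z i with one and the same rational function over R. *)
Definition rational (g : I -> S) := exists (H : {poly R}) (d : R),
  d != 0 /\ forall i, f d * g i = (map_poly f H).[z i].

Lemma eq_rational g g' : g =1 g' -> rational g -> rational g'.
Proof. by move=> gg' [H [d [d0 E]]]; exists H, d; split=> // i; rewrite -gg'. Qed.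

Lemma rational_const c : rational (fun=> f c).
Proof.
exists c%:P, 1; split=> [|i]; first exact: oner_neq0.
by rewrite rmorph1 mul1r map_polyC hornerC.
Qed.

Lemma rational_poly (H : {poly R}) : rational (fun i => (map_poly f H).[z i]).
Proof. by exists H, 1; split=> [|i]; rewrite ?oner_neq0 // rmorph1 mul1r. Qed.

Lemma rational_add g g' :
  rational g -> rational g' -> rational (fun i => g i + g' i).
Proof.
move=> [H [d [d0 E]]] [H' [d' [d'0 E']]].
exists (d' *: H + d *: H'), (d * d'); split=> [|i]; first by rewrite mulf_neq0.
rewrite rmorphD /= !map_polyZ hornerD !hornerZ -E -E' rmorphM; ring.
Qed.

Lemma rational_mul g g' :
  rational g -> rational g' -> rational (fun i => g i * g' i).
Proof.
move=> [H [d [d0 E]]] [H' [d' [d'0 E']]].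
exists (H * H'), (d * d'); split=> [|i]; first by rewrite mulf_neq0.
rewrite !rmorphM /= hornerM -E -E'; ring.
Qed.

Lemma rational_sum (J : Type) (r : seq J) (g : J -> I -> S) :
  (forall j, rational (g j)) -> rational (fun i => \sum_(j <- r) g j i).
Proof.
move=> rg; elim: r => [|j r IH].
  apply: (eq_rational (g := fun=> f 0)); last exact: rational_const.
  by move=> i; rewrite big_nil rmorph0.
apply: (eq_rational (g := fun i => g j i + \sum_(j <- r) g j i)).
  by move=> i; rewrite big_cons.
exact: rational_add.
Qed.

Lemma rational_prod (J : Type) (r : seq J) (g : J -> I -> S) :
  (forall j, rational (g j)) -> rational (fun i => \prod_(j <- r) g j i).
Proof.
move=> rg; elim: r => [|j r IH].
  apply: (eq_rational (g := fun=> f 1)); last exact: rational_const.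
  by move=> i; rewrite big_nil rmorph1.
apply: (eq_rational (g := fun i => g j i * \prod_(j <- r) g j i)).
  by move=> i; rewrite big_cons.
exact: rational_mul.
Qed.

Lemma rational_exp g n : rational g -> rational (fun i => g i ^+ n).
Proof.
move=> rg; apply: (eq_rational (g := fun i => \prod_(j <- iota 0 n) g i)).
  by move=> i; rewrite big_const_seq count_predT size_iota iter_mulr_1.
exact: rational_prod.
Qed.

(** As g has no zero, H vanishes at no z i, so its gcd with Phi, a divisor of the product of the X -
    z i, is constant. A Bezout relation then inverts H at all z i; over a mere domain it holds up to
    nonzero scalars, which the denominator in [rational] absorbs. *)
Lemma rational_inv g :
  (forall i, g i != 0) -> rational g -> rational (fun i => (g i)^-1).
Proof.
move=> g0 [H [d [d0 E]]].
pose D := gcdp H Phi.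
have Phi0 : Phi != 0.
  apply/eqP => Phi0; have := PhiE; rewrite Phi0 rmorph0 => /esym/eqP.
  by rewrite (negPf (monic_neq0 (monic_prod_XsubC _ _ _))).
have D0 : D != 0 by rewrite gcdp_eq0 negb_and Phi0 orbT.
have root_dvd (p : {poly R}) i : D %| p -> (map_poly f D).[z i] = 0 ->
    (map_poly f p).[z i] = 0.
  case/Pdiv.Idomain.dvdpP => -[c w] /= c0 /(congr1 (map_poly f)).
  rewrite map_polyZ rmorphM => /(congr1 (horner^~ (z i))) E1 Dz.
  move: E1; rewrite /= hornerZ hornerM Dz mulr0 => /eqP.
  by rewrite mulf_eq0 (negPf (f_neq0 c0)) => /eqP.
have Dz i : (map_poly f D).[z i] != 0.
  apply/eqP => /(root_dvd H i (dvdp_gcdl _ _)); rewrite -E => /eqP.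
  by rewrite mulf_eq0 (negPf (f_neq0 d0)) (negPf (g0 i)).
have [[c w] /= c0 Dw] := Pdiv.Idomain.dvdpP _ _ (dvdp_gcdr H Phi).
have : map_poly f D %| \prod_i ('X - (z i)%:P).
  rewrite -PhiE -(dvdpZr _ _ (f_neq0 c0)) -map_polyZ Dw rmorphM.
  exact: dvdp_mulIr.
move/dvdp_prod_XsubC => [m].
case: (mask m (index_enum I)) => [|i s].
  rewrite big_nil => /eqp_size; rewrite size_poly1 (size_map_inj_poly f_inj (rmorph0 f)).
  move/eqP/size_poly1P => [b b0 Db].
  have [[u v] /= /eqpP [[a1 a2] /= /andP[a10 a20] B]] := Bezoutp H Phi.
  exists (a1 * d *: u), (a2 * b); split=> [|i]; first by rewrite mulf_neq0.
  have Hz : f (a2 * b) = f a1 * (map_poly f u).[z i] * (f d * g i).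
    rewrite E; have /(congr1 (fun q => (map_poly f q).[z i])) := B.
    rewrite -/D Db !map_polyZ /= rmorphD !rmorphM map_polyC.
    rewrite !hornerZ hornerD !hornerM hornerC => <-.
    suff -> : (map_poly f Phi).[z i] = 0 by ring.
    by rewrite PhiE (bigD1 i) //= hornerM hornerXsubC subrr mul0r.
  by rewrite Hz map_polyZ hornerZ rmorphM; field; apply: g0.
rewrite big_cons => /eqp_root/(_ (z i)).
by rewrite rootM root_XsubC eqxx /= => /rootP/eqP; rewrite (negPf (Dz i)).
Qed.

(* The trace is read off the top coefficient of the Lagrange interpolation
   polynomial of the values g i * Phi'(z i), which is H * Phi' mod Phi. *)
Lemma rational_trace g : Phi \is monic -> rational g ->
  exists c d, d != 0 /\ f d * \sum_i g i = f c.
Proof.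
move=> mPhi [H [d [d0 E]]].
pose V i := \prod_(j | j != i) ('X - (z j)%:P).
have PhiV i : map_poly f Phi = ('X - (z i)%:P) * V i by rewrite PhiE (bigD1 i).
have sP : size (map_poly f Phi) = #|I|.+1.
  by rewrite PhiE size_prod_XsubC cardT enumT [index_enum I]unlock.
have mV i : V i \is monic by apply: monic_prod_XsubC.
have sV i : size (V i) = #|I|.
  apply/eqP; rewrite -eqSS -sP (PhiV i) size_monicM ?monicXsubC ?monic_neq0 //.
  by rewrite size_XsubC.
pose G := Pdiv.Ring.rmodp (H * Phi^`()) Phi.
have Gz i : (map_poly f G).[z i] = (map_poly f H).[z i] * (V i).[z i].
  have := Pdiv.RingMonic.rdivp_eq mPhi (H * Phi^`()).
  move=> /(congr1 (fun q => (map_poly f q).[z i])).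
  rewrite -/G !rmorphD !rmorphM /= hornerD !hornerM.
  have -> : (map_poly f Phi).[z i] = 0.
    by rewrite (PhiV i) hornerM hornerXsubC subrr mul0r.
  rewrite mulr0 add0r => <-; congr (_ * _).
  rewrite -deriv_map (PhiV i) derivM derivXsubC hornerD !hornerM.
  by rewrite hornerXsubC subrr mul0r addr0 hornerC mul1r.
pose L := \sum_i (map_poly f H).[z i] *: V i.
have GL : map_poly f G = L.
  apply/eqP; rewrite -subr_eq0; apply/eqP.
  apply: (@roots_geq_poly_eq0 _ _ [seq z i | i <- enum I]).
  - apply/allP => _ /mapP[i _ ->]; apply/rootP.
    rewrite hornerD hornerN Gz /L horner_sum (bigD1 i) //= hornerZ.
    rewrite big1 ?addr0 ?subrr // => j ji.
    by rewrite hornerZ horner_prod (bigD1 i) 1?eq_sym //= hornerXsubC subrr mul0r mulr0.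
  - by rewrite map_inj_uniq ?enum_uniq.
  rewrite size_map -cardE; apply: (leq_trans (size_polyD _ _)).
  rewrite size_polyN geq_max; apply/andP; split.
    rewrite -ltnS -sP !(size_map_inj_poly f_inj (rmorph0 f)).
    by rewrite Pdiv.Ring.ltn_rmodp monic_neq0.
  apply: (leq_trans (size_sum _ _ _)); apply/bigmax_leqP => i _.
  by rewrite -(sV i) size_scale_leq.
exists (G`_(#|I|.-1)), d; split=> //.
rewrite -coef_map /= GL /L coef_sum mulr_sumr; apply: eq_bigr => i _.
by rewrite coefZ -E -(sV i) -/(lead_coef _) (monicP (mV i)) mulr1.
Qed.

End Rational.

(** * Characteristic 2 and integral elements *)

Section Char2.
Variables (R : comNzRingType) (two0 : 1 + 1 = 0 :> R).
Implicit Types x y : R.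

Lemma char2_addrr x : x + x = 0.
Proof. by rewrite -mulr2n -mulr_natr mulr2n two0 mulr0. Qed.

Lemma char2_oppr x : - x = x.
Proof. by apply/esym/eqP; rewrite -subr_eq0 opprK char2_addrr. Qed.

Lemma char2_sqrrD x y : (x + y) ^+ 2 = x ^+ 2 + y ^+ 2.
Proof. by rewrite sqrrD mulr2n char2_addrr addr0. Qed.

End Char2.

Lemma char2_sqr_inj (F : fieldType) (two0 : 1 + 1 = 0 :> F) (x y : F) :
  x ^+ 2 = y ^+ 2 -> x = y.
Proof. by move/eqP; rewrite eqf_sqr char2_oppr // orbb => /eqP. Qed.

Section Integral.
Variables (R K : comNzRingType) (f : {rmorphism R -> K}).

Lemma integral_root_exp n (u : K) :
  (0 < n)%N -> integralOver f (u ^+ n) -> integralOver f u.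
Proof.
move=> n0 iu; apply: (@integral_root_monic _ _ _ u ('X^n - (u ^+ n)%:P)).
- exact: monicXnsubC.
- by apply/rootP; rewrite hornerD hornerN hornerXn hornerC subrr.
apply/integral_poly => i; rewrite coefB coefXn coefC.
apply: integral_sub; first exact: integral_nat.
by case: ifP => // _; apply: integral0.
Qed.

Lemma integral_prod (J : Type) (r : seq J) (g : J -> K) :
  (forall j, integralOver f (g j)) -> integralOver f (\prod_(j <- r) g j).
Proof.
by move=> ig; elim/big_ind: _ => //; [apply: integral1 | move=> x y; apply: integral_mul].
Qed.

Lemma integral_sum (J : Type) (r : seq J) (g : J -> K) :
  (forall j, integralOver f (g j)) -> integralOver f (\sum_(j <- r) g j).
Proof.
by move=> ig; elim/big_ind: _ => //; [apply: integral0 | move=> x y; apply: integral_add].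
Qed.

Lemma integral_exp n (u : K) : integralOver f u -> integralOver f (u ^+ n).
Proof.
move=> iu; elim: n => [|n IH]; first by rewrite expr0; apply: integral1.
by rewrite exprS; apply: integral_mul.
Qed.

End Integral.

(** * Descent of symmetric sums to polynomials *)

Section Descent.
Variables (p h : nat) (F S : fieldType) (f : {rmorphism {poly F} -> S}).
Variables (L : finType) (E T : L -> nat -> S).
Hypotheses (ph : p = h.*2.+1) (p_pr : prime p) (p_gt3 : (3 < p)%N).
Hypotheses (two0 : 1 + 1 = 0 :> S) (f_inj : injective f) (cardL : #|L| = h.*2.+2).
Hypothesis ET_periodic : forall l a b, (a = b %[mod p] \/ p %| a + b)%N ->
  E l a = E l b /\ T l a = T l b.
Hypothesis E0 : forall l, E l 0 = 1.
Hypothesis E_neq0 : forall l a, ~~ (p %| a)%N -> E l a != 0.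
Hypothesis T_neq0 : forall l a, ~~ (p %| a)%N -> T l a != 0.
Hypothesis T2 : forall l a,
  T l a.*2 = f 'X ^+ 3 * T l a ^+ 2 * E l a ^+ 2.
Hypothesis TB : forall l a b, (b <= a)%N -> T l (a + b) * T l (a - b) =
  T l a ^+ 2 * E l b ^+ 2 + E l a ^+ 2 * T l b ^+ 2.
Hypothesis EB : forall l a b, (b <= a)%N -> E l (a + b) * E l (a - b) =
  E l a ^+ 2 * E l b ^+ 2 + T l a ^+ 2 * T l b ^+ 2.

Let z (x : L * 'I_h) := E x.1 x.2.+1 / T x.1 x.2.+1.
Hypothesis z_inj : injective z.
Hypothesis trace_neq0 : forall l, \sum_(i < h) T l i.+1 / E l i.+1 != 0.

Let addrr := char2_addrr two0.

Let E2 l a : E l a.*2 = E l a ^+ 4 + T l a ^+ 4.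
Proof.
have := EB l (leqnn a); rewrite subnn E0 mulr1 addnn => ->.
by rewrite -!exprD.
Qed.

Let ndvd_half (i : 'I_h) : ~~ (p %| i.+1)%N.
Proof. by rewrite gtnNdvd // ph; have := ltn_ord i; lia. Qed.

(** The odd-index relations are the addition formulas at (k + 1) a and k a, whose difference is
    a. *)
Lemma theta_seq_mul l a : ~~ (p %| a)%N ->
  theta_seq 'X^3 f (fun k => E l (a * k)) (fun k => T l (a * k)).
Proof.
move=> pa; split; rewrite ?muln1 ?E_neq0 ?T_neq0 // => k; rewrite -?doubleMr.
- by rewrite T2 rmorphXn.
- exact: E2.
- rewrite char2_sqrrD // !exprMn -TB ?leq_mul //.
  by congr (T l _ * T l _); rewrite -?mulnDr -?mulnBr ?subSnn ?muln1 //; congr muln; lia.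
rewrite char2_sqrrD // !exprMn -EB ?leq_mul //.
by congr (E l _ * E l _); rewrite -?mulnDr -?mulnBr ?subSnn ?muln1 //; congr muln; lia.
Qed.

(** Since h + 1 = -h modulo p, the values at (h + 1) a and h a coincide, so T (h+1) E h + E (h+1) T
    h is twice a product, which is 0. The degree equals the number of pairs of a line and a residue
    up to sign. *)
Lemma division_poly : exists Phi : {poly {poly F}},
  [/\ Phi \is monic, size Phi = (h * h.*2.+2).+1 &
   forall l a, ~~ (p %| a)%N -> root (map_poly f Phi) (E l a / T l a)].
Proof.
have h0 : (0 < h)%N by lia.
have [e [t L1]] := ladderP ('X^3 : {poly F}) h0.
have [e' [t' L2]] := ladderP ('X^3 : {poly F}) (ltn0Sn h).
have [mP sP _] := ladder_odd h0 L1 L2.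
exists (t' * e + e' * t); split=> //; first by rewrite sP; lia.
move=> l a pa; have TS := theta_seq_mul l pa.
have [hE hT] := lad_eval L1 TS; have [hE' hT'] := lad_eval L2 TS.
rewrite !muln1 in hE hT hE' hT'.
have [EE TT] : E l (a * h.+1) = E l (a * h) /\ T l (a * h.+1) = T l (a * h).
  apply: ET_periodic; right; rewrite -mulnDr dvdn_mull //.
  by rewrite ph; apply/eqP; rewrite -addnn -addSn modnn.
apply/rootP; apply: (mulfI (expf_neq0 (h ^ 2 + h.+1 ^ 2) (T_neq0 l pa))).
rewrite mulr0 rmorphD !rmorphM /= hornerD !hornerM exprD.
transitivity (T l (a * h.+1) * E l (a * h) + E l (a * h.+1) * T l (a * h)).
  by rewrite hE hT hE' hT'; ring.
by rewrite EE TT [T l _ * _]mulrC addrr.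
Qed.

Lemma integral_theta_ratio l a : ~~ (p %| a)%N -> integralOver f (E l a / T l a).
Proof.
move=> pa; have [Phi [mP _ rP]] := division_poly.
by exists Phi => //; apply: rP.
Qed.

Lemma ndvd_mul a b : ~~ (p %| a)%N -> ~~ (p %| b)%N -> ~~ (p %| a * b)%N.
Proof. by move=> pa pb; rewrite Euclid_dvdM // negb_or pa. Qed.

Lemma ndvd2 : ~~ (p %| 2)%N. Proof. by rewrite gtnNdvd //; lia. Qed.
Lemma ndvd3 : ~~ (p %| 3)%N. Proof. by rewrite gtnNdvd //; lia. Qed.

(* At twice a point the ratio z = E / T becomes (z + 1/z)^2 / X^3, so 1/z is
   a root of a monic quartic with integral coefficients. *)
Lemma integral_theta_ratioV l a :
  ~~ (p %| a)%N -> integralOver f (T l a / E l a).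
Proof.
move=> pa; set w := T l a / E l a.
have pa2 : ~~ (p %| a.*2)%N by rewrite -muln2 ndvd_mul ?ndvd2.
set c := f 'X ^+ 3 * (E l a.*2 / T l a.*2).
have ic : integralOver f c.
  apply: integral_mul; last exact: integral_theta_ratio.
  by apply: integral_exp; apply: integral_id.
apply: (@integral_root_monic _ _ _ w ('X^4 + (c *: 'X^2 + 1))).
- rewrite monicE lead_coefDl ?lead_coefXn // size_polyXn.
  apply: (leq_ltn_trans (size_polyD _ _)); rewrite size_poly1 gtn_max andbT.
  by apply: (leq_ltn_trans (size_scale_leq _ _)); rewrite size_polyXn.
- apply/rootP; rewrite !(hornerD, hornerZ, hornerXn, hornerC).
  have -> : c * w ^+ 2 = 1 + w ^+ 4.
    have [e0 t0] := (E_neq0 l pa, T_neq0 l pa).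
    have X0 : f 'X != 0 by rewrite -(rmorph0 f) (inj_eq f_inj) polyX_eq0.
    rewrite /c /w E2 T2; field; by rewrite X0 e0 t0.
  by rewrite [1 + w ^+ 4]addrC -addrA addrr addr0 addrr.
apply/integral_poly => i; rewrite !(coefD, coefZ, coefXn, coef1).
apply: integral_add; first exact: integral_nat.
apply: integral_add; last exact: integral_nat.
by apply: integral_mul => //; apply: integral_nat.
Qed.

Let Pi l := \prod_(i < h) T l i.+1.

Let Pi_neq0 l : Pi l != 0.
Proof. by rewrite prodf_seq_neq0; apply/allP => i _; rewrite T_neq0. Qed.

Lemma prod_theta_mul l c : ~~ (p %| c)%N ->
  \prod_(i < h) T l (c * i.+1) = Pi l.
Proof.
move=> pc; apply: (big_half_residues _ (G := T l) ph p_pr pc).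
by move=> a b ab; case: (ET_periodic l ab).
Qed.

(** Doubling permutes the residues, so the product of the duplication formulas reads Pi = X^(3h)
    Pi^2 prod E^2. Hence the cube of X^h Pi is the product of the (T / E)^2, which are integral. *)
Lemma integral_theta_prod l : integralOver f (f 'X ^+ h * Pi l).
Proof.
apply: (@integral_root_exp _ _ _ 3) => //.
have -> : (f 'X ^+ h * Pi l) ^+ 3 = \prod_(i < h) (T l i.+1 / E l i.+1) ^+ 2.
  have key : Pi l = (f 'X ^+ 3) ^+ h * Pi l ^+ 2 * \prod_(i < h) E l i.+1 ^+ 2.
    rewrite -{1}(prod_theta_mul l ndvd2) -prodrXl.
    have -> : (f 'X ^+ 3) ^+ h = \prod_(i < h) f 'X ^+ 3.
      by rewrite prodr_const card_ord.
    rewrite -!big_split /=.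
    by apply: eq_bigr => i _; rewrite mul2n T2.
  have e0 : \prod_(i < h) E l i.+1 ^+ 2 != 0.
    by rewrite prodf_seq_neq0; apply/allP => i _; rewrite expf_neq0 // E_neq0.
  apply: (mulIf e0); rewrite -big_split /=.
  transitivity (Pi l ^+ 2).
    rewrite [RHS]expr2 [X in _ = Pi l * X]key exprMn -!exprM [(h * 3)%N]mulnC; ring.
  rewrite -prodrXl; apply: eq_bigr => i _.
  by rewrite expr_div_n divfK // expf_neq0 // E_neq0.
apply: integral_prod => i; apply: integral_exp.
exact: integral_theta_ratioV.
Qed.

(** By the addition formula the square of the factor at x is T(3x) T(x) / (T(x) T(2x))^2.
    Multiplication by 2 and by 3 permutes the residues as p > 3, so the squares multiply to Pi^2 /
    Pi^4. This makes Pi a rational function of the ratio at any single [a]. *)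
Lemma prod_theta_ratio_add l a : ~~ (p %| a)%N ->
  \prod_(i < h) (E l (a * i.+1) / T l (a * i.+1) +
                 E l (a * (2 * i.+1)) / T l (a * (2 * i.+1))) = (Pi l)^-1.
Proof.
move=> pa; apply: (char2_sqr_inj two0); rewrite -prodrXl.
transitivity (\prod_(i < h) (T l (3 * a * i.+1) * T l (a * i.+1) /
   (T l (a * i.+1) * T l (2 * a * i.+1)) ^+ 2)).
  apply: eq_bigr => i _; rewrite char2_sqrrD // !expr_div_n.
  have pi : ~~ (p %| a * i.+1)%N by rewrite ndvd_mul.
  have pi2 : ~~ (p %| 2 * a * i.+1)%N by rewrite -mulnA ndvd_mul ?ndvd2.
  have le : (a * i.+1 <= 2 * a * i.+1)%N by rewrite -mulnA mul2n -addnn leq_addr.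
  have := TB l le.
  have -> : (2 * a * i.+1 + a * i.+1 = 3 * a * i.+1)%N by ring.
  have -> : (2 * a * i.+1 - a * i.+1 = a * i.+1)%N.
    by rewrite -mulnA mul2n -addnn addnK.
  move=> ->; have -> : (a * (2 * i.+1) = 2 * a * i.+1)%N by ring.
  field; by rewrite !T_neq0.
rewrite big_split /= prodfV prodrXl !big_split /= !prod_theta_mul ?ndvd_mul ?ndvd2 ?ndvd3 //.
by field; apply: Pi_neq0.
Qed.

Theorem theta_descent n :
  exists q, \sum_l (f 'X ^+ h * Pi l) ^+ n = f q.
Proof.
have [Phi [mP sP rP]] := division_poly.
have X0 : f 'X != 0 by rewrite -(rmorph0 f) (inj_eq f_inj) polyX_eq0.
have PhiE : map_poly f Phi = \prod_x ('X - (z x)%:P).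
  rewrite (all_roots_prod_XsubC (p := map_poly f Phi)
    (rs := [seq z x | x <- index_enum (L * 'I_h)%type])).
  - rewrite big_map; have /monicP -> : map_poly f Phi \is monic by rewrite monic_map.
    by rewrite scale1r.
  - rewrite (size_map_inj_poly f_inj (rmorph0 f)) sP size_map.
    rewrite [index_enum _]unlock -enumT -cardT card_prod card_ord cardL.
    by rewrite mulnC.
  - by apply/allP => _ /mapP [x _ ->]; apply: rP.
  by rewrite uniq_rootsE map_inj_uniq // index_enum_uniq.
pose rat := rational f z.
(* Multiplying the point by k is the same rational map e / t of z for all pairs. *)
have rat_ratio k : (0 < k)%N -> ~~ (p %| k)%N ->
    rat (fun x : L * 'I_h => E x.1 (x.2.+1 * k) / T x.1 (x.2.+1 * k)).
  move=> k0 pk; have [e [t Lk]] := ladderP ('X^3 : {poly F}) k0.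
  have ev (x : L * 'I_h) : E x.1 (x.2.+1 * k) = T x.1 x.2.+1 ^+ (k ^ 2) * (map_poly f e).[z x]
    /\ T x.1 (x.2.+1 * k) = T x.1 x.2.+1 ^+ (k ^ 2) * (map_poly f t).[z x].
    by have := lad_eval Lk (theta_seq_mul x.1 (ndvd_half x.2)); rewrite !muln1.
  have tz x : (map_poly f t).[z x] != 0.
    have := T_neq0 x.1 (ndvd_mul (ndvd_half x.2) pk).
    by rewrite (ev x).2; apply: contraNneq => ->; rewrite mulr0.
  apply: (eq_rational (g := fun x : L * 'I_h => (map_poly f e).[z x] / (map_poly f t).[z x])).
    move=> x; rewrite (ev x).1 (ev x).2.
    by field; rewrite tz /= expf_neq0 // T_neq0.
  apply: rational_mul; first exact: rational_poly.
  by apply: (rational_inv f_inj PhiE) => //; apply: rational_poly.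
(* The sum of the 1/z on a line. Rewritten over the multiples of any one residue, it becomes
   rational in the ratio at that residue. *)
pose tr l := \sum_(i < h) T l i.+1 / E l i.+1.
have trE (x : L * 'I_h) : tr x.1 = \sum_(j < h) (E x.1 (x.2.+1 * j.+1) / T x.1 (x.2.+1 * j.+1))^-1.
  transitivity (\sum_(j < h) T x.1 (x.2.+1 * j.+1) / E x.1 (x.2.+1 * j.+1)).
    symmetry; apply: (big_half_residues _ (G := fun a => T x.1 a / E x.1 a)
      ph p_pr (ndvd_half x.2)).
    by move=> a b /(ET_periodic x.1) [-> ->].
  by apply: eq_bigr => j _; rewrite invf_div.
have ratio_neq0 l a : ~~ (p %| a)%N -> E l a / T l a != 0.
  by move=> pa; rewrite mulf_neq0 ?invr_eq0 ?E_neq0 ?T_neq0.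
have rat_tr : rat (fun x : L * 'I_h => tr x.1).
  apply: (eq_rational (fun x : L * 'I_h => esym (trE x))).
  apply: rational_sum => j.
  apply: (rational_inv f_inj PhiE); first by move=> x; rewrite ratio_neq0 ?ndvd_mul.
  exact: rat_ratio.
have rat_u : rat (fun x : L * 'I_h => f 'X ^+ h * Pi x.1).
  apply: (eq_rational (g := fun x : L * 'I_h => f ('X ^+ h) * (\prod_(i < h)
     (E x.1 (x.2.+1 * i.+1) / T x.1 (x.2.+1 * i.+1) +
      E x.1 (x.2.+1 * (2 * i.+1)) / T x.1 (x.2.+1 * (2 * i.+1))))^-1)).
    by move=> x; rewrite rmorphXn prod_theta_ratio_add // invrK.
  apply: rational_mul; first exact: rational_const.
  apply: (rational_inv f_inj PhiE).
    by move=> x; rewrite prod_theta_ratio_add ?invr_eq0.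
  apply: rational_prod => i; apply: rational_add; apply: rat_ratio => //.
  by rewrite ndvd_mul ?ndvd2.
(* The weights (1/z) / [tr] add up to 1 on each line, whatever the parity of h. *)
have rat_s : rat (fun x : L * 'I_h => (z x)^-1 / tr x.1 * (f 'X ^+ h * Pi x.1) ^+ n).
  apply: rational_mul; last exact: rational_exp.
  apply: rational_mul; last first.
    by apply: (rational_inv f_inj PhiE) => // x; apply: trace_neq0.
  apply: (rational_inv f_inj PhiE); first by move=> x; apply: ratio_neq0.
  apply: (eq_rational (g := fun x : L * 'I_h => (map_poly f 'X).[z x])).
    by move=> x; rewrite map_polyX hornerX.
  exact: rational_poly.
have [c [d [d0 dc]]] := rational_trace f_inj z_inj PhiE mP rat_s.
apply: (integral_fraction_poly f_inj d0 (c := c)); last first.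
  by apply: integral_sum => l; apply: integral_exp; apply: integral_theta_prod.
rewrite -dc; congr (_ * _).
rewrite -(pair_bigA _ (fun l i => (z (l, i))^-1 / tr l * (f 'X ^+ h * Pi l) ^+ n)) /=.
apply: eq_bigr => l _; rewrite -mulr_suml -mulr_suml.
suff -> : \sum_(i < h) (z (l, i))^-1 = tr l.
  by rewrite mulfV ?mul1r //; apply: trace_neq0.
by apply: eq_bigr => i _; rewrite /z invf_div.
Qed.

End Descent.

(** Only the supports have to correspond: the finite boxes over which series are truncated do not
    match under a change of variables. *)
Lemma sum_support_bij (V : nmodType) (I J : eqType) (s : seq I) (t : seq J)
    (F : I -> V) (G : J -> V) (u : I -> J) (v : J -> I) :
    uniq s -> uniq t ->
    (forall i, i \in s -> F i != 0 -> [/\ u i \in t, v (u i) = i & G (u i) = F i]) ->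
    (forall j, j \in t -> G j != 0 -> [/\ v j \in s, u (v j) = j & F (v j) = G j]) ->
  \sum_(i <- s) F i = \sum_(j <- t) G j.
Proof.
move=> us ut FG GF.
have nz (K : eqType) (r : seq K) (H : K -> V) :
    \sum_(i <- r) H i = \sum_(i <- [seq i <- r | H i != 0]) H i.
  rewrite big_filter [RHS]big_mkcond /=; apply: eq_bigr => i _.
  by case: eqVneq => [->| ].
rewrite (nz _ s) (nz _ t).
rewrite (perm_big [seq u i | i <- [seq i <- s | F i != 0]] (op := +%R)) /=.
  rewrite big_map; apply: eq_big_seq => i; rewrite mem_filter => /andP[Fi si].
  by have [_ _ ->] := FG i si Fi.
apply: uniq_perm; first by rewrite filter_uniq.
  rewrite map_inj_in_uniq ?filter_uniq // => i i'.
  rewrite !mem_filter => /andP[Fi si] /andP[Fi' si'] E.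
  by have [_ <- _] := FG i si Fi; have [_ <- _] := FG i' si' Fi'; rewrite E.
move=> j; rewrite mem_filter; apply/andP/mapP => [[Gj tj]|[i]].
  have [vs uv Fv] := GF j tj Gj; exists (v j) => //.
  by rewrite mem_filter Fv Gj.
rewrite mem_filter => /andP[Fi si] ->.
by have [ti _ ->] := FG i si Fi.
Qed.

(** * Formal power series *)

Section Coefficients.
Variable R : comNzRingType.
Implicit Types (f g : fps R) (a b c : R) (m n M : nat).

Lemma fcoef_sum (I : Type) (r : seq I) (P : pred I) (F : I -> fps R) m :
  (\sum_(i <- r | P i) F i).[|m|] = \sum_(i <- r | P i) (F i).[|m|].
Proof. by elim/big_rec2: _ => // i x y _ <-; rewrite fcoefD. Qed.

Definition mono a n : fps R := Fps (fun m => if m == n then a else 0).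

Lemma coef_monoM a n f m :
  (mono a n * f).[|m|] = if (n <= m)%N then a * f.[|m - n|] else 0.
Proof.
rewrite fcoefM /=; case: leqP => nm.
  have nm1 : (n < m.+1)%N by [].
  rewrite (bigD1 (Ordinal nm1)) //= eqxx big1 ?addr0 // => i ni.
  by case: eqP => [E| ]; [case/eqP: ni; apply: val_inj | rewrite mul0r].
rewrite big1 // => i _; case: eqP => [E| ]; last by rewrite mul0r.
by have := ltn_ord i; rewrite E ltnS leqNgt nm.
Qed.

Lemma monoM a b m n : mono a m * mono b n = mono (a * b) (m + n).
Proof.
apply/fpsP => l; rewrite coef_monoM /=; case: leqP => ml.
  by rewrite -(eqn_add2l m) subnKC //; case: eqP; rewrite ?mulr0.
by case: eqP => // E; move: ml; rewrite E ltnNge leq_addr.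
Qed.

Lemma mono1 : mono 1 0 = 1.
Proof. by apply/fpsP => m /=; case: eqP. Qed.

Lemma monoX a m n : mono a m ^+ n = mono (a ^+ n) (m * n).
Proof.
elim: n => [|n IH]; first by rewrite !expr0 muln0 mono1.
by rewrite !exprS IH monoM mulnS.
Qed.

Lemma mono_prod (I : Type) (r : seq I) (a : I -> R) (n : I -> nat) :
  \prod_(i <- r) mono (a i) (n i) =
  mono (\prod_(i <- r) a i) (\sum_(i <- r) n i).
Proof.
elim: r => [|i r IH]; first by rewrite !big_nil mono1.
by rewrite !big_cons IH monoM.
Qed.

(** [c] may be 0: then [n] only bounds the order from below, which lets terms of higher order take
    part in a sum at level [n]. *)
Definition lead n c f := (forall m, (m < n)%N -> f.[|m|] = 0) /\ f.[|n|] = c.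

Lemma leadM m n a b f g : lead m a f -> lead n b g -> lead (m + n) (a * b) (f * g).
Proof.
move=> [f0 fm] [g0 gn]; split=> [l lmn| ]; rewrite fcoefM.
  apply: big1 => i _; have [im|mi] := ltnP i m; first by rewrite f0 ?mul0r.
  by rewrite g0 ?mulr0 //; have := ltn_ord i; lia.
have mmn : (m < (m + n).+1)%N by rewrite ltnS leq_addr.
rewrite (bigD1 (Ordinal mmn)) //= fm addKn gn big1 ?addr0 // => i ni.
have [im|mi] := ltnP i m; first by rewrite f0 ?mul0r.
rewrite g0 ?mulr0 //; have := ltn_ord i.
have : val i != m by apply: contraNneq ni => E; apply/eqP/val_inj.
by move=> /= ? ?; lia.
Qed.

Lemma lead1 : lead 0 1 1.
Proof. by split=> // m; rewrite ltn0. Qed.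

Lemma lead_prod (I : Type) (r : seq I) (n : I -> nat) (c : I -> R) (f : I -> fps R) :
  (forall i, lead (n i) (c i) (f i)) ->
  lead (\sum_(i <- r) n i) (\prod_(i <- r) c i) (\prod_(i <- r) f i).
Proof.
move=> H; elim: r => [|i r IH]; first by rewrite !big_nil; apply: lead1.
by rewrite !big_cons; apply: leadM.
Qed.

Lemma lead_exp n c f m : lead n c f -> lead (n * m) (c ^+ m) (f ^+ m).
Proof.
move=> H; elim: m => [|m IH]; first by rewrite muln0; apply: lead1.
by rewrite mulnS !exprS; apply: leadM.
Qed.

Lemma lead_inj m n a b f : a != 0 -> b != 0 ->
  lead m a f -> lead n b f -> m = n /\ a = b.
Proof.
move=> a0 b0 [fm am] [fn bn].
have mn : m = n.
  apply/eqP; rewrite eqn_leq; apply/andP; split; rewrite leqNgt; apply/negP.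
    by move=> /fm; rewrite bn => /eqP; rewrite (negPf b0).
  by move=> /fn; rewrite am => /eqP; rewrite (negPf a0).
by split=> //; rewrite -am -bn mn.
Qed.

Lemma lead_neq0 n c f : c != 0 -> lead n c f -> f != 0.
Proof. by move=> c0 [_ fc]; apply: contraNneq c0 => f0; rewrite -fc f0. Qed.

Lemma lead_higher m n c f : lead n c f -> (m < n)%N -> lead m 0 f.
Proof. by move=> [f0 _] mn; split=> [l lm| ]; apply: f0 => //; lia. Qed.

Lemma lead_exists f : f != 0 -> exists n c, c != 0 /\ lead n c f.
Proof.
move=> f0; have ex : exists n, f.[|n|] != 0.
  apply: contrapT => nex; case/eqP: f0; apply/fpsP => m; rewrite fcoef0.
  by apply/eqP; apply: contrapT => /negP fm; apply: nex; exists m.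
exists (ex_minn ex), f.[|ex_minn ex|]; case: ex_minnP => n fn mn.
split=> //; split=> // m mn'; apply/eqP; apply: contraTT mn' => /mn.
by rewrite -leqNgt.
Qed.

(** Congruence modulo x^M. Infinite products never appear; identities are proved with finite
    products modulo every power of x. *)
Definition eqm M f g := forall m, (m < M)%N -> f.[|m|] = g.[|m|].

Lemma eqm_sym M f g : eqm M f g -> eqm M g f.
Proof. by move=> fg m /fg. Qed.

Lemma eqm_trans M f g e : eqm M f g -> eqm M g e -> eqm M f e.
Proof. by move=> fg ge m mM; rewrite fg ?ge. Qed.

Lemma eqm_le M N f g : (N <= M)%N -> eqm M f g -> eqm N f g.
Proof. by move=> NM fg m mN; apply: fg; apply: leq_trans NM. Qed.

Lemma eqm_eq f g : (forall M, eqm M f g) -> f = g.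
Proof. by move=> fg; apply/fpsP => m; apply: (fg m.+1). Qed.

Lemma eqmM M f g f' g' : eqm M f g -> eqm M f' g' -> eqm M (f * f') (g * g').
Proof.
move=> fg fg' m mM; rewrite !fcoefM; apply: eq_bigr => i _.
by rewrite fg ?fg' //; have := ltn_ord i; lia.
Qed.

Lemma eqmD M f g f' g' : eqm M f g -> eqm M f' g' -> eqm M (f + f') (g + g').
Proof. by move=> fg fg' m mM; rewrite !fcoefD fg ?fg'. Qed.

Lemma eqmX M f g n : eqm M f g -> eqm M (f ^+ n) (g ^+ n).
Proof.
move=> fg; elim: n => [|n IH] //.
by rewrite !exprS; apply: eqmM.
Qed.

Lemma eqm_prod (I : Type) (r : seq I) M (f g : I -> fps R) :
  (forall i, eqm M (f i) (g i)) -> eqm M (\prod_(i <- r) f i) (\prod_(i <- r) g i).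
Proof.
move=> fg; elim: r => [|i r IH]; first by rewrite !big_nil.
by rewrite !big_cons; apply: eqmM.
Qed.

Lemma eqm_sum (I : Type) (r : seq I) M (f g : I -> fps R) :
  (forall i, eqm M (f i) (g i)) -> eqm M (\sum_(i <- r) f i) (\sum_(i <- r) g i).
Proof.
move=> fg; elim: r => [|i r IH]; first by rewrite !big_nil.
by rewrite !big_cons; apply: eqmD.
Qed.

Lemma eqm_mono M a n f g :
  eqm (M - n) f g -> eqm M (mono a n * f) (mono a n * g).
Proof.
move=> fg m mM; rewrite !coef_monoM; case: leqP => // nm.
by rewrite fg //; lia.
Qed.

Lemma eqm_cancel M u f g : u.[|0|] = 1 -> eqm M (u * f) (u * g) -> eqm M f g.
Proof.
move=> u0 ufg m; elim/ltn_ind: m => m IH mM.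
have := ufg m mM; rewrite !fcoefM !big_ord_recl /= subn0 u0 !mul1r.
rewrite [X in _ + X = _](eq_bigr (fun i : 'I_m => u.[|bump 0 i|] * g.[|m - bump 0 i|])).
  exact: addIr.
by move=> i _; rewrite IH // /bump; have := ltn_ord i; lia.
Qed.

End Coefficients.

(** * Power series over a field form an integral domain *)

Section Domain.
Variable k : fieldType.
Implicit Types f g : fps k.

Lemma fps_mulf_eq0 f g : f * g = 0 -> (f == 0) || (g == 0).
Proof.
move=> fg; apply/norP => -[/lead_exists[m [a [a0 fa]]] /lead_exists[n [b [b0 gb]]]].
have := (leadM fa gb).2; rewrite fg fcoef0 => /esym/eqP.
by rewrite mulf_eq0 (negPf a0) (negPf b0).
Qed.

Definition fps_unit f : bool := `[< exists g, g * f = 1 >].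

(** Chosen classically; it serves to declare the integral domain whose fraction field contains 1 /
    eta'. *)
Definition fps_inv f : fps k :=
  if pselect (exists g, g * f = 1) is left e then projT1 (cid e) else f.

Fact fps_mulVf : {in fps_unit, left_inverse 1 fps_inv *%R}.
Proof.
move=> f /asboolP ex; rewrite /fps_inv; case: pselect => // e.
by case: cid.
Qed.

Fact fps_unitP f g : g * f = 1 -> fps_unit f.
Proof. by move=> gf; apply/asboolP; exists g. Qed.

Fact fps_inv_out : {in [predC fps_unit], fps_inv =1 id}.
Proof.
move=> f; rewrite inE /fps_inv; case: pselect => // e /negP[].
by apply/asboolP.
Qed.

HB.instance Definition _ := GRing.ComNzRing_hasMulInverse.Build (fps k)
  fps_mulVf fps_unitP fps_inv_out.

HB.instance Definition _ := GRing.ComUnitRing_isIntegral.Build (fps k)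
  fps_mulf_eq0.

End Domain.

(** * Substitution of c x^A for x *)

Section Substitution.
Variables (R S : comNzRingType) (phi : {rmorphism R -> S}).
Implicit Types (f g : fps R) (c : S) (A : nat).

(* f(c x^A), for A > 0 *)
Definition subst c A f : fps S :=
  Fps (fun m => if (A %| m)%N then c ^+ (m %/ A) * phi f.[|m %/ A|] else 0).

Lemma substD c A f g : subst c A (f + g) = subst c A f + subst c A g.
Proof.
apply/fpsP => m; rewrite [RHS]fcoefD /= rmorphD mulrDr.
by case: ifP => // _; rewrite addr0.
Qed.

Lemma subst0 c A : subst c A 0 = 0.
Proof. by apply/fpsP => m /=; rewrite rmorph0 mulr0 if_same. Qed.

Lemma subst_sum c A (I : Type) (r : seq I) (F : I -> fps R) :
  subst c A (\sum_(i <- r) F i) = \sum_(i <- r) subst c A (F i).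
Proof.
elim: r => [|i r IH]; first by rewrite !big_nil subst0.
by rewrite !big_cons substD IH.
Qed.

Lemma subst1 c A : (0 < A)%N -> subst c A 1 = 1.
Proof.
move=> A0; apply/fpsP => m /=.
have [->|m0] := eqVneq m 0%N; first by rewrite dvdn0 div0n mul1r rmorph1.
case: ifP => // Am; have /negbTE -> : (m %/ A != 0)%N.
  by rewrite -lt0n divn_gt0 // dvdn_leq // lt0n.
by rewrite rmorph0 mulr0.
Qed.

Lemma substM c A f g : (0 < A)%N ->
  subst c A (f * g) = subst c A f * subst c A g.
Proof.
move=> A0; apply/fpsP => m; rewrite fcoefM /=.
case: ifP => [/dvdnP[q ->]|Am]; last first.
  rewrite big1 // => i _; case: ifP => Ai; last by rewrite mul0r.
  case: ifP => Ami; last by rewrite mulr0.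
  have im : (i <= m)%N by rewrite -ltnS.
  by have := dvdn_add Ami Ai; rewrite subnK // Am.
rewrite mulnK // rmorph_sum mulr_sumr /=.
pose F i := c ^+ q * phi (f.[|i|] * g.[|q - i|]).
pose G i := (if (A %| i)%N then c ^+ (i %/ A) * phi f.[|i %/ A|] else 0) *
  (if (A %| q * A - i)%N then c ^+ ((q * A - i) %/ A) * phi g.[|(q * A - i) %/ A|]
   else 0).
have GF i : (i <= q)%N -> G (i * A)%N = F i.
  move=> iq; rewrite /G -mulnBl !dvdn_mull // !mulnK // /F rmorphM.
  by rewrite -{3}(subnKC iq) exprD; ring.
transitivity (\sum_(0 <= i < q.+1) F i); first by rewrite big_mkord.
transitivity (\sum_(0 <= i < (q * A).+1) G i); last by rewrite big_mkord.
apply: (sum_support_bij (u := fun i => (i * A)%N) (v := fun j => (j %/ A)%N)).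
- exact: iota_uniq.
- exact: iota_uniq.
- move=> i; rewrite !mem_index_iota /= ltnS => iq _.
  by rewrite ltnS leq_mul2r iq orbT mulnK // GF.
move=> j; rewrite !mem_index_iota /= ltnS => jq Gj.
have [i E] : exists i, j = (i * A)%N.
  by apply/dvdnP; apply: contraNT Gj => /negPf; rewrite /G => ->; rewrite mul0r.
rewrite E mulnK //; have iq : (i <= q)%N by rewrite -(leq_pmul2r A0) -E.
by rewrite ltnS GF.
Qed.

Lemma substX c A f n : (0 < A)%N -> subst c A (f ^+ n) = subst c A f ^+ n.
Proof.
move=> A0; elim: n => [|n IH]; first by rewrite !expr0 subst1.
by rewrite !exprS substM // IH.
Qed.

Lemma subst_prod c A (I : Type) (r : seq I) (F : I -> fps R) : (0 < A)%N ->
  subst c A (\prod_(i <- r) F i) = \prod_(i <- r) subst c A (F i).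
Proof.
move=> A0; elim: r => [|i r IH]; first by rewrite !big_nil subst1.
by rewrite !big_cons substM // IH.
Qed.

Lemma subst_mono c A a n : (0 < A)%N ->
  subst c A (mono a n) = mono (c ^+ n * phi a) (A * n).
Proof.
move=> A0; apply/fpsP => m /=; have [Am|Am] := boolP (A %| m)%N.
  have -> : (m == A * n)%N = (m %/ A == n)%N by rewrite mulnC eq_sym [RHS]eq_sym eqn_div.
  by case: eqP => [->| ] //; rewrite rmorph0 mulr0.
by case: eqP => // E; move: Am; rewrite E dvdn_mulr.
Qed.

Lemma eqm_subst c A M f g : (0 < A)%N -> eqm M f g -> eqm M (subst c A f) (subst c A g).
Proof.
move=> A0 fg m mM /=; case: ifP => // Am.
by rewrite fg // (leq_ltn_trans _ mM) // leq_div.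
Qed.

End Substitution.

(** * Theta series *)

HB.lock Definition zbox (N : nat) : seq int := [seq i%:Z - N%:Z | i <- iota 0 N.*2.+1].

Lemma mem_zbox N (n : int) : (n \in zbox N) = (absz n <= N)%N.
Proof.
rewrite zbox.unlock; apply/mapP/idP => [[i]|nN].
  by rewrite mem_iota => /andP[_ iN] ->; lia.
by exists (absz (n + N%:Z)); rewrite ?mem_iota; lia.
Qed.

Lemma zbox_uniq N : uniq (zbox N).
Proof. by rewrite zbox.unlock map_inj_uniq ?iota_uniq // => i j E; lia. Qed.

Definition zbox2 N : seq (int * int) := [seq (a, b) | a <- zbox N, b <- zbox N].

Lemma mem_zbox2 N (x : int * int) :
  (x \in zbox2 N) = (absz x.1 <= N)%N && (absz x.2 <= N)%N.
Proof.
apply/allpairsP/andP => [[y [y1 y2 ->]]|[x1 x2]].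
  by rewrite -!mem_zbox.
by exists x; rewrite !mem_zbox -surjective_pairing.
Qed.

Lemma zbox2_uniq N : uniq (zbox2 N).
Proof. by apply: allpairs_uniq; rewrite ?zbox_uniq // => -[? ?] [? ?] _ _ [-> ->]. Qed.

Section ThetaSeries.
Variable k : fieldType.
Hypothesis two0 : 1 + 1 = 0 :> k.
Implicit Types (q : int -> nat) (c d : int -> k).

Lemma fps_two0 : 1 + 1 = 0 :> fps k.
Proof. by apply/fpsP => m; rewrite fcoefD fcoef0 fcoef1 (char2_addrr two0). Qed.

Lemma sum_zbox_even N (F : int -> k) :
  (forall n, F (- n) = F n) -> \sum_(n <- zbox N) F n = F 0.
Proof.
move=> Fe; elim: N => [|N IH]; first by rewrite zbox.unlock big_seq1.
rewrite (perm_big [:: N.+1%:Z, - N.+1%:Z & zbox N]).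
  by rewrite 2!big_cons Fe /= addrA char2_addrr // add0r.
apply: uniq_perm; rewrite ?zbox_uniq //=.
  by rewrite ?zbox_uniq !inE !mem_zbox; lia.
by move=> n; rewrite !inE !mem_zbox; lia.
Qed.

Lemma coef_sqr (f : fps k) m :
  (f ^+ 2).[|m|] = if (2 %| m)%N then f.[|m %/ 2|] ^+ 2 else 0.
Proof.
pose g := \sum_(i < m.+1) mono f.[|i|] i.
have fg : eqm m.+1 f g.
  move=> l lm; rewrite fcoef_sum (bigD1 (Ordinal lm)) //= eqxx big1 ?addr0 // => i il.
  by case: eqP => // E; case/eqP: il; apply: val_inj.
have gE : g ^+ 2 = \sum_(i < m.+1) mono (f.[|i|] ^+ 2) (i * 2).
  rewrite /g; elim/big_rec2: _ => [|i x y _ <-]; first by rewrite expr0n.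
  by rewrite char2_sqrrD ?monoX //; apply: fps_two0.
rewrite (eqmX 2 fg) // gE fcoef_sum; case: ifP => [/dvdnP[l ->]|m2].
  have lm : (l < (l * 2).+1)%N by lia.
  rewrite mulnK // (bigD1 (Ordinal lm)) //= eqxx big1 ?addr0 // => i il.
  case: eqP => // E; case/eqP: il; apply: val_inj => /=; lia.
rewrite big1 // => i _ /=; case: eqP => // E.
by rewrite [X in (2 %| X)%N]E dvdn_mull in m2.
Qed.

(** The sum of c n x^(q n) over all integers n. Under [proper_exp] the box of radius m + 1 holds
    every n with q n = m; the slack of 1 admits exponents A n^2 + B n, which for A = B vanish at n =
    -1. *)
Definition zseries q c : fps k :=
  Fps (fun m => \sum_(n <- zbox m.+1) if q n == m then c n else 0).

Definition proper_exp q := forall n, (absz n <= (q n).+1)%N.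

Lemma coef_zseries q c N m : proper_exp q -> (m < N)%N ->
  (zseries q c).[|m|] = \sum_(n <- zbox N) if q n == m then c n else 0.
Proof.
move=> qp mN; apply: (sum_support_bij (u := id) (v := id)); rewrite ?zbox_uniq //.
  by move=> n; rewrite !mem_zbox => nm _; split=> //; lia.
move=> n; rewrite !mem_zbox => _.
have [E _|_] := eqVneq (q n) m; last by rewrite eqxx.
by split=> //; have := qp n; lia.
Qed.

Lemma eq_zseries q c d : (forall n, c n = d n) -> zseries q c = zseries q d.
Proof. by move=> cd; apply/fpsP => m /=; apply: eq_bigr => n _; rewrite cd. Qed.

Lemma zseries_reindex q q' c d (u v : int -> int) :
    proper_exp q -> proper_exp q' ->
    (forall n, c n != 0 -> [/\ v (u n) = n, q' (u n) = q n & d (u n) = c n]) ->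
    (forall n, d n != 0 -> [/\ u (v n) = n, q (v n) = q' n & c (v n) = d n]) ->
  zseries q c = zseries q' d.
Proof.
move=> qp qp' uP vP; apply/fpsP => m /=.
apply: (sum_support_bij (u := u) (v := v)); rewrite ?zbox_uniq //.
  move=> n _; have [E cn|_] := eqVneq (q n) m; last by rewrite eqxx.
  have [vu qu du] := uP n cn; rewrite mem_zbox qu E eqxx; split=> //.
  by have := qp' (u n); rewrite qu E.
move=> n _; have [E cn|_] := eqVneq (q' n) m; last by rewrite eqxx.
have [vu qu du] := vP n cn; rewrite mem_zbox qu E eqxx; split=> //.
by have := qp (v n); rewrite qu E.
Qed.

Lemma coef_zseriesM q q' c d N m : proper_exp q -> proper_exp q' -> (m < N)%N ->
  (zseries q c * zseries q' d).[|m|] =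
  \sum_(x <- zbox2 N) if (q x.1 + q' x.2 == m)%N then c x.1 * d x.2 else 0.
Proof.
move=> qp qp' mN; rewrite fcoefM big_allpairs.
transitivity (\sum_(i < m.+1) \sum_(a <- zbox N) \sum_(b <- zbox N)
   (if q a == i then c a else 0) * (if (q' b == m - i)%N then d b else 0)).
  apply: eq_bigr => i _.
  rewrite (coef_zseries c qp (N := N)); last by have := ltn_ord i; lia.
  rewrite (coef_zseries d qp' (N := N)); last by lia.
  by rewrite mulr_suml; apply: eq_bigr => a _; rewrite mulr_sumr.
rewrite exchange_big /=; apply: eq_bigr => a _.
rewrite exchange_big /=; apply: eq_bigr => b _.
have [E|NE] := eqVneq (q a + q' b)%N m.
  have am : (q a < m.+1)%N by lia.
  rewrite (bigD1 (Ordinal am)) //= eqxx big1 => [|i ia].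
    by rewrite -E addKn eqxx addr0.
  case: eqP => [E'| ]; last by rewrite mul0r.
  by case/eqP: ia; apply: val_inj.
apply: big1 => i _; case: eqP => [E'| ]; last by rewrite mul0r.
case: eqP => [E''| ]; last by rewrite mulr0.
by case/eqP: NE; have := ltn_ord i; lia.
Qed.

Lemma zseries_sqr q c : proper_exp q ->
  zseries q c ^+ 2 = zseries (fun n => (q n).*2) (fun n => c n ^+ 2).
Proof.
move=> qp; have qp2 : proper_exp (fun n => (q n).*2) by move=> n; have := qp n; lia.
apply/fpsP => m; rewrite coef_sqr.
case: ifP => [/dvdnP[l ->]|m2]; last first.
  rewrite /= big1 // => n _; case: eqP => // E.
  by move: m2; rewrite -E -muln2 dvdn_mull.
rewrite mulnK // (coef_zseries _ qp (N := (l * 2).+1)); last by lia.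
rewrite (coef_zseries _ qp2 (N := (l * 2).+1)) //.
elim: (zbox _) => [|n r IH]; first by rewrite !big_nil expr0n.
rewrite !big_cons char2_sqrrD // IH -muln2 eqn_mul2r /=.
by case: eqP; rewrite ?expr0n.
Qed.

End ThetaSeries.

Lemma absz_sqr (x : int) : (absz x ^ 2)%N%:Z = x ^+ 2.
Proof. by rewrite -abszX abszE ger0_norm ?sqr_ge0. Qed.

Lemma absz_sqr_rotate (a b : int) :
  (absz (a + b)%R ^ 2 + absz (a - b)%R ^ 2 = (absz a ^ 2).*2 + (absz b ^ 2).*2)%N.
Proof.
by apply/eqP; rewrite -eqz_nat -!addnn !PoszD !absz_sqr; apply/eqP; ring.
Qed.

(** * Addition and duplication formulas in characteristic 2 *)

Section ThetaSystem.
Variables (k : fieldType) (w : nat) (chi : int -> int -> k).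
Hypotheses (two0 : 1 + 1 = 0 :> k) (w_gt0 : (0 < w)%N).
Hypothesis chi_add : forall u v m n,
  chi (u + v) (m + n) * chi (u - v) (m - n) = chi u m ^+ 2 * chi v n ^+ 2.
Hypothesis chi00 : chi 0 0 = 1.
Hypothesis chi0N : forall m, chi 0 (- m) = chi 0 m.

Definition qexp (n : int) := (w * absz n ^ 2)%N.

Lemma qexp_proper : proper_exp qexp.
Proof. by move=> n; rewrite /qexp; nia. Qed.

Lemma qexp_rotate a b :
  (qexp (a + b) + qexp (a - b) = (qexp a).*2 + (qexp b).*2)%N.
Proof. by rewrite /qexp -!mulnDr absz_sqr_rotate mulnDr !doubleMr. Qed.

Let qexp2_proper : proper_exp (fun n => (qexp n).*2).
Proof. by move=> n; rewrite /qexp; nia. Qed.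

Definition theta_odd u := zseries qexp (fun m => if odd (absz m) then chi u m else 0).
Definition theta_even u := zseries qexp (fun m => if odd (absz m) then 0 else chi u m).
(** One half of the series [theta_odd 0], in which the terms at m and -m cancel. *)
Definition theta_half :=
  zseries qexp (fun m => if odd (absz m) && (0 < m) then chi 0 m else 0).

Lemma theta_even0 : theta_even 0 = 1.
Proof.
apply/fpsP => m; rewrite fcoef1 /= sum_zbox_even //.
  by rewrite /qexp /= muln0 eq_sym; case: eqP; rewrite ?chi00.
by move=> n; rewrite /qexp abszN chi0N.
Qed.

(** Odd a and b correspond to M = (a + b)/2 and N = (a - b)/2 of opposite parity; [chi_add] and the
    parallelogram law match the terms. In characteristic 2 the squares on the right are again single
    sums, with doubled exponents. *)
Lemma theta_odd_add u v : theta_odd (u + v) * theta_odd (u - v) =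
  theta_odd u ^+ 2 * theta_even v ^+ 2 + theta_even u ^+ 2 * theta_odd v ^+ 2.
Proof.
rewrite /theta_odd /theta_even !(zseries_sqr two0 _ qexp_proper).
apply/fpsP => m; rewrite fcoefD.
rewrite (coef_zseriesM _ _ qexp_proper qexp_proper (N := m.+1)) //.
rewrite !(coef_zseriesM _ _ qexp2_proper qexp2_proper (N := m.+1)) //.
rewrite -big_split /=.
apply: (sum_support_bij
  (u := fun x => (((x.1 + x.2) %/ 2)%Z, ((x.1 - x.2) %/ 2)%Z))
  (v := fun x => (x.1 + x.2, x.1 - x.2))); rewrite ?zbox2_uniq //.
  move=> [a b]; rewrite !mem_zbox2 /= => /andP[aN bN].
  have [E|_] := eqVneq (qexp a + qexp b)%N m; last by rewrite eqxx.
  case: (boolP (odd (absz a))) => oa; last by rewrite mul0r eqxx.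
  case: (boolP (odd (absz b))) => ob; last by rewrite mulr0 eqxx.
  move=> _.
  set M := ((a + b) %/ 2)%Z; set N := ((a - b) %/ 2)%Z.
  have [Ea Eb] : a = M + N /\ b = M - N by rewrite /M /N; lia.
  have oMN : odd (absz M) = ~~ odd (absz N) by move: oa; rewrite Ea; lia.
  have -> : ((qexp M).*2 + (qexp N).*2 == m)%N by rewrite -qexp_rotate -Ea -Eb E.
  rewrite -Ea -Eb; split=> //; first by rewrite /M /N; lia.
  rewrite Ea Eb chi_add oMN; case: (odd (absz N)) => /=;
    by rewrite !expr0n /= ?mul0r ?mulr0 ?addr0 ?add0r.
move=> [M N]; rewrite !mem_zbox2 /= => /andP[MN NN].
have [E|_] := eqVneq ((qexp M).*2 + (qexp N).*2)%N m; last by rewrite addr0 eqxx.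
have [oMN|eMN] := boolP (odd (absz (M + N))); last first.
  have -> : odd (absz M) = odd (absz N) by lia.
  by case: (odd _); rewrite !expr0n /= !(mul0r, mulr0) addr0 eqxx.
move=> _; have oMN' : odd (absz (M - N)) by lia.
have oM : odd (absz M) = ~~ odd (absz N) by lia.
have q1 : (qexp (M + N) + qexp (M - N) = m)%N by rewrite qexp_rotate.
split.
- have := qexp_proper (M + N); have := qexp_proper (M - N); lia.
- by congr pair; lia.
rewrite q1 eqxx oMN' chi_add oM; case: (odd (absz N)) => /=;
  by rewrite !expr0n /= ?mul0r ?mulr0 ?addr0 ?add0r.
Qed.

(** The same rotation: even a and b correspond to M and N of equal parity. *)
Lemma theta_even_add u v : theta_even (u + v) * theta_even (u - v) =
  theta_even u ^+ 2 * theta_even v ^+ 2 + theta_odd u ^+ 2 * theta_odd v ^+ 2.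
Proof.
rewrite /theta_odd /theta_even !(zseries_sqr two0 _ qexp_proper).
apply/fpsP => m; rewrite fcoefD.
rewrite (coef_zseriesM _ _ qexp_proper qexp_proper (N := m.+1)) //.
rewrite !(coef_zseriesM _ _ qexp2_proper qexp2_proper (N := m.+1)) //.
rewrite -big_split /=.
apply: (sum_support_bij
  (u := fun x => (((x.1 + x.2) %/ 2)%Z, ((x.1 - x.2) %/ 2)%Z))
  (v := fun x => (x.1 + x.2, x.1 - x.2))); rewrite ?zbox2_uniq //.
  move=> [a b]; rewrite !mem_zbox2 /= => /andP[aN bN].
  have [E|_] := eqVneq (qexp a + qexp b)%N m; last by rewrite eqxx.
  case: (boolP (odd (absz a))) => oa; first by rewrite mul0r eqxx.
  case: (boolP (odd (absz b))) => ob; first by rewrite mulr0 eqxx.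
  move=> _.
  set M := ((a + b) %/ 2)%Z; set N := ((a - b) %/ 2)%Z.
  have [Ea Eb] : a = M + N /\ b = M - N by rewrite /M /N; lia.
  have oMN : odd (absz M) = odd (absz N) by move: oa; rewrite Ea; lia.
  have -> : ((qexp M).*2 + (qexp N).*2 == m)%N by rewrite -qexp_rotate -Ea -Eb E.
  rewrite -Ea -Eb; split=> //; first by rewrite /M /N; lia.
  rewrite Ea Eb chi_add oMN; case: (odd (absz N)) => /=;
    by rewrite !expr0n /= ?mul0r ?mulr0 ?addr0 ?add0r.
move=> [M N]; rewrite !mem_zbox2 /= => /andP[MN NN].
have [E|_] := eqVneq ((qexp M).*2 + (qexp N).*2)%N m; last by rewrite addr0 eqxx.
have [oMN|eMN] := boolP (odd (absz (M + N))).
  have -> : odd (absz M) = ~~ odd (absz N) by lia.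
  by case: (odd _); rewrite !expr0n /= !(mul0r, mulr0) addr0 eqxx.
move=> _; have oMN' : ~~ odd (absz (M - N)) by lia.
have oM : odd (absz M) = odd (absz N) by lia.
have q1 : (qexp (M + N) + qexp (M - N) = m)%N by rewrite qexp_rotate.
split.
- have := qexp_proper (M + N); have := qexp_proper (M - N); lia.
- by congr pair; lia.
rewrite q1 eqxx (negPf oMN') chi_add oM; case: (odd (absz N)) => /=;
  by rewrite !expr0n /= ?mul0r ?mulr0 ?addr0 ?add0r.
Qed.

(* The terms on both sides are matched through (a + b)/2 and (a - b)/2: for odd
   a and odd b > 0 exactly one of these is odd. *)
Lemma theta_odd_double u :
  theta_odd (u + u) * theta_half = theta_odd u ^+ 2 * theta_even u ^+ 2.
Proof.
rewrite /theta_odd /theta_even /theta_half !(zseries_sqr two0 _ qexp_proper).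
apply/fpsP => m.
rewrite (coef_zseriesM _ _ qexp_proper qexp_proper (N := m.+1)) //.
rewrite !(coef_zseriesM _ _ qexp2_proper qexp2_proper (N := m.+1)) //.
apply: (sum_support_bij
  (u := fun x => let M := ((x.1 + x.2) %/ 2)%Z in let N := ((x.1 - x.2) %/ 2)%Z in
                 if odd (absz M) then (M, N) else (N, M))
  (v := fun x => (x.1 + x.2, `|x.1 - x.2|))); rewrite ?zbox2_uniq //.
  move=> [a b]; rewrite !mem_zbox2 /= => /andP[aN bN].
  have [E|_] := eqVneq (qexp a + qexp b)%N m; last by rewrite eqxx.
  case: (boolP (odd (absz a))) => oa; last by rewrite mul0r eqxx.
  case: (boolP (odd (absz b) && (0 < b))) => [/andP[ob b0]| ]; last by rewrite mulr0 eqxx.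
  move=> _.
  set M := ((a + b) %/ 2)%Z; set N := ((a - b) %/ 2)%Z.
  have [Ea Eb] : a = M + N /\ b = M - N by rewrite /M /N; lia.
  have oMN : odd (absz M) = ~~ odd (absz N) by move: oa; rewrite Ea; lia.
  have q1 : ((qexp M).*2 + (qexp N).*2 = m)%N.
    by rewrite -qexp_rotate -Ea -Eb.
  have c1 : chi (u + u) a * chi 0 b = chi u M ^+ 2 * chi u N ^+ 2.
    by rewrite Ea Eb -[X in chi X (M - N)](subrr u) chi_add.
  move: oMN; case: (boolP (odd (absz M))) => oM oN /=.
    rewrite q1 eqxx oM ifN -?oN // c1; split=> //; first by rewrite /M /N; lia.
    by congr pair; lia.
  have {}oN : odd (absz N) by rewrite -[odd _]negbK -oN.
  rewrite addnC q1 eqxx oN (negPf oM) c1 mulrC; split=> //; first by rewrite /M /N; lia.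
  by congr pair; lia.
move=> [M N]; rewrite !mem_zbox2 /= => /andP[MN NN].
have [E|_] := eqVneq ((qexp M).*2 + (qexp N).*2)%N m; last by rewrite eqxx.
case: (boolP (odd (absz M))) => oM; last by rewrite expr0n mul0r eqxx.
case: (boolP (odd (absz N))) => oN; first by rewrite expr0n mulr0 eqxx.
move=> _.
have q1 : (qexp (M + N) + qexp `|M - N|%R = m)%N.
  by rewrite -E -qexp_rotate /qexp absz_id.
have o1 : odd (absz (M + N)) by lia.
have o2 : odd (absz `|M - N|%R) by lia.
have p2 : 0 < `|M - N| by lia.
split.
- have := qexp_proper (M + N); have := qexp_proper `|M - N|%R; lia.
- have [lt|lt] := ltP 0 (M - N).
    have -> : `|M - N| = M - N by lia.
    have -> : ((M + N + (M - N)) %/ 2)%Z = M by lia.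
    have -> : ((M + N - (M - N)) %/ 2)%Z = N by lia.
    by rewrite oM.
  have -> : `|M - N| = N - M by lia.
  have -> : ((M + N + (N - M)) %/ 2)%Z = N by lia.
  have -> : ((M + N - (N - M)) %/ 2)%Z = M by lia.
  by rewrite (negPf oN).
rewrite q1 eqxx o1 o2 p2 /=.
have -> : chi 0 `|M - N| = chi 0 (M - N).
  by have [->|->] : `|M - N| = M - N \/ `|M - N| = - (M - N) by lia.
by rewrite -[X in chi X (M - N)](subrr u) chi_add.
Qed.

End ThetaSystem.

Lemma lead_sum (R : comNzRingType) (I : Type) (r : seq I) n (c : I -> R)
    (f : I -> fps R) :
  (forall i, lead n (c i) (f i)) -> lead n (\sum_(i <- r) c i) (\sum_(i <- r) f i).
Proof.
move=> H; split=> [m mn| ]; rewrite fcoef_sum.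
  by apply: big1 => i _; apply: (H i).1.
by apply: eq_bigr => i _; apply: (H i).2.
Qed.

Lemma lead_zseries (k : fieldType) q (c : int -> k) N :
  (forall n, c n != 0 -> (N <= q n)%N) ->
  lead N (\sum_(n <- zbox N.+1) if q n == N then c n else 0) (zseries q c).
Proof.
move=> H; split=> // m mN /=; apply: big1 => n _.
have [E|//] := eqVneq (q n) m; apply/eqP; apply: contraTT mN => /H.
by rewrite E -leqNgt.
Qed.

Lemma lead_zseries1 (k : fieldType) q (c : int -> k) n0 : proper_exp q ->
  (forall n, c n != 0 -> n != n0 -> (q n0 < q n)%N) ->
  lead (q n0) (c n0) (zseries q c).
Proof.
move=> qp H.
have := @lead_zseries k q c (q n0); rewrite (bigD1_seq n0) ?zbox_uniq ?mem_zbox //=.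
rewrite eqxx big1_seq ?addr0 => [|n /andP[nn0 _]].
  apply=> n cn; have [->//|nn0] := eqVneq n n0.
  by rewrite ltnW // H.
case: ifP => // /eqP E; apply/eqP; apply/negPn/negP => cn.
by have := H n cn nn0; rewrite E ltnn.
Qed.

(** * Theta series of the p + 1 lines *)

Section Lines.
Variables (k : fieldType) (p h w : nat) (om : k).
Hypotheses (two0 : 1 + 1 = 0 :> k) (ph : p = h.*2.+1) (p_pr : prime p).
Hypotheses (p_gt3 : (3 < p)%N) (w_gt0 : (0 < w)%N).
Hypothesis om_prim : (p ^ 2).-primitive_root om.

(** On [Some c] the point u restricts m to its class modulo p, and om^(c m^2) arises from
    multiplying the variable by a root of unity. On [None] only multiples of p occur, and the point
    is the p-th root of unity om^(u p). *)
Definition chi (l : option 'I_p) (u m : int) : k :=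
  match l with
  | Some c => if (p %| m - u)%Z then om ^+ (c * absz m ^ 2) else 0
  | None => if (p %| m)%Z then om ^ (u * m) else 0
  end.

Let om_neq0 : om != 0.
Proof.
apply/eqP => om0; have := prim_expr_order om_prim.
by rewrite om0 expr0n expn_eq0 -leqn0 leqNgt prime_gt0 //= => /esym/eqP; rewrite oner_eq0.
Qed.

(** As p is odd, the sum and the difference determine a and b modulo p; this makes the divisibility
    conditions in [chi] compatible with [chi_add]. *)
Lemma dvdz_halves (a b : int) :
  (p %| a + b)%Z && (p %| a - b)%Z = (p %| a)%Z && (p %| b)%Z.
Proof.
apply/andP/andP => [[ab ab']|[pa pb]]; last by rewrite rpredD ?rpredB.
have p2 : coprimez p 2.
  by rewrite /coprimez /gcdz /= -[_ == _]/(coprime p 2) coprime_sym prime_coprime // dvdn2 ph /= odd_double.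
split; rewrite -(Gauss_dvdzl _ p2).
  have -> : a * 2 = (a + b) + (a - b) by ring.
  exact: rpredD.
have -> : b * 2 = (a + b) - (a - b) by ring.
exact: rpredB.
Qed.

Lemma chi_add l u v m n :
  chi l (u + v) (m + n) * chi l (u - v) (m - n) = chi l u m ^+ 2 * chi l v n ^+ 2.
Proof.
case: l => [c| ] /=.
  have := dvdz_halves (m - u) (n - v).
  have -> : m - u + (n - v) = m + n - (u + v) by ring.
  have -> : m - u - (n - v) = m - n - (u - v) by ring.
  case: ifP => _ /=; case: ifP => _ /=; case: ifP => _ //=; case: ifP => _ //= _;
    rewrite ?expr0n ?mul0r ?mulr0 //.
  rewrite -!exprM -!exprD -mulnDr absz_sqr_rotate -!muln2; congr (_ ^+ _); ring.
have := dvdz_halves m n.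
case: ifP => _ /=; case: ifP => _ /=; case: ifP => _ //=; case: ifP => _ //= _;
  rewrite ?expr0n ?mul0r ?mulr0 //.
have sq x : (om ^ x) ^+ 2 = om ^ (x * 2) by rewrite -exprz_exp exprnP.
by rewrite !sq -!expfzDr //; congr (_ ^ _); ring.
Qed.

Lemma chi00 l : chi l 0 0 = 1.
Proof. by case: l => [c| ] /=; rewrite ?subr0 dvdz0 ?muln0 ?expr0 // mul0r expr0z. Qed.

Lemma chi_opp l u m : chi l (- u) (- m) = chi l u m.
Proof.
case: l => [c| ] /=; last by rewrite rpredN mulrNN.
by rewrite -opprD rpredN abszN.
Qed.

Lemma chi0N l m : chi l 0 (- m) = chi l 0 m.
Proof. by rewrite -[RHS]chi_opp oppr0. Qed.

Lemma om_expz (n : int) : ((p ^ 2)%N%:Z %| n)%Z -> om ^ n = 1.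
Proof.
move=> /dvdzP [q ->]; rewrite mulrC -exprz_exp.
by rewrite -exprnP prim_expr_order // exp1rz.
Qed.

Lemma chi_addp l u m (q : int) : chi l (u + q * p) m = chi l u m.
Proof.
case: l => [c| ] /=.
  rewrite opprD addrA; congr (if _ then _ else _).
  by rewrite rpredBr // dvdz_mull.
case: ifP => // pm; rewrite mulrDl expfzDr // [X in _ * X]om_expz ?mulr1 //.
by rewrite -mulrA dvdz_mull // expnS expn1 PoszM dvdz_mul.
Qed.


Local Notation tho l a := (theta_odd w (chi l) a%:Z).
Local Notation the l a := (theta_even w (chi l) a%:Z).

Lemma theta_periodic l a b : (a = b %[mod p] \/ p %| a + b)%N ->
  the l a = the l b /\ tho l a = tho l b.
Proof.
move=> ab; have H : (exists q : int, a%:Z = b%:Z + q * p%:Z) \/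
    (exists q : int, a%:Z = - b%:Z + q * p%:Z).
  case: ab => [E|/dvdnP [q E]].
    left; exists ((a %/ p)%N%:Z - (b %/ p)%N%:Z).
    rewrite {1}(divn_eq a p) {1}(divn_eq b p) E !PoszD !PoszM; ring.
  by right; exists q%:Z; rewrite -PoszM -E PoszD; ring.
have eqs c d : (forall m, c m = d (- m)) -> zseries (qexp w) c = zseries (qexp w) d.
  move=> cd; apply: (zseries_reindex (u := fun n => - n) (v := fun n => - n));
    try exact: qexp_proper.
    by move=> n _; rewrite opprK /qexp abszN cd.
  by move=> n _; rewrite opprK /qexp abszN cd opprK.
case: H => -[q ->]; split.
- by apply: eq_zseries => m; rewrite chi_addp.
- by apply: eq_zseries => m; rewrite chi_addp.
- by apply: eqs => m; rewrite chi_addp abszN -[chi l b _]chi_opp opprK.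
- by apply: eqs => m; rewrite chi_addp abszN -[chi l b _]chi_opp opprK.
Qed.

(** Equal parity makes n - n0 an even multiple of p, so |n| is at least 2p - |n0| > |n0|. *)
Lemma qexp_gap (n n0 : int) : odd (absz n) = odd (absz n0) ->
  (p %| n - n0)%Z -> (absz n0 < p)%N -> n != n0 -> (qexp w n0 < qexp w n)%N.
Proof.
move=> on /dvdzP[j nj] n0p nn0.
have nE : n = n0 + j * p by rewrite -nj; ring.
have j0 : j != 0 by apply: contraNneq nn0 => j0; rewrite nE j0 mul0r addr0.
have oj : ~~ odd (absz j).
  have : ~~ odd (absz (j * p)) by rewrite -nj; move: on; lia.
  by rewrite abszM oddM ph /= odd_double andbT.
have jp : (2 * p <= absz (j * p)%R)%N.
  by rewrite abszM leq_mul //; move: oj j0; lia.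
rewrite /qexp ltn_pmul2l // ltn_exp2r //; move: jp; rewrite -nj; lia.
Qed.

(** [rep_odd] and [rep_even] are the odd and the even member of {r, p - r}: for 0 < r < p, the least
    absolute values of the integers of each parity congruent to r modulo p. *)
Definition rep_odd r := if odd r then r else (p - r)%N.
Definition rep_even r := if odd r then (p - r)%N else r.

Let p_odd : odd p. Proof. by rewrite ph /= odd_double. Qed.

Lemma lead_theta_odd_some (c : 'I_p) r : (0 < r < p)%N ->
  lead (w * rep_odd r ^ 2) (om ^+ (c * rep_odd r ^ 2)) (tho (Some c) r).
Proof.
move=> /andP[r0 rp].
pose n0 : int := if odd r then r%:Z else r%:Z - p%:Z.
have an0 : absz n0 = rep_odd r by rewrite /n0 /rep_odd; case: ifP => _; lia.
have on0 : odd (absz n0) by rewrite an0 /rep_odd; case: ifP => // ?; lia.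
have pn0 : (p %| n0 - r%:Z)%Z.
  rewrite /n0; case: ifP => _; first by rewrite subrr dvdz0.
  have -> : (r%:Z - p%:Z - r%:Z = - p%:Z)%R by ring.
  by rewrite rpredN dvdzz.
have := @lead_zseries1 k (qexp w)
  (fun m => if odd (absz m) then chi (Some c) r m else 0) n0 (qexp_proper w_gt0).
rewrite on0 /= pn0 -an0; apply=> n; case: ifP => [on| ]; last by rewrite eqxx.
case: ifP => [pn _| ]; last by rewrite eqxx.
apply: qexp_gap; rewrite ?on ?on0 //.
  have -> : n - n0 = n - r%:Z - (n0 - r%:Z) by ring.
  by rewrite rpredB.
by rewrite an0 /rep_odd; case: ifP => _; lia.
Qed.

Lemma lead_theta_even_some (c : 'I_p) r : (0 < r < p)%N ->
  lead (w * rep_even r ^ 2) (om ^+ (c * rep_even r ^ 2)) (the (Some c) r).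
Proof.
move=> /andP[r0 rp].
pose n0 : int := if odd r then r%:Z - p%:Z else r%:Z.
have an0 : absz n0 = rep_even r by rewrite /n0 /rep_even; case: ifP => _; lia.
have on0 : odd (absz n0) = false.
  by rewrite an0 /rep_even; case: ifP => // ?; lia.
have pn0 : (p %| n0 - r%:Z)%Z.
  rewrite /n0; case: ifP => _; last by rewrite subrr dvdz0.
  have -> : (r%:Z - p%:Z - r%:Z = - p%:Z)%R by ring.
  by rewrite rpredN dvdzz.
have := @lead_zseries1 k (qexp w)
  (fun m => if odd (absz m) then 0 else chi (Some c) r m) n0 (qexp_proper w_gt0).
rewrite on0 /= pn0 -an0; apply=> n; case: ifP => [on|on]; first by rewrite eqxx.
case: ifP => [pn _| ]; last by rewrite eqxx.
apply: qexp_gap; rewrite ?on ?on0 //.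
  have -> : n - n0 = n - r%:Z - (n0 - r%:Z) by ring.
  by rewrite rpredB.
by rewrite an0 /rep_even; case: ifP => _; lia.
Qed.

Lemma lead_theta_even_none r : lead 0 1 (the None r).
Proof.
have := @lead_zseries1 k (qexp w)
  (fun m => if odd (absz m) then 0 else chi None r m) 0 (qexp_proper w_gt0).
rewrite /= dvdz0 mulr0 expr0z /qexp /= muln0; apply=> n _ n0.
by rewrite muln_gt0 w_gt0 expn_gt0 absz_gt0 n0.
Qed.

(** The lowest terms are those at m = p and m = -p. *)
Lemma lead_theta_odd_none r :
  lead (w * p ^ 2) (om ^+ (r * p) + (om ^+ (r * p))^-1) (tho None r).
Proof.
have := @lead_zseries k (qexp w)
  (fun m => if odd (absz m) then chi None r m else 0) (w * p ^ 2).
have p2 : (p <= w * p ^ 2)%N.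
  by rewrite expnS expn1 mulnA leq_pmull // muln_gt0 w_gt0 prime_gt0.
rewrite (bigD1_seq p%:Z) ?zbox_uniq ?mem_zbox ?leqW //=.
rewrite big_mkcond (bigD1_seq (- p%:Z)) ?zbox_uniq ?mem_zbox ?abszN ?leqW //=.
have -> : - p%:Z != p%:Z by apply/eqP; have := prime_gt0 p_pr; lia.
rewrite /qexp abszN /= eqxx p_odd rpredN dvdzz mulrN -PoszM -invr_expz -!exprnP.
rewrite big1_seq ?addr0 => [|n /andP[n1 _]].
  apply=> n; case: ifP => [on| ]; last by rewrite eqxx.
  case: ifP => [/dvdzP[j nE] _| ]; last by rewrite eqxx.
  rewrite nE leq_pmul2l // leq_exp2r // abszM leq_pmull // absz_gt0.
  by apply: contraTneq on => j0; rewrite nE j0 mul0r.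
case: ifP => // n2; case: ifP => // /eqP /eqP; rewrite eqn_pmul2l // eqn_exp2r // => /eqP E.
by case/negP: n1; apply/eqP; move/eqP: n2; lia.
Qed.

Lemma ndvdp_double r : ~~ (p %| r)%N -> ~~ (p ^ 2 %| r * p * 2)%N.
Proof.
move=> pr; rewrite mulnAC expnSr expn1 dvdn_pmul2r ?prime_gt0 //.
by rewrite Euclid_dvdM // negb_or pr gtnNdvd //; lia.
Qed.

Lemma om_add_inv_neq0 r : ~~ (p %| r)%N -> om ^+ (r * p) + (om ^+ (r * p))^-1 != 0.
Proof.
move=> /ndvdp_double; apply: contraNneq => E.
rewrite (prim_order_dvd om_prim) exprM; apply/eqP.
have x0 : om ^+ (r * p) != 0 by rewrite expf_neq0.
apply: (mulfI (invr_neq0 x0)); rewrite mulr1 expr2 mulrA mulVf // mul1r.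
by apply/eqP; rewrite -subr_eq0 (char2_oppr two0) E.
Qed.

Lemma ndvdp_mod a : ~~ (p %| a)%N -> (0 < a %% p < p)%N.
Proof. by move=> pa; rewrite lt0n pa ltn_pmod ?prime_gt0. Qed.

Lemma theta_odd_neq0 l a : ~~ (p %| a)%N -> tho l a != 0.
Proof.
move=> pa; have [_ ->] : the l a = the l (a %% p)%N /\ tho l a = tho l (a %% p)%N.
  by apply: theta_periodic; left; rewrite modn_mod.
case: l => [c| ].
  apply: lead_neq0 (lead_theta_odd_some c (ndvdp_mod pa)).
  by rewrite expf_neq0.
apply: lead_neq0 (lead_theta_odd_none (a %% p)%N).
by apply: om_add_inv_neq0; rewrite /dvdn modn_mod.
Qed.

Lemma theta_even_neq0 l a : ~~ (p %| a)%N -> the l a != 0.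
Proof.
move=> pa; have [-> _] : the l a = the l (a %% p)%N /\ tho l a = tho l (a %% p)%N.
  by apply: theta_periodic; left; rewrite modn_mod.
case: l => [c| ].
  apply: lead_neq0 (lead_theta_even_some c (ndvdp_mod pa)).
  by rewrite expf_neq0.
exact: lead_neq0 (oner_neq0 _) (lead_theta_even_none _).
Qed.

Let half_bounds (i : 'I_h) : (0 < i.+1 < p)%N.
Proof. by rewrite /= ph; have := ltn_ord i; lia. Qed.

Lemma rep_add r : (0 < r < p)%N -> (rep_even r + rep_odd r = p)%N.
Proof. by rewrite /rep_even /rep_odd; case: ifP => _ /andP[? ?]; lia. Qed.

Lemma rep_even_inj (i j : 'I_h) : rep_even i.+1 = rep_even j.+1 -> i = j.
Proof.
rewrite /rep_even => E; apply: val_inj => /=; have := ltn_ord i; have := ltn_ord j.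
by move: E; case: ifP => _; case: ifP => _; lia.
Qed.

Lemma rep_even_gt0 (i : 'I_h) : (0 < rep_even i.+1)%N.
Proof. by rewrite /rep_even; case: ifP => _; have := half_bounds i; lia. Qed.

Lemma rep_odd_gt0 (i : 'I_h) : (0 < rep_odd i.+1)%N.
Proof. by rewrite /rep_odd; case: ifP => _; have := half_bounds i; lia. Qed.

Let ndvd_half (i : 'I_h) : ~~ (p %| i.+1)%N.
Proof. by rewrite gtnNdvd //; case/andP: (half_bounds i). Qed.

(** Leading terms of the cross products are compared. [None] and [Some c] differ in order. For two
    lines [Some], the orders force equal residues, since [rep_even] and [rep_odd] have sum p and
    vary in opposite directions; the coefficients then force equal lines. On [None] the coefficients
    alone decide. *)
Lemma theta_ratio_inj (x y : option 'I_p * 'I_h) :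
  the x.1 x.2.+1 * tho y.1 y.2.+1 = the y.1 y.2.+1 * tho x.1 x.2.+1 -> x = y.
Proof.
have om0 n : om ^+ n != 0 by rewrite expf_neq0.
have mixed (c : 'I_p) (i j : 'I_h) :
    the None i.+1 * tho (Some c) j.+1 <> the (Some c) j.+1 * tho None i.+1.
  move=> E; have := leadM (lead_theta_even_none i.+1) (lead_theta_odd_some c (half_bounds j)).
  rewrite E => L1.
  have L2 := leadM (lead_theta_even_some c (half_bounds j)) (lead_theta_odd_none i.+1).
  have [] := lead_inj _ _ L1 L2; rewrite ?mul1r ?mulf_neq0 ?om_add_inv_neq0 //.
  rewrite add0n -mulnDr => /eqP; rewrite eqn_pmul2l // => /eqP.
  have op : (rep_odd j.+1 < p)%N.
    by rewrite -(rep_add (half_bounds j)) -addn1 addnC leq_add2r rep_even_gt0.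
  move=> Eq; have : (rep_odd j.+1 ^ 2 < p ^ 2)%N by rewrite ltn_exp2r.
  by move: Eq; set a := (_ ^ 2)%N; set b := (_ ^ 2)%N; set c' := (_ ^ 2)%N; lia.
case: x => -[c| ] i; case: y => -[d| ] j /=.
- move=> E.
  have L1 := leadM (lead_theta_even_some c (half_bounds i)) (lead_theta_odd_some d (half_bounds j)).
  have L2 := leadM (lead_theta_even_some d (half_bounds j)) (lead_theta_odd_some c (half_bounds i)).
  rewrite E in L1; have [] := lead_inj _ _ L1 L2; rewrite ?mulf_neq0 //.
  have si := rep_add (half_bounds i); have sj := rep_add (half_bounds j).
  rewrite -!mulnDr => /eqP; rewrite eqn_pmul2l // => /eqP Eq.
  have eij : rep_even i.+1 = rep_even j.+1.
    move: si sj Eq; set m := rep_even _; set o := rep_odd _.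
    set m' := rep_even _; set o' := rep_odd _ => si sj Eq.
    apply/eqP; rewrite eqn_leq; apply/andP; split; rewrite leqNgt; apply/negP => lt;
      have lt2 := lt; move: lt2; rewrite -(ltn_exp2r _ _ (ltn0Sn 1)) => lt2.
      have : (o < o')%N by lia.
      by rewrite -(ltn_exp2r _ _ (ltn0Sn 1)); lia.
    have : (o' < o)%N by lia.
    by rewrite -(ltn_exp2r _ _ (ltn0Sn 1)); lia.
  have ij := rep_even_inj eij; subst j; rewrite -!exprD => /eqP.
  rewrite (eq_prim_root_expr om_prim).
  have m0 := rep_even_gt0 i; have o0 := rep_odd_gt0 i.
  move: {L1 L2 E sj eij Eq} si m0 o0.
  set m := rep_even _; set o := rep_odd _ => si m0 o0.
  wlog cd : c d / (c <= d)%N.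
    move=> W; have [cd|dc] := leqP c d; first exact: W.
    by rewrite eq_sym => /(W _ _ (ltnW dc)) [->].
  pose e := (d - c)%N; have dE : (d : nat) = (c + e)%N by rewrite /e subnKC.
  rewrite dE.
  have -> : (c * m ^ 2 + (c + e) * o ^ 2 = c * (m ^ 2 + o ^ 2) + e * o ^ 2)%N by ring.
  have -> : ((c + e) * m ^ 2 + c * o ^ 2 = c * (m ^ 2 + o ^ 2) + e * m ^ 2)%N by ring.
  (* Since o = p - m, e m^2 exceeds e o^2 by 2 e m p modulo p^2. Adding this term avoids a
     subtraction in nat and leaves p^2 dividing 2 e m p. *)
  rewrite eqn_modDl -(eqn_modDr (e * m * p * 2)).
  have -> : (e * o ^ 2 + e * m * p * 2 = e * m ^ 2 + e * p ^ 2)%N by rewrite -si; ring.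
  rewrite eqn_modDl modnMl eq_sym => H.
  have e0 : e = 0%N.
    have : (p %| e * m)%N by apply: contraLR H => /ndvdp_double.
    rewrite Euclid_dvdM // => /orP[ | ].
      have [//|e0] := posnP e; rewrite gtnNdvd //.
      by rewrite /e (leq_ltn_trans (leq_subr _ _)).
    by rewrite gtnNdvd //; lia.
  by congr (Some _, _); apply: val_inj; rewrite /= dE e0 addn0.
- by move=> E; case: (mixed c j i).
- by move/mixed.
move=> E.
have L1 := leadM (lead_theta_even_none i.+1) (lead_theta_odd_none j.+1).
have L2 := leadM (lead_theta_even_none j.+1) (lead_theta_odd_none i.+1).
rewrite E in L1; have [] := lead_inj _ _ L1 L2; rewrite ?mul1r ?om_add_inv_neq0 //.
move=> _ H; congr pair; apply: val_inj; apply/eqP.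
set x := om ^+ (i.+1 * p) in H; set y := om ^+ (j.+1 * p) in H.
have [x0 y0] : x != 0 /\ y != 0 by rewrite !om0.
(* From x + 1/x = y + 1/y follows y = x or y = 1/x; the latter would require p to divide a positive
   sum of two residues at most h. *)
have : (x - y) * (x * y - 1) == 0.
  have -> : (x - y) * (x * y - 1) = x * y * ((x + x^-1) - (y + y^-1)).
    by field; apply/andP.
  by rewrite H subrr mulr0.
rewrite mulf_eq0 !subr_eq0 /x /y -exprD -mulnDl => /orP[].
  rewrite (eq_prim_root_expr om_prim) expnSr expn1 -!muln_modl ?prime_gt0 //.
  rewrite eqn_pmul2r ?prime_gt0 // !modn_small ?eqSS //;
  by [case/andP: (half_bounds i) | case/andP: (half_bounds j)].
rewrite -(prim_order_dvd om_prim) expnSr expn1 dvdn_pmul2r ?prime_gt0 //.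
rewrite gtnNdvd // ph; have := ltn_ord i; have := ltn_ord j; lia.
Qed.

(** These are the nontrivial p-th roots of unity, with sum -1. *)
Lemma sum_om_add_inv :
  \sum_(i < h) (om ^+ (i.+1 * p) + (om ^+ (i.+1 * p))^-1) = 1.
Proof.
pose ze := om ^+ p.
have zep : ze ^+ p = 1 by rewrite -exprM mulnn prim_expr_order.
have ze1 : ze - 1 != 0.
  rewrite subr_eq0 -(prim_order_dvd om_prim) gtnNdvd ?prime_gt0 //.
  by rewrite -[X in (X < _)%N]expn1 ltn_exp2l ?prime_gt1.
have : \sum_(i < p) ze ^+ i = 0.
  by apply: (mulfI ze1); rewrite -subrX1 zep subrr mulr0.
have -> : \sum_(i < p) ze ^+ i = 1 + \sum_(i < h + h) ze ^+ i.+1.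
  by rewrite -(big_mkord xpredT (fun i => ze ^+ i)) ph -addnn big_nat_recl //= big_mkord.
rewrite big_split_ord /= [X in 1 + (_ + X)](reindex_inj rev_ord_inj) /= -big_split /=.
move/eqP; rewrite addrC addr_eq0 (char2_oppr two0) => /eqP <-.
apply: eq_bigr => i _; congr (_ + _); first by rewrite mulnC exprM.
rewrite mulnC exprM -/ze.
have zi : ze ^+ i.+1 != 0 by rewrite !expf_neq0.
apply: (mulIf zi); rewrite mulVf // -exprD -zep; congr (_ ^+ _).
by have := ltn_ord i; rewrite ph; lia.
Qed.

(** The trace with denominators cleared. On [None] all terms share one order, and their leading
    coefficients add up to 1. On [Some c] the residue 1 gives the only term of least order: its odd
    representative 1 is the smallest, and the even one it omits, p - 1, is the largest. *)
Lemma theta_trace_neq0 l :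
  \sum_(i < h) tho l i.+1 * \prod_(j < h | j != i) the l j.+1 != 0.
Proof.
case: l => [c| ]; last first.
  have L (i : 'I_h) := leadM (lead_theta_odd_none i.+1) (lead_prod
    [seq j <- index_enum 'I_h | j != i] (fun j : 'I_h => lead_theta_even_none j.+1)).
  have {}L (i : 'I_h) : lead (w * p ^ 2) (om ^+ (i.+1 * p) + (om ^+ (i.+1 * p))^-1)
      (tho None i.+1 * \prod_(j < h | j != i) the None j.+1).
    by have := L i; rewrite !big_filter !big1_eq addn0 mulr1.
  apply: lead_neq0 (lead_sum (index_enum 'I_h) L); rewrite sum_om_add_inv; exact: oner_neq0.
have h0 : (0 < h)%N by move: p_gt3; rewrite ph; lia.
pose i0 := Ordinal h0.
pose v (i : 'I_h) := (w * rep_odd i.+1 ^ 2 + \sum_(j < h | j != i) w * rep_even j.+1 ^ 2)%N.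
pose a (i : 'I_h) := om ^+ (c * rep_odd i.+1 ^ 2) *
  \prod_(j < h | j != i) om ^+ (c * rep_even j.+1 ^ 2).
have L i : lead (v i) (a i)
    (tho (Some c) i.+1 * \prod_(j < h | j != i) the (Some c) j.+1).
  have := leadM (lead_theta_odd_some c (half_bounds i)) (lead_prod
    [seq j <- index_enum 'I_h | j != i]
    (fun j : 'I_h => lead_theta_even_some c (half_bounds j))).
  by rewrite !big_filter.
have v0 i : i != i0 -> (v i0 < v i)%N.
  move=> ii0; rewrite /v.
  have V (j : 'I_h) : (\sum_(j < h) w * rep_even j.+1 ^ 2 = w * rep_even j.+1 ^ 2 +
      \sum_(l < h | l != j) w * rep_even l.+1 ^ 2)%N by rewrite (bigD1 j).
  have := V i0; rewrite (V i).
  have [e0 o0] : rep_even i0.+1 = p.-1 /\ rep_odd i0.+1 = 1%N.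
    by rewrite /rep_even /rep_odd /= subn1.
  have ne : rep_even i.+1 <> p.-1.
    by rewrite -e0 => /rep_even_inj/eqP; rewrite (negPf ii0).
  have := rep_odd_gt0 i; have := rep_add (half_bounds i) => sp o1.
  have : (rep_odd i0.+1 < rep_odd i.+1)%N by rewrite o0; move: ne sp o1; lia.
  have : (rep_even i.+1 < rep_even i0.+1)%N by rewrite e0; move: ne sp o1; lia.
  rewrite -(ltn_exp2r _ _ (ltn0Sn 1)) -(ltn_pmul2l w_gt0) => lt1.
  rewrite -(ltn_exp2r _ _ (ltn0Sn 1)) -(ltn_pmul2l w_gt0) => lt2.
  move: lt1 lt2; set x1 := (w * _)%N; set x2 := (w * _)%N; set x3 := (w * _)%N.
  by set x4 := (w * _)%N; lia.
have L0 i : lead (v i0) (if i == i0 then a i0 else 0)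
    (tho (Some c) i.+1 * \prod_(j < h | j != i) the (Some c) j.+1).
  by have [->//|/v0 vi] := eqVneq i i0; apply: lead_higher (L i) vi.
apply: lead_neq0 (lead_sum (index_enum 'I_h) L0).
rewrite -big_mkcond big_pred1_eq mulf_neq0 ?expf_neq0 //.
by rewrite prodf_seq_neq0; apply/allP => j _; rewrite expf_neq0 ?implybT.
Qed.

End Lines.

(** * The Jacobi triple product *)

Section GaussianBinomial.
Variables (R : comNzRingType) (Q : R).

Fixpoint qbin (M l : nat) : R :=
  match M, l with
  | _, 0 => 1
  | 0, _.+1 => 0
  | M'.+1, l'.+1 => qbin M' l' + Q ^+ l * qbin M' l
  end.

Definition qfact n : R := \prod_(i < n) (1 - Q ^+ i.+1).

Lemma qbin0 M : qbin M 0 = 1. Proof. by case: M. Qed.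

Lemma qbinS M l : qbin M.+1 l.+1 = qbin M l + Q ^+ l.+1 * qbin M l.+1.
Proof. by []. Qed.

Lemma qbin_small M l : (M < l)%N -> qbin M l = 0.
Proof.
elim: M l => [|M IH] [|l] // Ml; rewrite qbinS !IH ?mulr0 ?addr0 //; lia.
Qed.

Lemma qbinn M : qbin M M = 1.
Proof. by elim: M => // M IH; rewrite qbinS IH qbin_small // mulr0 addr0. Qed.

Lemma qfactS n : qfact n.+1 = qfact n * (1 - Q ^+ n.+1).
Proof. by rewrite /qfact big_ord_recr. Qed.

Lemma qbin_qfact a b : qbin (a + b) a * qfact a * qfact b = qfact (a + b).
Proof.
have [n ab] := ubnP (a + b); elim: n a b ab => // n IH [|a] [|b] ab.
- by rewrite qbin0 /qfact big_ord0 !mulr1.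
- by rewrite qbin0 {1}/qfact big_ord0 !mul1r.
- by rewrite addn0 qbinn {2}/qfact big_ord0 mul1r mulr1.
have e1 : qbin (a + b.+1) a * qfact a * qfact b.+1 = qfact (a + b.+1).
  by apply: IH; lia.
have e2 : qbin (a.+1 + b) a.+1 * qfact a.+1 * qfact b = qfact (a.+1 + b).
  by apply: IH; lia.
rewrite addSnnS in e2; rewrite addSn qbinS [in RHS]qfactS.
transitivity (qbin (a + b.+1) a * qfact a * qfact b.+1 * (1 - Q ^+ a.+1) +
  Q ^+ a.+1 * (1 - Q ^+ b.+1) * (qbin (a + b.+1) a.+1 * qfact a.+1 * qfact b)).
  by rewrite !(qfactS a) !(qfactS b); ring.
by rewrite e1 e2 -addSn exprD; ring.
Qed.

(** Gauss's binomial theorem, kept homogeneous: with x a power of the variable, it gives the triple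
    product without negative exponents. *)
Lemma qbinomial x y M : \prod_(i < M) (x + y * Q ^+ i) =
  \sum_(l < M.+1) Q ^+ 'C(l, 2) * qbin M l * y ^+ l * x ^+ (M - l).
Proof.
elim: M y => [|M IH] y.
  by rewrite big_ord0 big_ord_recl big_ord0 /= !expr0 !mulr1 addr0.
rewrite big_ord_recl expr0 mulr1.
have -> : \prod_(i < M) (x + y * Q ^+ lift ord0 i) =
          \prod_(i < M) (x + (y * Q) * Q ^+ i).
  by apply: eq_bigr => i _; rewrite exprS mulrA.
rewrite IH mulrDl !mulr_sumr big_ord_recl [RHS]big_ord_recl /= qbin0.
rewrite !expr0 !subn0 !mulr1 mul1r mul1r -exprS -addrA; congr (_ + _).
rewrite [RHS](eq_bigr (fun l : 'I_M.+1 =>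
    Q ^+ 'C(l.+1, 2) * (Q ^+ l.+1 * qbin M l.+1) * y ^+ l.+1 * x ^+ (M - l) +
    y * (Q ^+ 'C(l, 2) * qbin M l * (y * Q) ^+ l * x ^+ (M - l)))); last first.
  move=> l _; rewrite /bump /= !add1n subSS binS bin1 exprD.
  by rewrite [(y * Q) ^+ l]exprMn [y ^+ l.+1]exprS; ring.
rewrite big_split /=; congr (_ + _).
rewrite big_ord_recr /= qbin_small // mulr0 mulr0 !mul0r addr0.
apply: eq_bigr => l _; rewrite /bump /= !add1n.
have lM : (l < M)%N by [].
rewrite exprMn -[in RHS](subnSK lM) [x ^+ _.+1]exprS; ring.
Qed.

End GaussianBinomial.

Section TripleProductExponent.
Variables (A B : nat).
Hypotheses (A_gt0 : (0 < A)%N) (BA : (B <= A)%N).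

Definition jtp_exp (n : int) : nat := absz (A%:Z * n ^+ 2 + B%:Z * n).

Lemma jtp_exp_ge0 n : 0 <= A%:Z * n ^+ 2 + B%:Z * n.
Proof.
have [n0|n0] := leP 0 n; first by rewrite addr_ge0 ?mulr_ge0 ?sqr_ge0.
have -> : A%:Z * n ^+ 2 + B%:Z * n =
  A%:Z * ((- n) * (- n - 1)) + (A%:Z - B%:Z) * (- n) by ring.
have nn : 0 <= - n by lia.
have nn1 : 0 <= - n - 1 by lia.
have ba : 0 <= A%:Z - B%:Z by lia.
by rewrite addr_ge0 // mulr_ge0 // mulr_ge0.
Qed.

Lemma jtp_expE n : (jtp_exp n)%:Z = A%:Z * n ^+ 2 + B%:Z * n.
Proof. by rewrite /jtp_exp abszE ger0_norm ?jtp_exp_ge0. Qed.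

Lemma jtp_exp_ge n : (A * (absz n * (absz n).-1) <= jtp_exp n)%N.
Proof.
rewrite -lez_nat jtp_expE PoszM.
have [n0|n0] := leP 0 n.
  have -> : (absz n * (absz n).-1)%N%:Z = n ^+ 2 - n.
    have [->//|n1] := eqVneq n 0.
    rewrite PoszM; have -> : (absz n).-1%:Z = n - 1 by lia.
    have -> : (absz n)%:Z = n by lia.
    by ring.
  rewrite -subr_ge0.
  have -> : A%:Z * n ^+ 2 + B%:Z * n - A%:Z * (n ^+ 2 - n) = (A%:Z + B%:Z) * n by ring.
  by rewrite mulr_ge0.
have -> : (absz n * (absz n).-1)%N%:Z = n ^+ 2 + n.
  rewrite PoszM; have -> : (absz n).-1%:Z = - n - 1 by lia.
  have -> : (absz n)%:Z = - n by lia.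
    by ring.
rewrite -subr_ge0.
have -> : A%:Z * n ^+ 2 + B%:Z * n - A%:Z * (n ^+ 2 + n) = (A%:Z - B%:Z) * (- n) by ring.
by rewrite mulr_ge0 ?subr_ge0 ?lez_nat ?oppr_ge0 // ltW.
Qed.

Lemma jtp_exp_proper : proper_exp jtp_exp.
Proof.
move=> n; have := jtp_exp_ge n; have [->//|n0] := posnP (absz n).
have : (absz n * (absz n).-1 <= A * (absz n * (absz n).-1))%N by rewrite leq_pmull.
have : ((absz n).-1 <= absz n * (absz n).-1)%N by rewrite leq_pmull.
lia.
Qed.

Lemma jtp_exponent N l : (l <= 2 * N)%N ->
  (A * (l * l.-1) + B * l + A * (2 * N - 1) * (2 * N - l) =
   N * (A * (2 * N - 1)) + N * B + A * (N * (N - 1)) + jtp_exp (l%:Z - N%:Z))%N.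
Proof.
move=> lN; have [N0|N0] := posnP N.
  by move: lN; rewrite N0 leqn0 => /eqP ->; rewrite /jtp_exp !(muln0, mul0n, mulr0).
have e1 (a : nat) : a%:Z * a.-1%:Z = a%:Z * (a%:Z - 1).
  by case: a => // a; congr (_ * _); lia.
apply/eqP; rewrite -eqz_nat !PoszD jtp_expE !PoszM !subn1 !e1.
have -> : (2 * N).-1%:Z = 2 * N%:Z - 1 by lia.
have -> : (2 * N - l)%N%:Z = 2 * N%:Z - l%:Z by lia.
apply/eqP; ring.
Qed.

End TripleProductExponent.

Section TripleProduct.
Variables (k : fieldType) (A B : nat) (xi : k).
Hypotheses (two0 : 1 + 1 = 0 :> k) (A_gt0 : (0 < A)%N) (BA : (B <= A)%N).
Hypothesis xi_neq0 : xi != 0.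

Let Q : fps k := mono 1 (2 * A).

Lemma eqm_qfact a b : (a <= b)%N ->
  eqm (2 * A * a.+1) (qfact Q b) (qfact Q a).
Proof.
move=> ab; rewrite -(subnKC ab); elim: (b - a)%N => [|d IH]; first by rewrite addn0.
rewrite addnS qfactS -[X in eqm _ _ X]mulr1; apply: eqmM => //.
rewrite /Q monoX expr1n => m mM; rewrite fcoefD /=.
have [E|_] := eqVneq m (2 * A * (a + d).+1)%N; last by rewrite oppr0 addr0.
by move: mM; rewrite E ltn_pmul2l ?muln_gt0 // ltnS ltnNge leq_addr.
Qed.

Lemma qfact_coef0 n : (qfact Q n).[|0|] = 1.
Proof.
have := eqm_qfact (leq0n n); rewrite /qfact big_ord0 => -> //.
by rewrite muln1 muln_gt0.
Qed.

(** Modulo this power every [qfact] involved agrees with the one at [minn n m], which has constant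
    term 1 and cancels. *)
Lemma eqm_qbin N n m : (n + m = 2 * N)%N -> 
  eqm (2 * A * (minn n m).+1) (qbin Q (2 * N) n * qfact Q N) 1.
Proof.
move=> nm; set M := (2 * A * _)%N; pose c := minn n m.
have e l : (c <= l)%N -> eqm M (qfact Q l) (qfact Q c) by exact: eqm_qfact.
have E := qbin_qfact Q n m; rewrite nm in E.
have [cn cm] : (c <= n)%N /\ (c <= m)%N by rewrite /c geq_minl geq_minr.
have cN : (c <= N)%N by rewrite /c; lia.
apply: (eqm_cancel (u := qfact Q c)); first exact: qfact_coef0.
rewrite mulr1; apply: eqm_trans (e (2 * N)%N _); last by lia.
rewrite -E mulrC; apply: eqmM; last exact/eqm_sym/e.
apply: eqmM => //.
apply: eqm_trans (e N cN) _; exact/eqm_sym/e.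
Qed.

(** Gauss's theorem for the 2N factors x^(A(2N-1)) + xi x^(B+2Al). Taking out the first term for l
    >= N and the second for l < N leaves the two families of factors; [E0] is the total exponent
    taken out. *)
Lemma finite_triple_product N :
  \prod_(j < N) ((1 + mono xi (A * (2 * j + 1) + B)) *
                 (1 + mono xi^-1 (A * (2 * j + 1) - B))) =
  \sum_(l < (2 * N).+1) mono (xi ^ (l%:Z - N%:Z)) (jtp_exp A B (l%:Z - N%:Z)) *
     qbin Q (2 * N) l.
Proof.
pose E0 := (N * (A * (2 * N - 1)) + \sum_(j < N) (B + 2 * A * j))%N.
have E0E : E0 = (N * (A * (2 * N - 1)) + N * B + A * (N * (N - 1)))%N.
  rewrite /E0 big_split /= sum_nat_const card_ord addnA; congr (_ + _)%N.
  elim: N {E0} => [|N IH]; first by rewrite big_ord0 ?mul0n ?muln0.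
  by rewrite big_ord_recr IH /= subn1 /=; case: N {IH} => [|N] /=; nia.
pose F l : fps k := mono 1 (A * (2 * N - 1)) + mono xi B * Q ^+ l.
have lhs : \prod_(l < 2 * N) F l = mono (xi ^+ N) E0 *
    \prod_(j < N) ((1 + mono xi (A * (2 * j + 1) + B)) *
                   (1 + mono xi^-1 (A * (2 * j + 1) - B))).
  have -> : (2 * N = N + N)%N by rewrite mul2n addnn.
  rewrite big_split_ord /= (reindex_inj rev_ord_inj) /= -big_split /=.
  have -> : mono (xi ^+ N) E0 = \prod_(j < N) mono xi (A * (2 * N - 1) + (B + 2 * A * j)).
    rewrite mono_prod prodr_const card_ord; congr mono.
    by rewrite big_split /= sum_nat_const card_ord.
  rewrite [X in X * _](reindex_inj rev_ord_inj) -big_split /=.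
  apply: eq_bigr => j _; rewrite /F /Q !monoX !expr1n !monoM !mulr1.
  have jN := ltn_ord j.
  have -> : mono xi (A * (2 * N - 1) + (B + 2 * A * (N - j.+1))) =
    mono 1 (A * (2 * N - 1)) * mono xi (B + 2 * A * (N - j.+1)) by rewrite monoM mul1r.
  rewrite mulrACA mulrC; congr (_ * _).
    rewrite mulrDr mulr1 monoM mul1r; congr (_ + mono _ _); nia.
  rewrite mulrDr mulr1 monoM mulfV // addrC; congr (_ + mono _ _).
  have : (B <= A * (2 * j + 1))%N by rewrite (leq_trans BA) // leq_pmulr // addn1.
  nia.
have x0 : mono (xi ^+ N) E0 != 0.
  apply/eqP => /(congr1 (fun f => fcoef f E0)) /=; rewrite eqxx => /eqP.
  by rewrite expf_eq0 (negPf xi_neq0) andbF.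
apply: (mulfI x0); rewrite -lhs qbinomial mulr_sumr; apply: eq_bigr => l _.
have lN : (l <= 2 * N)%N by rewrite -ltnS.
have -> : Q ^+ 'C(l, 2) * qbin Q (2 * N) l * mono xi B ^+ l *
    mono 1 (A * (2 * N - 1)) ^+ (2 * N - l) =
  Q ^+ 'C(l, 2) * mono xi B ^+ l * mono 1 (A * (2 * N - 1)) ^+ (2 * N - l) *
    qbin Q (2 * N) l by ring.
rewrite /Q !monoX !expr1n !monoM mulrA monoM mul1r mulr1.
congr (mono _ _ * _).
  by rewrite !exprnP -expfzDr // addrC subrK.
have bl : ('C(l, 2) * 2 = l * l.-1)%N by have := bin_ffact l 2; rewrite ffactnS ffactn1.
have -> : (2 * A * 'C(l, 2) = A * (l * l.-1))%N by rewrite -bl; ring.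
rewrite E0E; exact: jtp_exponent.
Qed.

Theorem triple_product N :
  eqm N (zseries (jtp_exp A B) (fun n => xi ^ n))
    (\prod_(j < N) ((1 + mono 1 (2 * A * j.+1)) *
       ((1 + mono xi (A * (2 * j + 1) + B)) * (1 + mono xi^-1 (A * (2 * j + 1) - B))))).
Proof.
rewrite big_split finite_triple_product /=.
have -> : \prod_(j < N) (1 + mono 1 (2 * A * j.+1)) = qfact Q N.
  apply: eq_bigr => j _; rewrite /Q monoX expr1n.
  by rewrite -[mono _ _ in RHS](char2_oppr (fps_two0 two0)) opprK.
rewrite mulrC mulr_suml; apply: (@eqm_trans _ _ _
  (\sum_(l < (2 * N).+1) mono (xi ^ (l%:Z - N%:Z)) (jtp_exp A B (l%:Z - N%:Z)))).
  move=> m mN; rewrite (coef_zseries _ (jtp_exp_proper A_gt0 BA) mN) fcoef_sum.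
  rewrite zbox.unlock big_map -[iota 0 N.*2.+1]/(index_iota 0 N.*2.+1) big_mkord mul2n.
  by apply: eq_bigr => l _; rewrite /= eq_sym.
apply: eqm_sum => l; rewrite -mulrA -[X in eqm _ X _]mulr1.
apply/eqm_mono/eqm_sym.
have lN : (l <= 2 * N)%N by rewrite -ltnS.
apply: eqm_le (eqm_qbin (m := (2 * N - l)%N) (subnKC lN)).
set m := minn _ _; have := jtp_exp_ge A_gt0 BA (l%:Z - N%:Z).
set n := absz (l%:Z - N%:Z); have mn : (m + n = N)%N by rewrite /m /n; lia.
move=> ge; rewrite leq_subLR; apply: leq_trans (leq_add ge (leqnn _)).
(* The error in the l-th term has order at least A (n (n - 1) + 2 m + 2), which by this inequality
   is at least 2 A (n + m) = 2 A N. *)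
have n2 : (2 * n <= n * n.-1 + 2)%N by case: n {mn ge} => [|[|[|n]]] //=; nia.
rewrite [(2 * A)%N]mulnC -mulnA -mulnDr (leq_trans _ (leq_pmull _ A_gt0)) //.
lia.
Qed.

End TripleProduct.

Lemma big_residue_pairs (T : Type) (idx : T) (op : Monoid.com_law idx) (h : nat)
    (F : nat -> T) :
  \big[op/idx]_(b < h.*2) F b.+1 =
  \big[op/idx]_(i < h) op (F i.+1) (F (h.*2.+1 - i.+1)%N).
Proof.
rewrite -addnn big_split_ord /= [X in op _ X](reindex_inj rev_ord_inj) /= -big_split.
by apply: eq_bigr => i _; congr (op _ (F _)); have := ltn_ord i; lia.
Qed.

(** With p = 2h + 1, the exponents 3 b^2 over odd b < p add up to the order of eta(r^(p^2))^(h-1)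
    eta(r^p). The truncated predecessor sets h = 0 apart. *)
Lemma sum_odd_squares h : (\sum_(i < h) 3 * (h.*2.+1 - (i.+1).*2) ^ 2 =
  h.*2.+1 ^ 2 * h.-1 + h.*2.+1)%N \/ h = 0%N.
Proof.
have [->|h0] := posnP h; first by right.
left; rewrite (reindex_inj rev_ord_inj) /=.
transitivity (\sum_(i < h) 3 * i.*2.+1 ^ 2)%N.
  by apply: eq_bigr => i _; congr (_ * _ ^ _)%N; have := ltn_ord i; lia.
case: h h0 => // h _; elim: h => [|h IH]; first by rewrite big_ord_recr big_ord0.
by rewrite big_ord_recr /= IH /= -!muln2; ring.
Qed.

Lemma prod_ordS (R : comNzRingType) (F : nat -> R) N :
  \prod_(j < N.+1) F j = \prod_(j < N) F j * F N.
Proof. exact: big_ord_recr. Qed.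

Section SubstSeries.
Variables (K k : fieldType) (phi : {rmorphism K -> k}).

Lemma eq_zseries2 q q' (c d : int -> k) :
  (forall n, q n = q' n) -> (forall n, c n = d n) -> zseries q c = zseries q' d.
Proof. by move=> qq cd; apply/fpsP => m /=; apply: eq_bigr => n _; rewrite qq cd. Qed.

Lemma subst_zseries c A q d : (0 < A)%N -> proper_exp q ->
  subst phi c A (zseries q d) =
  zseries (fun n => (A * q n)%N) (fun n => c ^+ q n * phi (d n)).
Proof.
move=> A0 qp; have qp' : proper_exp (fun n => (A * q n)%N).
  by move=> n; have := qp n; have := leq_pmull (q n) A0; lia.
apply/fpsP => m; rewrite (coef_zseries _ qp' (ltnSn m)) [LHS]/=.
case: ifP => [Am|Am]; last first.
  rewrite big1 // => n _; case: eqP => // E.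
  by move: Am; rewrite -E dvdn_mulr.
have mA : (m %/ A < m.+1)%N by rewrite ltnS leq_div.
rewrite -[\sum_(n <- zbox (m %/ A).+1) _]/((zseries q d).[|m %/ A|]).
rewrite (coef_zseries _ qp mA) rmorph_sum mulr_sumr; apply: eq_bigr => n _.
rewrite -[X in (A * q n)%N == X](divnK Am) mulnC eqn_pmul2r //.
by case: eqP => [<-| ] //; rewrite rmorph0 mulr0.
Qed.

End SubstSeries.

(** * Product formulas for eta and its cube *)

Section Products.
Variable k : fieldType.
Hypothesis two0 : 1 + 1 = 0 :> k.

Lemma mono_zseries a d q (c : int -> k) : proper_exp q ->
  mono a d * zseries q c = zseries (fun n => (d + q n)%N) (fun n => a * c n).
Proof.
move=> qp; have qp' : proper_exp (fun n => (d + q n)%N) by move=> n; have := qp n; lia.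
apply/fpsP => m; rewrite coef_monoM (coef_zseries _ qp' (ltnSn m)).
case: leqP => dm; last first.
  rewrite big1 // => n _; case: eqP => // E; move: dm; rewrite -E; lia.
have md : (m - d < m.+1)%N by lia.
rewrite (coef_zseries _ qp md) mulr_sumr; apply: eq_bigr => n _.
have -> : (d + q n == m)%N = (q n == m - d)%N by lia.
by case: eqP; rewrite ?mulr0.
Qed.

Definition pochhammer c N : fps k := \prod_(j < N) (1 + mono 1 (c * j.+1)).

Lemma pochhammerS c N :
  pochhammer c N.+1 = pochhammer c N * (1 + mono 1 (c * N.+1)).
Proof. exact: (prod_ordS (fun j => 1 + mono 1 (c * j.+1) : fps k)). Qed.

Lemma eqm_one_add N (a : k) d : (N <= d)%N -> eqm N (1 + mono a d) 1.
Proof.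
move=> Nd m mN; rewrite fcoefD [X in _ + X]/=.
by case: eqP => [E|_]; [move: mN; rewrite E ltnNge Nd | rewrite addr0].
Qed.

Lemma eqm_pochhammer c N a b : (0 < c)%N -> (N <= a)%N -> (a <= b)%N ->
  eqm N (pochhammer c b) (pochhammer c a).
Proof.
move=> c0 Na ab; rewrite -(subnKC ab); elim: (b - a)%N => [|d IH]; first by rewrite addn0.
rewrite addnS pochhammerS -[X in eqm _ _ X]mulr1; apply: eqmM => //.
by apply: eqm_one_add; nia.
Qed.

Lemma pochhammer_coef0 c N : (0 < c)%N -> (pochhammer c N).[|0|] = 1.
Proof.
move=> c0; have L j : lead 0 (1 : k) (1 + mono 1 (c * j.+1)).
  by split=> //; rewrite fcoefD /= eq_sym muln_eq0 eqn0Ngt c0 addr0.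
by have := (lead_prod (index_enum 'I_N) (fun j : 'I_N => L j)).2; rewrite !big1_eq.
Qed.

(** D over an arbitrary field: for each k > 0 prime to 6, exactly one of k and -k has the form 6 n +
    1. *)
Definition eta : fps k := zseries (fun n => absz (6 * n + 1)%R ^ 2)%N (fun=> 1).

Lemma eta_proper : proper_exp (fun n => absz (6 * n + 1)%R ^ 2)%N.
Proof. by move=> n; have : (absz n <= absz (6 * n + 1)%R)%N by [lia]; nia. Qed.

(** Euler's pentagonal number theorem. As (6 n + 1)^2 = 36 n^2 + 12 n + 1, the triple product has
    the exponents 72 j + 72, 72 j + 48 and 72 j + 24: all positive multiples of 24. *)
Lemma eta_product N M : (N <= M)%N -> eqm N eta (mono 1 1 * pochhammer 24 M).
Proof.
move=> NM; have -> : eta = mono 1 1 * zseries (jtp_exp 36 12) (fun n => 1 ^ n).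
  rewrite mono_zseries; last by apply: jtp_exp_proper.
  apply: eq_zseries2 => n; last by rewrite exp1rz mulr1.
  by apply/eqP; rewrite -eqz_nat PoszD jtp_expE // absz_sqr; apply/eqP; ring.
apply: eqm_mono; apply: (@eqm_le _ N); first exact: leq_subr.
apply: eqm_trans (triple_product two0 (_ : (0 < 36)%N) (_ : (12 <= 36)%N) (oner_neq0 k) (N := N)) _ => //.
apply: (@eqm_trans _ _ _ (pochhammer 24 (3 * N))).
  pose F j : fps k := (1 + mono 1 (2 * 36 * j.+1)) *
       ((1 + mono 1 (36 * (2 * j + 1) + 12)) * (1 + mono 1^-1 (36 * (2 * j + 1) - 12))).
  suff E L : \prod_(j < L) F j = pochhammer 24 (3 * L) by rewrite -E.
  elim: L => [|L IH]; first by rewrite muln0 /pochhammer !big_ord0.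
  rewrite (prod_ordS F) IH mulnS addnC !addnS addn0 !pochhammerS /F invr1.
  have -> : (2 * 36 * L.+1 = 24 * (3 * L).+3)%N by lia.
  have -> : (36 * (2 * L + 1) + 12 = 24 * (3 * L).+2)%N by lia.
  have -> : (36 * (2 * L + 1) - 12 = 24 * (3 * L).+1)%N by lia.
  ring.
have [le|le] := leqP M (3 * N); first by apply: eqm_pochhammer.
by apply: eqm_sym; apply: eqm_pochhammer => //; [rewrite leq_pmull | exact: ltnW].
Qed.

(** Jacobi's series for the cube of eta, reduced modulo 2: its coefficients (-1)^n (2n + 1) are
    odd. *)
Definition eta3 : fps k :=
  zseries (qexp 3) (fun m => if odd (absz m) && (0 < m) then 1 else 0).

Let one_add_sqr n : (1 + mono 1 n : fps k) ^+ 2 = 1 + mono 1 (n * 2).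
Proof. by rewrite (char2_sqrrD (fps_two0 two0)) monoX !expr1n. Qed.

(* With P = prod (1 + w^n) and O the same product over odd n, Euler's identity
   P O = 1 in characteristic 2 turns the triple product for the left-hand
   side, which is P^4 O, into P^3. *)
Lemma eta3E : eta3 = eta ^+ 3.
Proof.
(* Each odd m > 0 is |4 n + 1| for exactly one integer n, and 3 (4 n + 1)^2 = 48 n^2 + 24 n + 3. *)
have -> : eta3 = mono 1 3 * zseries (jtp_exp 48 24) (fun n => 1 ^ n).
  rewrite mono_zseries; last by apply: jtp_exp_proper.
  have E n : qexp 3 (4 * n + 1) = (3 + jtp_exp 48 24 n)%N.
    apply/eqP; rewrite -eqz_nat PoszD jtp_expE // /qexp PoszM absz_sqr.
    by apply/eqP; ring.
  have qN n : qexp 3 (- n) = qexp 3 n by rewrite /qexp abszN.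
  apply: (zseries_reindex
    (u := fun m => if (m %% 4)%Z == 1 then ((m - 1) %/ 4)%Z else - ((m + 1) %/ 4)%Z)
    (v := fun n => `|4 * n + 1|)).
  - exact: qexp_proper.
  - by move=> n; have := jtp_exp_proper (isT : (0 < 48)%N) (isT : (24 <= 48)%N) n; lia.
  - move=> m; case: ifP => [/andP[om m0] _| ]; last by rewrite eqxx.
    case: eqP => m4.
      have e : 4 * ((m - 1) %/ 4)%Z + 1 = m by lia.
      by rewrite -E e exp1rz mulr1; split=> //; lia.
    have e : 4 * (- ((m + 1) %/ 4)%Z) + 1 = - m by lia.
    by rewrite -E e exp1rz mulr1 qN; split=> //; lia.
  move=> n _; rewrite exp1rz mulr1 -E.
  have -> : qexp 3 `|4 * n + 1| = qexp 3 (4 * n + 1) by rewrite /qexp absz_id.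
  have -> : odd (absz `|4 * n + 1|) && (0 < `|4 * n + 1|) by lia.
  by split=> //; case: eqP; lia.
apply: eqm_eq => N; pose P := pochhammer 24 N.
pose O c L : fps k := \prod_(j < L) (1 + mono 1 (c * (2 * j + 1))).
pose F j : fps k := (1 + mono 1 (2 * 48 * j.+1)) *
       ((1 + mono 1 (48 * (2 * j + 1) + 24)) * (1 + mono 1^-1 (48 * (2 * j + 1) - 24))).
pose X := \prod_(j < N) F j.
pose o c j : fps k := 1 + mono 1 (c * (2 * j + 1)).
have XO : X * O 24 N ^+ 2 = pochhammer 24 (4 * N).
  rewrite -prodrXl /X -big_split /=; elim: N {P X} => [|L IH].
    by rewrite muln0 /pochhammer !big_ord0.
  rewrite (prod_ordS (fun j => F j * o 24 j ^+ 2)) IH.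
  rewrite mulnS addnC !addnS addn0 !pochhammerS /F invr1 /o one_add_sqr.
  have -> : (2 * 48 * L.+1 = 24 * (4 * L).+4)%N by lia.
  have -> : (48 * (2 * L + 1) + 24 = 24 * (4 * L).+3)%N by lia.
  have -> : (48 * (2 * L + 1) - 24 = 24 * (4 * L).+1)%N by lia.
  have -> : (24 * (2 * L + 1) * 2 = 24 * (4 * L).+2)%N by lia.
  ring.
have PO : pochhammer 24 (2 * N) = P ^+ 2 * O 24 N.
  rewrite -prodrXl /P -big_split /=; elim: N {P X XO} => [|L IH].
    by rewrite muln0 /pochhammer !big_ord0.
  rewrite (prod_ordS (fun j => (1 + mono 1 (24 * j.+1)) ^+ 2 * o 24 j)) -IH.
  rewrite mulnS addnC !addnS addn0 !pochhammerS /o one_add_sqr.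
  have -> : (24 * L.+1 * 2 = 24 * (2 * L).+2)%N by lia.
  have -> : (24 * (2 * L + 1) = 24 * (2 * L).+1)%N by lia.
  ring.
have le2 : (N <= 2 * N)%N by rewrite leq_pmull.
have le4 : (N <= 4 * N)%N by rewrite leq_pmull.
have P2 : eqm N (P ^+ 2 * O 24 N) P by rewrite -PO; apply: eqm_pochhammer.
have P4 : eqm N (X * O 24 N ^+ 2) P by rewrite XO; apply: eqm_pochhammer.
have PO1 : eqm N (P * O 24 N) 1.
  apply: (eqm_cancel (u := P)); first exact: pochhammer_coef0.
  by rewrite mulr1 mulrA -expr2.
have XP : eqm N X (P ^+ 3).
  apply: (@eqm_trans _ _ _ (X * (P * O 24 N) ^+ 2)).
    rewrite -{1}[X]mulr1; apply: eqmM => //.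
    by apply: eqm_sym; have := eqmX 2 PO1; rewrite expr1n.
  have -> : X * (P * O 24 N) ^+ 2 = P ^+ 2 * (X * O 24 N ^+ 2) by ring.
  by rewrite [P ^+ 3]exprSr; apply: eqmM.
apply: (@eqm_trans _ _ _ (mono 1 3 * P ^+ 3)).
  apply: eqm_mono; apply: (@eqm_le _ N); first exact: leq_subr.
  apply: eqm_trans XP.
  exact: (triple_product two0 (isT : (0 < 48)%N) (isT : (24 <= 48)%N) (oner_neq0 k)).
have -> : mono 1 3 * P ^+ 3 = (mono 1 1 * P) ^+ 3 by rewrite exprMn monoX expr1n.
by apply/eqmX/eqm_sym/eta_product.
Qed.

End Products.

(** * Products of theta series along a line *)

Section EtaDilation.
Variable k : fieldType.
Hypothesis two0 : 1 + 1 = 0 :> k.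

Definition eta_at (a : k) A : fps k :=
  zseries (fun n => A * absz (6 * n + 1)%R ^ 2)%N (fun n => a ^+ (absz (6 * n + 1)%R ^ 2)).

Lemma subst_eta (K : fieldType) (phi : {rmorphism K -> k}) a A :
  (0 < A)%N -> subst phi a A (eta K) = eta_at a A.
Proof.
move=> A0; rewrite subst_zseries //; last exact: eta_proper.
by apply: eq_zseries2 => n //; rewrite rmorph1 mulr1.
Qed.

Lemma eta_at_product A N M : (0 < A)%N -> (N <= M)%N ->
  eqm N (eta_at 1 A) (mono 1 A * pochhammer k (24 * A) M).
Proof.
move=> A0 NM; rewrite -(subst_eta idfun) //.
have -> : mono 1 A * pochhammer k (24 * A) M =
    subst idfun 1 A (mono 1 1 * pochhammer k 24 M).
  rewrite substM // subst_mono // expr1n mulr1 muln1; congr (_ * _).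
  rewrite subst_prod //; apply: eq_bigr => j _.
  rewrite substD subst1 // subst_mono // expr1n mulr1; congr (_ + mono _ _); ring.
by apply: eqm_subst => //; apply: eta_product.
Qed.

Lemma pochhammer_regroup c p N :
  \prod_(j < N) \prod_(b < p) (1 + mono 1 (c * (p * j + b.+1))) =
  pochhammer k c (p * N).
Proof.
elim: N => [|N IH]; first by rewrite muln0 /pochhammer !big_ord0.
rewrite (prod_ordS (fun j => \prod_(b < p) (1 + mono 1 (c * (p * j + b.+1)) : fps k))) IH.
rewrite mulnS addnC /pochhammer big_split_ord /=; congr (_ * _).
by apply: eq_bigr => b _; rewrite addnS.
Qed.

(** Carries factorizations over roots of unity from polynomials to series. *)
Definition poly_fps (P : {poly k}) : fps k := Fps (fun m => P`_m).

Lemma poly_fpsD P R : poly_fps (P + R) = poly_fps P + poly_fps R.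
Proof. by apply/fpsP => m; rewrite fcoefD /= coefD. Qed.

Lemma poly_fpsM P R : poly_fps (P * R) = poly_fps P * poly_fps R.
Proof. by apply/fpsP => m; rewrite fcoefM /= coefM. Qed.

Lemma poly_fpsZXn a n : poly_fps (a *: 'X^n) = mono a n.
Proof.
apply/fpsP => m /=; rewrite coefZ coefXn.
by case: eqP; rewrite ?mulr1 ?mulr0.
Qed.

Lemma poly_fps1 : poly_fps 1 = 1.
Proof. by rewrite -mono1 -poly_fpsZXn scale1r expr0. Qed.

Lemma poly_fps_prod (I : Type) (r : seq I) (F : I -> {poly k}) :
  poly_fps (\prod_(i <- r) F i) = \prod_(i <- r) poly_fps (F i).
Proof. by apply: (big_morph poly_fps poly_fpsM poly_fps1). Qed.

Section RootsOfUnity.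
Variables (p h : nat) (z : k).
Hypotheses (ph : p = h.*2.+1) (p_pr : prime p) (p_gt3 : (3 < p)%N).
Hypothesis z_prim : p.-primitive_root z.

Let z_neq0 : z != 0.
Proof.
apply/eqP => z0; have := prim_expr_order z_prim.
by rewrite z0 ph exprS mul0r => /esym/eqP; rewrite oner_eq0.
Qed.

(** In characteristic 2, (1 + xX)(1 + X/x) = (X - x)(X - 1/x). Doubling permutes the pairs of
    inverse roots, so the product runs over all nontrivial p-th roots of unity. *)
Lemma prod_cyclotomic_pairs :
  \prod_(i < h) ((1 + (z ^+ (2 * i.+1)) *: 'X) * (1 + (z ^+ (2 * i.+1))^-1 *: 'X)) =
  \sum_(i < p) 'X^i :> {poly k}.
Proof.
pose F i : {poly k} := 'X - (z ^+ i)%:P.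
pose G a : {poly k} := ('X - (z ^+ a)%:P) * ('X - (z ^+ a)^-1%:P).
have two0p : 1 + 1 = 0 :> {poly k} by rewrite -polyC1 -polyCD two0.
have X1 : 'X - 1 != 0 :> {poly k} by rewrite -polyC1 polyXsubC_eq0.
apply: (mulfI X1); rewrite -subrX1 -(factor_Xn_sub_1 z_prim).
rewrite [in RHS]ph big_nat_recl // expr0 big_mkord; congr (_ * _).
rewrite (big_residue_pairs _ h F).
transitivity (\prod_(i < h) G (2 * i.+1)%N).
  apply: eq_bigr => i _; rewrite /G !(char2_oppr two0p) -!mul_polyC.
  set x := z ^+ _; have x0 : x != 0 by rewrite expf_neq0.
  have e : x%:P * x^-1%:P = 1 :> {poly k} by rewrite -polyCM mulfV.
  transitivity (1 + (x%:P + x^-1%:P) * 'X + (x%:P * x^-1%:P) * ('X * 'X)); first by ring.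
  transitivity ('X * 'X + (x%:P + x^-1%:P) * 'X + x%:P * x^-1%:P); last by ring.
  by rewrite e; ring.
rewrite (big_half_residues _ (G := G) ph p_pr).
- apply: eq_bigr => i _; congr (_ * ('X - _%:P)).
  have x0 : z ^+ i.+1 != 0 by rewrite expf_neq0.
  apply: (mulIf x0); rewrite mulVf // -exprD subnK ?prim_expr_order // -?ph //.
  by have := ltn_ord i; lia.
- by rewrite gtnNdvd //; lia.
move=> a b [ab|ab].
  by rewrite /G; have /eqP -> : z ^+ a == z ^+ b by rewrite (eq_prim_root_expr z_prim) ab.
have zb : z ^+ b = (z ^+ a)^-1.
  have x0 : z ^+ a != 0 by rewrite expf_neq0.
  apply: (mulfI x0); rewrite mulfV // -exprD; apply/eqP.
  by rewrite -(prim_order_dvd z_prim).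
by rewrite /G zb invrK mulrC.
Qed.

Lemma prod_cyclotomic_mono e : (0 < e)%N ->
  (1 + mono 1 e) * \prod_(i < h) ((1 + mono (z ^+ (2 * i.+1)) e) *
     (1 + mono (z ^+ (2 * i.+1))^-1 e)) = 1 + mono 1 (e * p) :> fps k.
Proof.
move=> e0; have two0p : 1 + 1 = 0 :> {poly k} by rewrite -polyC1 -polyCD two0.
have E : (1 + 1 *: 'X^1) * \prod_(i < h) ((1 + (z ^+ (2 * i.+1)) *: 'X^1) *
    (1 + (z ^+ (2 * i.+1))^-1 *: 'X^1)) = 1 + 1 *: 'X^p :> {poly k}.
  rewrite expr1 prod_cyclotomic_pairs !scale1r addrC -[X in 'X + X](char2_oppr two0p).
  by rewrite -subrX1 addrC (char2_oppr two0p).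
have := congr1 (subst idfun 1 e \o poly_fps) E => /=.
rewrite poly_fpsM poly_fps_prod !poly_fpsD poly_fps1 !poly_fpsZXn.
rewrite substM // subst_prod // !substD !subst1 // !subst_mono // !expr1n !mulr1 muln1.
move=> <-; congr (_ * _); apply: eq_bigr => i _.
rewrite poly_fpsM !poly_fpsD poly_fps1 !poly_fpsZXn substM // !substD !subst1 //.
by rewrite !subst_mono // !expr1n !mul1r muln1.
Qed.

(** At X = 1 the previous factors become (1 + z^(2i))(1 + z^(-2i)) = (z^i + z^(-i))^2, and the
    right-hand side becomes p = 1. *)
Lemma prod_root_sum : \prod_(i < h) (z ^+ i.+1 + (z ^+ i.+1)^-1) = 1.
Proof.
apply: (char2_sqr_inj two0); rewrite expr1n -prodrXl.
have /(congr1 (horner^~ 1)) := prod_cyclotomic_pairs.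
rewrite horner_prod horner_sum.
rewrite [in RHS](eq_bigr (fun=> 1)); last by move=> i _; rewrite hornerXn expr1n.
rewrite sumr_const card_ord ph -[RHS]mulr_natr mul1r mulrS -addnn mulrnDr.
rewrite (char2_addrr two0) addr0 => E; rewrite -[RHS]E; apply: eq_bigr => i _.
rewrite !(hornerM, hornerD, hornerZ, hornerX, hornerC) !mulr1 mulnC exprM.
have x0 : z ^+ i.+1 != 0 by rewrite expf_neq0.
set x := z ^+ i.+1 in x0 *; transitivity (x ^+ 2 + (x^+2)^-1 + (1 + 1)).
  by field.
by field.
Qed.

End RootsOfUnity.
End EtaDilation.

Lemma sqz (n : nat) : (n ^ 2)%N%:Z = n%:Z ^+ 2.
Proof. by rewrite expnS expn1 PoszM expr2. Qed.

Lemma qexpE w (n : int) : (qexp w n)%:Z = w%:Z * n ^+ 2.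
Proof. by rewrite /qexp PoszM absz_sqr. Qed.

(** * Products of theta series on the lines [Some 0] and [None] *)

Section LineProducts.
Variables (k : fieldType) (p h : nat) (om : k).
Hypotheses (two0 : 1 + 1 = 0 :> k) (ph : p = h.*2.+1) (p_pr : prime p).
Hypotheses (p_gt3 : (3 < p)%N).
Hypothesis om_prim : (p ^ 2).-primitive_root om.

Local Notation tho l a := (theta_odd 3 (@chi k p om l) a%:Z).

Let h_gt0 : (0 < h)%N. Proof. by move: p_gt3; rewrite ph; lia. Qed.
Let p_gt0 : (0 < p)%N. Proof. exact: prime_gt0. Qed.
Let p_odd : odd p. Proof. by rewrite ph /= odd_double. Qed.

Let om_neq0 : om != 0.
Proof.
apply/eqP => om0; have := prim_expr_order om_prim.
by rewrite om0 expr0n expn_eq0 -leqn0 leqNgt p_gt0 /= => /esym/eqP; rewrite oner_eq0.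
Qed.

Let exph (x : fps k) : x ^+ h = x ^+ h.-1 * x.
Proof. by rewrite -exprSr prednK. Qed.

Lemma prod_theta_mul2 l : \prod_(i < h) tho l (2 * i.+1)%N = \prod_(i < h) tho l i.+1.
Proof.
apply: (big_half_residues _ (G := fun a => tho l a) ph p_pr).
  by rewrite gtnNdvd //; lia.
by move=> a b ab; case: (theta_periodic p_pr (isT : (0 < 3)%N) om_prim l ab).
Qed.

(** An odd m congruent to 2 a modulo p is 2 a - p - 2 p n for a unique n. At the even argument 2 a
    this holds without distinguishing the parity of the residue. *)
Lemma theta_odd_zero (c : 'I_p) a : (c : nat) = 0%N -> (a <= h)%N ->
  tho (Some c) (2 * a)%N = mono 1 (3 * (p - 2 * a) ^ 2) *
    zseries (jtp_exp (12 * p ^ 2) (12 * p * (p - 2 * a))) (fun n => 1 ^ n).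
Proof.
move=> c0 ah.
have A0 : (0 < 12 * p ^ 2)%N by rewrite muln_gt0 expn_gt0 p_gt0.
have BA : (12 * p * (p - 2 * a) <= 12 * p ^ 2)%N.
  by rewrite expnS expn1 mulnA leq_mul ?leq_subr.
have pr := jtp_exp_proper A0 BA.
rewrite mono_zseries //.
have ap : (2 * a <= p)%N by rewrite ph; lia.
pose v (n : int) : int := (2 * a)%N%:Z - p%:Z - n * (2 * p)%N%:Z.
have qv n : qexp 3 (v n) =
    (3 * (p - 2 * a) ^ 2 + jtp_exp (12 * p ^ 2) (12 * p * (p - 2 * a)) n)%N.
  apply/eqP; rewrite -eqz_nat PoszD (jtp_expE A0 BA) qexpE.
  have -> : (3 * (p - 2 * a) ^ 2)%N%:Z = 3 * (p%:Z - 2 * a%:Z) ^+ 2.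
    by rewrite PoszM sqz -(subzn ap) PoszM.
  have -> : (12 * p * (p - 2 * a))%N%:Z = 12 * p%:Z * (p%:Z - 2 * a%:Z).
    by rewrite !PoszM -(subzn ap) PoszM.
  have -> : (12 * p ^ 2)%N%:Z = 12 * p%:Z ^+ 2 by rewrite PoszM sqz.
  by rewrite /v !PoszM; apply/eqP; ring.
have ov n : odd (absz (v n)).
  have : v n = (2 * a)%N%:Z - p%:Z - 2 * (n * p%:Z) by rewrite /v PoszM; ring.
  by move: p_odd; lia.
have pv n : (p %| v n - (2 * a)%N%:Z)%Z.
  have -> : v n - (2 * a)%N%:Z = (- 1 - 2 * n) * p%:Z by rewrite /v PoszM; ring.
  exact: dvdz_mull.
have p2 : (2 * p)%N%:Z != 0 by rewrite eqz_nat muln_eq0 negb_or /= -lt0n p_gt0.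
have uv n : (((2 * a)%N%:Z - p%:Z - v n) %/ (2 * p)%N%:Z)%Z = n.
  have -> : (2 * a)%N%:Z - p%:Z - v n = n * (2 * p)%N%:Z by rewrite /v; ring.
  exact: mulzK.
apply: (zseries_reindex
  (u := fun m => (((2 * a)%N%:Z - p%:Z - m) %/ (2 * p)%N%:Z)%Z) (v := v)).
- exact: qexp_proper.
- by move=> n; have := pr n; lia.
- move=> m; rewrite /chi c0 mul0n expr0; case: ifP => [om' | ]; last by rewrite eqxx.
  case: ifP => [/dvdzP[j jE] _ | ]; last by rewrite eqxx.
  have [i iE] : exists i, j = - 1 - 2 * i.
    exists ((- 1 - j) %/ 2)%Z.
    have : odd (absz j).
      have : odd (absz (j * p%:Z)) by rewrite -jE; move: om'; lia.
      by rewrite abszM oddM => /andP[].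
    lia.
  have -> : m = v i.
    have -> : m = (2 * a)%N%:Z + (m - (2 * a)%N%:Z) by ring.
    by rewrite jE iE /v PoszM; ring.
  by rewrite uv qv exp1rz mulr1.
move=> n _; rewrite /chi c0 mul0n expr0 ov pv uv qv exp1rz mulr1.
by [].
Qed.

Lemma theta_odd_none a :
  tho None a = mono (om ^+ (a * p)) (3 * p ^ 2) *
    zseries (jtp_exp (12 * p ^ 2) (12 * p ^ 2)) (fun n => (om ^+ (a * p * 2)) ^ n).
Proof.
have A0 : (0 < 12 * p ^ 2)%N by rewrite muln_gt0 expn_gt0 p_gt0.
have pr := jtp_exp_proper A0 (leqnn _).
rewrite mono_zseries //.
pose v (n : int) : int := p%:Z * (2 * n + 1).
have qv n : qexp 3 (v n) = (3 * p ^ 2 + jtp_exp (12 * p ^ 2) (12 * p ^ 2) n)%N.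
  apply/eqP; rewrite -eqz_nat PoszD (jtp_expE A0 (leqnn _)) qexpE.
  have -> : (12 * p ^ 2)%N%:Z = 12 * p%:Z ^+ 2 by rewrite PoszM sqz.
  have -> : (3 * p ^ 2)%N%:Z = 3 * p%:Z ^+ 2 by rewrite PoszM sqz.
  by rewrite /v; apply/eqP; ring.
have ov n : odd (absz (v n)).
  have : v n = p%:Z + 2 * (n * p%:Z) by rewrite /v; ring.
  by move: p_odd; lia.
have pv n : (p %| v n)%Z by rewrite /v dvdz_mulr.
have p0 : p%:Z != 0 by rewrite eqz_nat -lt0n.
have uv n : (((v n %/ p)%Z - 1) %/ 2)%Z = n by rewrite /v mulKz //; lia.
have cv n : om ^ (a%:Z * v n) = om ^+ (a * p) * om ^+ (a * p * 2) ^ n.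
  rewrite !exprnP exprz_exp -expfzDr //; congr (_ ^ _).
  by rewrite /v !PoszM; ring.
apply: (zseries_reindex (u := fun m => (((m %/ p)%Z - 1) %/ 2)%Z) (v := v)).
- exact: qexp_proper.
- by move=> n; have := pr n; lia.
- move=> m; rewrite /chi; case: ifP => [om' | ]; last by rewrite eqxx.
  case: ifP => [/dvdzP[j jE] _ | ]; last by rewrite eqxx.
  have [i iE] : exists i, j = 2 * i + 1.
    exists ((j - 1) %/ 2)%Z.
    have : odd (absz j).
      by move: om'; rewrite jE abszM oddM => /andP[].
    lia.
  have -> : m = v i by rewrite jE iE /v mulrC.
  by rewrite uv qv cv.
move=> n _; rewrite /chi ov pv uv qv cv.
by [].
Qed.

(** The residue a contributes the exponents 24 p times p (j + 1), p j + a and p j + (p - a). Over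
    all a the last two kinds run once through the integers prime to p. One of the h copies of the
    multiples of p completes them to eta(r^p); the other h - 1 make up the power of eta(r^(p^2)). *)
Lemma prod_theta_zero (c : 'I_p) : (c : nat) = 0%N ->
  \prod_(i < h) tho (Some c) i.+1 = eta_at 1 (p ^ 2) ^+ h.-1 * eta_at 1 p.
Proof.
move=> c0; rewrite -prod_theta_mul2.
have p2 : (0 < p ^ 2)%N by rewrite expn_gt0 p_gt0.
have A0 : (0 < 12 * p ^ 2)%N by rewrite muln_gt0.
apply: eqm_eq => N.
pose g b : fps k := 1 + mono 1 (24 * p * b).
pose F (i : 'I_h) j : fps k := g (p * j.+1)%N *
  (g (p * j + i.+1)%N * g (p * j + (p - i.+1))%N).
have T (i : 'I_h) : eqm N (tho (Some c) (2 * i.+1)%N)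
    (mono 1 (3 * (p - i.+1.*2) ^ 2) * \prod_(j < N) F i j).
  have ip : (2 * i.+1 <= p)%N by rewrite ph; have := ltn_ord i; lia.
  have BA : (12 * p * (p - 2 * i.+1) <= 12 * p ^ 2)%N.
    by rewrite expnS expn1 mulnA leq_mul ?leq_subr.
  rewrite theta_odd_zero ?ltn_ord // mul2n; apply: eqm_mono.
  apply: (@eqm_le _ N); first exact: leq_subr.
  rewrite -mul2n; refine (eqm_trans (triple_product two0 A0 BA (oner_neq0 k) (N := N)) _).
  suff E j : (1 + mono 1 (2 * (12 * p ^ 2) * j.+1)) *
     ((1 + mono 1 (12 * p ^ 2 * (2 * j + 1) + 12 * p * (p - 2 * i.+1))) *
      (1 + mono 1^-1 (12 * p ^ 2 * (2 * j + 1) - 12 * p * (p - 2 * i.+1)))) = F i j :> fps k.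
    by under eq_bigr => j _ do rewrite E.
  rewrite invr1 /F [g (p * j + i.+1)%N * _]mulrC /g.
  set a := i.+1 in ip *; have : exists d, p = (2 * a + d)%N by exists (p - 2 * a)%N; lia.
  move=> [d pd]; have -> : (p - 2 * a = d)%N by lia.
  have -> : (p - a = a + d)%N by lia.
  have e : (12 * p * p = 12 * p * (2 * a + d))%N by rewrite -pd.
  have -> : (2 * (12 * p ^ 2) * j.+1 = 24 * p * (p * j.+1))%N by ring.
  have -> : (12 * p ^ 2 * (2 * j + 1) + 12 * p * d = 24 * p * (p * j + (a + d)))%N.
    have -> : (12 * p ^ 2 * (2 * j + 1) = 24 * p * (p * j) + 12 * p * p)%N by ring.
    by rewrite e; ring.
  have -> : (12 * p ^ 2 * (2 * j + 1) - 12 * p * d = 24 * p * (p * j + a))%N.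
    have -> : (12 * p ^ 2 * (2 * j + 1) = 24 * p * (p * j) + 12 * p * p)%N by ring.
    rewrite e; have -> : (24 * p * (p * j) + 12 * p * (2 * a + d) =
      24 * p * (p * j + a) + 12 * p * d)%N by ring.
    by rewrite addnK.
  by [].
apply: eqm_trans (eqm_prod (index_enum 'I_h) T) _.
rewrite big_split mono_prod prodr_const expr1n exchange_big /=.
apply: eqm_trans (eqm_sym (eqmM (eqmX h.-1 (eta_at_product two0 p2 (leqnn N)))
  (eta_at_product two0 p_gt0 (leq_pmull N p_gt0)))).
rewrite -pochhammer_regroup exprMn monoX expr1n mulrACA monoM mulr1.
have -> : (\sum_(i < h) 3 * (p - i.+1.*2) ^ 2 = p ^ 2 * h.-1 + p)%N.
  by rewrite ph; have [//|E] := sum_odd_squares h; move: h_gt0; rewrite E.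
rewrite -prodrXl -big_split /=.
suff E j : \prod_(i < h) F i j = (1 + mono 1 (24 * p ^ 2 * j.+1)) ^+ h.-1 *
    \prod_(b < p) (1 + mono 1 (24 * p * (p * j + b.+1))) :> fps k.
  by under eq_bigr => j _ do rewrite E.
have g1 : 1 + mono 1 (24 * p ^ 2 * j.+1) = g (p * j.+1)%N.
  by rewrite /g; congr (_ + mono _ _); ring.
rewrite g1 /F big_split /= prodr_const card_ord exph -mulrA.
congr (_ * _).
transitivity (\prod_(b < p) g (p * j + b.+1)%N) => //.
rewrite ph (prod_ordS (fun b => g (h.*2.+1 * j + b.+1)%N)) mulrC.
rewrite (big_residue_pairs _ h (fun b => g (h.*2.+1 * j + b)%N)) /=.
by congr (_ * g _); rewrite mulnS addnC.
Qed.

(** Here A = B, so the triple product begins with the constant factor 1 + z^(-2i), which turns the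
    coefficient z^i into z^i + z^(-i). These coefficients multiply to 1, and the other factors
    combine by [prod_cyclotomic_mono]. *)
Lemma prod_theta_none :
  \prod_(i < h) tho None i.+1 = eta_at 1 (p ^ 2) ^+ h.-1 * eta_at 1 (p ^ 3).
Proof.
have p2 : (0 < p ^ 2)%N by rewrite expn_gt0 p_gt0.
have p3 : (0 < p ^ 3)%N by rewrite expn_gt0 p_gt0.
have A0 : (0 < 12 * p ^ 2)%N by rewrite muln_gt0.
pose z := om ^+ p.
have z_prim : p.-primitive_root z.
  have := dvdn_prim_root om_prim (dvdn_exp (isT : 0 < 2)%N (dvdnn p)).
  by rewrite expnS expn1 mulnK.
have z0 n : z ^+ n != 0 by rewrite !expf_neq0.
apply: eqm_eq => N.
pose w j := (24 * p ^ 2 * j)%N.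
pose F (i : 'I_h) j : fps k := (1 + mono 1 (w j)) *
  ((1 + mono (z ^+ (2 * i.+1)) (w j)) * (1 + mono (z ^+ (2 * i.+1))^-1 (w j))).
have T (i : 'I_h) : eqm N (tho None i.+1)
    (mono (z ^+ i.+1 + (z ^+ i.+1)^-1) (3 * p ^ 2) * \prod_(j < N) F i j.+1).
  have xE : om ^+ (i.+1 * p * 2) = z ^+ (2 * i.+1).
    by have -> : (i.+1 * p * 2 = p * (2 * i.+1))%N by [ring]; rewrite exprM.
  rewrite theta_odd_none xE.
  have -> : om ^+ (i.+1 * p) = z ^+ i.+1 by rewrite /z -exprM mulnC.
  set x := z ^+ (2 * i.+1); have x0 : x != 0 by apply: z0.
  have -> : mono (z ^+ i.+1 + (z ^+ i.+1)^-1) (3 * p ^ 2) =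
      mono (z ^+ i.+1) (3 * p ^ 2) * (1 + mono x^-1 0).
    rewrite mulrDr mulr1 monoM addn0.
    have -> : z ^+ i.+1 / x = (z ^+ i.+1)^-1.
      by rewrite /x mul2n -addnn exprD; field.
    apply/fpsP => m; rewrite fcoefD /=.
    by case: ifP => _; rewrite ?addr0.
  rewrite -mulrA; apply: eqm_mono.
  apply: (@eqm_le _ N); first exact: leq_subr.
  pose u j : fps k := (1 + mono 1 (w j.+1)) * (1 + mono x (w j.+1)).
  pose v j : fps k := 1 + mono x^-1 (w j).
  have E j : (1 + mono 1 (2 * (12 * p ^ 2) * j.+1)) *
     ((1 + mono x (12 * p ^ 2 * (2 * j + 1) + 12 * p ^ 2)) *
      (1 + mono x^-1 (12 * p ^ 2 * (2 * j + 1) - 12 * p ^ 2))) = u j * v j :> fps k.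
    rewrite /u /v /w.
    have -> : (2 * (12 * p ^ 2) * j.+1 = 24 * p ^ 2 * j.+1)%N by ring.
    have -> : (12 * p ^ 2 * (2 * j + 1) + 12 * p ^ 2 = 24 * p ^ 2 * j.+1)%N by ring.
    have -> : (12 * p ^ 2 * (2 * j + 1) - 12 * p ^ 2 = 24 * p ^ 2 * j)%N.
      by rewrite mulnDr muln1 addnK; ring.
    by rewrite mulrA.
  suff H : eqm N (\prod_(j < N) (u j * v j)) ((1 + mono x^-1 0) * \prod_(j < N) F i j.+1).
    apply: eqm_trans H; have := triple_product two0 A0 (leqnn _) x0 (N := N).
    by under eq_bigr => j _ do rewrite E.
  have -> : \prod_(j < N) F i j.+1 = \prod_(j < N) u j * \prod_(j < N) v j.+1.
    by rewrite -big_split; apply: eq_bigr => j _; rewrite /F mulrA.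
  rewrite big_split /= mulrCA; apply: eqmM => //.
  have -> : 1 + mono x^-1 0 = v 0%N by rewrite /v /w muln0.
  (* The two sides differ by the factor [v N], which is 1 modulo x^N. *)
  have <- : \prod_(j < N.+1) v j = v 0%N * \prod_(j < N) v j.+1.
    by rewrite big_ord_recl.
  rewrite (prod_ordS v) -[X in eqm _ X _]mulr1; apply: eqmM => //.
  by apply/eqm_sym/eqm_one_add; rewrite /w leq_pmull // muln_gt0.
apply: eqm_trans (eqm_prod (index_enum 'I_h) T) _.
rewrite big_split mono_prod (prod_root_sum two0 ph p_pr p_gt3 z_prim) exchange_big /=.
apply: eqm_trans (eqm_sym (eqmM (eqmX h.-1 (eta_at_product two0 p2 (leqnn N)))
  (eta_at_product two0 p3 (leqnn N)))).
rewrite exprMn monoX expr1n mulrACA monoM mulr1.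
have -> : (\sum_(i < h) 3 * p ^ 2 = p ^ 2 * h.-1 + p ^ 3)%N.
  rewrite sum_nat_const card_ord (expnSr p 2) -mulnDr mulnA mulnC; congr (_ * _)%N.
  by move: h_gt0 ph; lia.
rewrite -prodrXl -big_split /=.
suff E j : \prod_(i < h) F i j.+1 = (1 + mono 1 (24 * p ^ 2 * j.+1)) ^+ h.-1 *
    (1 + mono 1 (24 * p ^ 3 * j.+1)) :> fps k.
  by under eq_bigr => j _ do rewrite E.
have w0 : (0 < w j.+1)%N by rewrite /w !muln_gt0 p_gt0.
have := prod_cyclotomic_mono two0 ph p_pr p_gt3 z_prim w0.
have -> : (w j.+1 * p = 24 * p ^ 3 * j.+1)%N by rewrite /w; ring.
by move=> <-; rewrite /F big_split /= prodr_const card_ord exph -mulrA.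
Qed.

End LineProducts.

Lemma F2_neq0 (x : 'F_2) : x != 0 -> x = 1.
Proof. by case: x => -[|[|m]] //= i _; apply: val_inj. Qed.

(** In the field with 2^(totient n) elements, Euler's theorem makes n divide the order of the
    multiplicative group. *)
Lemma exists_prim_root n : odd n ->
  exists (F : fieldType) (z : F), 1 + 1 = 0 :> F /\ n.-primitive_root z.
Proof.
move=> on; have n0 : (0 < n)%N by case: n on.
have t0 : (0 < totient n)%N by rewrite totient_gt0.
have [F ch cF] := pPrimePowerField (isT : prime 2) t0.
have F1 : (1 < #|F|)%N by apply: finNzRing_gt1.
have nF : (n %| #|F|.-1)%N.
  rewrite cF -subn1 -eqn_mod_dvd ?expn_gt0 //.
  by rewrite Euler_exp_totient // coprime2n.
have : has (#|F|.-1).-primitive_root (enum (predC1 (0 : F))).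
  apply: has_prim_root; first by rewrite -subn1 subn_gt0.
  - apply/allP => x; rewrite mem_enum inE => x0; apply/unity_rootP.
    by apply: (mulfI x0); rewrite -exprS prednK ?expf_card ?mulr1 // ltnW.
  - exact: enum_uniq.
  by rewrite -cardE cardC1.
move/hasP => [x _ xp]; exists F, (x ^+ (#|F|.-1 %/ n)); split.
  by have := pcharf0 ch; rewrite mulr2n.
exact: dvdn_prim_root.
Qed.

(** * The Hecke operator *)

Section F2Embedding.
Variables (S : comNzRingType) (two0 : 1 + 1 = 0 :> S).

Definition F2_embed of 1 + 1 = 0 :> S := fun x : 'F_2 => (val x)%:R : S.

Fact F2_embed_zmod_morphism : zmod_morphism (F2_embed two0).
Proof.
move=> x y; rewrite /F2_embed.
have [->|/F2_neq0 ->] := eqVneq x 0; have [->|/F2_neq0 ->] := eqVneq y 0;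
  by rewrite /= ?subr0 ?sub0r ?subrr // ?(char2_oppr two0).
Qed.

Fact F2_embed_monoid_morphism : monoid_morphism (F2_embed two0).
Proof.
split=> // x y; rewrite /F2_embed.
have [->|/F2_neq0 ->] := eqVneq x 0; have [->|/F2_neq0 ->] := eqVneq y 0;
  by rewrite /= ?mulr0 ?mul0r ?mulr1.
Qed.

HB.instance Definition _ := GRing.isZmodMorphism.Build 'F_2 S (F2_embed two0)
  F2_embed_zmod_morphism.
HB.instance Definition _ := GRing.isMonoidMorphism.Build 'F_2 S (F2_embed two0)
  F2_embed_monoid_morphism.

End F2Embedding.

Lemma coprime6E k : coprime k 6 = (k %% 6 == 1)%N || (k %% 6 == 5)%N.
Proof.
rewrite -coprime_modl; have : (k %% 6 < 6)%N by rewrite ltn_pmod.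
by case: (k %% 6)%N => [|[|[|[|[|[|m]]]]]].
Qed.

Lemma D_eta : D = eta 'F_2.
Proof.
apply/fpsP => m; rewrite /eta (coef_zseries _ eta_proper (ltnSn m)) [LHS]/= big_mkcond.
apply: (sum_support_bij
  (u := fun j : nat => if (j %% 6 == 1)%N then (j %/ 6)%N%:Z else - (j %/ 6).+1%:Z)
  (v := fun n : int => absz (6 * n + 1))); rewrite ?iota_uniq ?zbox_uniq //.
  move=> j; rewrite mem_index_iota coprime6E => /andP[j1 jm].
  case: ifP => [/andP[j6 /eqP jE] _| ]; last by rewrite eqxx.
  have e : absz (6 * (if (j %% 6 == 1)%N then (j %/ 6)%N%:Z else - (j %/ 6).+1%:Z) + 1) = j.
    by move: j6; case: ifP => /eqP; lia.
  rewrite e jE eqxx; split=> //; rewrite mem_zbox.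
  by case: ifP => _; lia.
move=> n _; have [E _|_] := eqVneq (absz (6 * n + 1)%R ^ 2)%N m; last by rewrite eqxx.
set j := absz _ in E *.
have jm : (0 < j <= j ^ 2)%N by rewrite /j; nia.
rewrite mem_index_iota coprime6E -E ?eqxx andbT ltnS jm.
have -> : ((j %% 6 == 1) || (j %% 6 == 5))%N by rewrite /j; lia.
by split=> //; rewrite /j; case: ifP => /eqP; lia.
Qed.

(** * Supports modulo 24 *)

Section Exponents.
Variable R : comNzRingType.
Implicit Types f g : fps R.

Definition exponents_mod a f := forall m, f.[|m|] != 0 -> m = a %[mod 24].

Lemma exponents_modM a b f g : exponents_mod a f -> exponents_mod b g ->
  exponents_mod (a + b) (f * g).
Proof.
move=> fa gb m; apply: contraNeq => mab; rewrite fcoefM big1 // => i _.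
have [->|/fa fi] := eqVneq f.[|i|] 0; first by rewrite mul0r.
have [->|/gb gi] := eqVneq g.[|m - i|] 0; first by rewrite mulr0.
case/eqP: mab; have im : (i <= m)%N by rewrite -ltnS.
by rewrite -(subnKC im) -modnDm fi gi modnDm.
Qed.

Lemma exponents_modX a f n : exponents_mod a f -> exponents_mod (a * n) (f ^+ n).
Proof.
move=> fa; elim: n => [|n IH].
  by rewrite muln0 expr0 => m; rewrite fcoef1; case: m => //= m; rewrite eqxx.
by rewrite mulnS exprS; apply: exponents_modM.
Qed.

End Exponents.

(** (6 n + 1)^2 = 12 n (3 n + 1) + 1, and n (3 n + 1) is even. *)
Lemma eta_exponents (k : fieldType) : exponents_mod 1 (eta k).
Proof.
move=> m; apply: contraNeq => m1.
rewrite /eta (coef_zseries _ eta_proper (ltnSn m)) big1 // => n _.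
have [E|//] := eqVneq (absz (6 * n + 1)%R ^ 2)%N m; case/eqP: m1; rewrite -E.
have [q qE] : exists q : nat, (absz (6 * n + 1)%R ^ 2 = 24 * q + 1)%N.
  have : exists q : int, n * (3 * n + 1) = 2 * q.
    exists (((n * (3 * n + 1)) %/ 2)%Z).
    have : ~~ odd (absz (n * (3 * n + 1))) by rewrite abszM oddM; lia.
    lia.
  move=> [q qE]; exists (absz q); apply/eqP; rewrite -eqz_nat absz_sqr PoszD PoszM.
  have q0 : (absz q)%:Z = q.
    have : 0 <= n * (3 * n + 1) by have [n0|n0] := leP 0 n; nia.
    by rewrite qE; lia.
  have -> : (6 * n + 1) ^+ 2 = 12 * (n * (3 * n + 1)) + 1 by ring.
  by rewrite qE q0; apply/eqP; ring.
by rewrite qE mulnC modnMDl.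
Qed.

(** p is prime to 6, so p^2 = 1 modulo 24 and p m = n gives m = p n: both halves of [T] land in the
    class of p n. *)
Lemma T_exponents p n f : prime p -> (3 < p)%N -> exponents_mod n f ->
  exponents_mod (p * n) (T p f).
Proof.
move=> p_pr p3 fn m.
have pp : p * p = 1 %[mod 24].
  have : coprime p 6.
    rewrite prime_coprime //; apply/negP => p6; have := dvdn_leq (isT : 0 < 6)%N p6.
    by move: p_pr p3 p6; case: (p) => [|[|[|[|[|[|[|q]]]]]]].
  rewrite coprime6E -[X in (X == 1)%N](@modn_dvdm 24) // -[X in (X == 5)%N](@modn_dvdm 24) //.
  rewrite -modnMm; have : (p %% 24 < 24)%N by rewrite ltn_pmod.
  by case: (p %% 24)%N => [|[|[|[|[|[|[|[|[|[|[|[|[|[|[|[|[|[|[|[|[|[|[|[|r]]]]]]]]]]]]]]]]]]]]]]]].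
rewrite /T fcoefD /=; have [pm0|/fn pm _] := eqVneq f.[|p * m|] 0; last first.
  by rewrite -modnMmr -pm modnMmr mulnA -modnMml pp modnMml mul1n.
rewrite pm0 add0r; case: ifP => [/dvdnP[q ->]| ]; last by rewrite eqxx.
rewrite mulnK ?prime_gt0 // => /fn qn.
by rewrite mulnC -modnMmr qn modnMmr.
Qed.

(* Stated over an abstract field: the field tactic does not terminate over a
   field of fractions of power series. *)
Lemma expV3_mulK (F : fieldType) (x a b : F) :
  x != 0 -> a * b = x^-1 ^+ 3 * a * b * x ^+ 3.
Proof. by move=> x0; field. Qed.

Lemma mul_expV_predK (F : fieldType) (x y : F) h :
  x != 0 -> (0 < h)%N -> x * (x^-1 ^+ h * (x ^+ h.-1 * y)) = y.
Proof.
move=> x0; case: h => // h _ /=; rewrite exprS exprVn.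
by field; rewrite x0 expf_neq0.
Qed.

(** * T_p as a sum over lines, and its descent *)

Section Hecke.
Variables (k : fieldType) (p h : nat) (rho : k).
Hypotheses (two0 : 1 + 1 = 0 :> k) (ph : p = h.*2.+1) (p_pr : prime p).
Hypotheses (p_gt3 : (3 < p)%N).
Hypothesis rho_prim : (p ^ 2).-primitive_root rho.

(** The theta series have exponents 3 m^2, so replacing r by rho^c r multiplies their terms by om^(c
    m^2). *)
Let om := rho ^+ 3.
Let p_gt0 : (0 < p)%N. Proof. exact: prime_gt0. Qed.
Let p2_gt0 : (0 < p ^ 2)%N. Proof. by rewrite expn_gt0 p_gt0. Qed.
Let p3_gt0 : (0 < p ^ 3)%N. Proof. by rewrite expn_gt0 p_gt0. Qed.
Let h_gt0 : (0 < h)%N. Proof. by move: p_gt3; rewrite ph; lia. Qed.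

Let ndvd_half (i : 'I_h) : ~~ (p %| i.+1)%N.
Proof. by rewrite gtnNdvd // ph; have := ltn_ord i; lia. Qed.

Let om_prim : (p ^ 2).-primitive_root om.
Proof.
rewrite prim_root_exp_coprime // coprime_pexpr // coprime_sym prime_coprime //.
by rewrite gtnNdvd.
Qed.

Let phi := F2_embed two0.
Let etap : fps k := eta_at 1 (p ^ 2).

Local Notation the l a := (theta_even 3 (@chi k p om l) a%:Z).
Local Notation tho l a := (theta_odd 3 (@chi k p om l) a%:Z).

Definition line_eta (l : option 'I_p) : fps k :=
  match l with
  | Some c => eta_at (rho ^+ (c * p)) p
  | None => eta_at 1 (p ^ 3)
  end.

(** Summing over c kills the powers of r^p whose exponent is not divisible by p and multiplies the
    others by p = 1; this extracts the c_(pn). The line [None] gives the terms in x^(pn). *)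
Lemma sum_line_eta n :
  \sum_l line_eta l ^+ n = subst phi 1 (p ^ 2) (T p (D ^+ n)).
Proof.
rewrite D_eta; set f := eta 'F_2 ^+ n.
have pk : p%:R = 1 :> k.
  by rewrite ph -[LHS]mulr_natr mul1r mulrS -addnn mulrnDr char2_addrr // addr0.
rewrite (bigD1 None) //= (reindex_omap Some id) => [|[]] //=.
rewrite -(subst_eta phi) // -substX // -/f.
rewrite (eq_bigl predT) => [|c]; last by rewrite eqxx.
rewrite (eq_bigr (fun c : 'I_p => subst phi (rho ^+ (c * p)) p f)); last first.
  by move=> c _; rewrite -(subst_eta phi) // -substX.
apply/fpsP => m; rewrite fcoefD fcoef_sum /=.
case: (boolP (p %| m)%N) => pm; last first.
  rewrite big1 // addr0 ifN; last first.
    by apply: contraNN pm; apply: dvdn_trans; rewrite expnS dvdn_mulr.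
  by rewrite ifN //; apply: contraNN pm; apply: dvdn_trans; rewrite expnS dvdn_mulr.
case/dvdnP: pm => m1 ->; rewrite mulnK //.
rewrite -mulr_suml.
have -> : \sum_(c < p) (rho ^+ (c * p)) ^+ m1 = (p %| m1)%N%:R.
  pose ze := rho ^+ (p * m1).
  rewrite (eq_bigr (fun c : 'I_p => ze ^+ c)); last first.
    by move=> c _; rewrite /ze -!exprM; congr (_ ^+ _); ring.
  case: (boolP (p %| m1)%N) => pm1.
    have -> : ze = 1.
      by apply/eqP; rewrite -(prim_order_dvd rho_prim) expnS expn1 dvdn_pmul2l.
    by rewrite (eq_bigr (fun=> 1)) ?sumr_const ?card_ord // => c _; rewrite expr1n.
  have ze1 : ze - 1 != 0.
    by rewrite subr_eq0 -(prim_order_dvd rho_prim) expnS expn1 dvdn_pmul2l.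
  apply: (mulfI ze1); rewrite -subrX1 mulr0 /ze -exprM mulnAC mulnn exprM.
  by rewrite (prim_expr_order rho_prim) expr1n subrr.
have p3E : (p ^ 3 = p * p * p)%N by ring.
have p2E : (p ^ 2 = p * p)%N by ring.
have pp0 : (0 < p * p)%N by rewrite muln_gt0 p_gt0.
rewrite p3E p2E dvdn_pmul2r // dvdn_pmul2r //.
case: (boolP (p %| m1)%N) => [/dvdnP[m2 ->]|pm1]; last first.
  rewrite mul0r addr0 ifN //; apply: contraNN pm1.
  by apply: dvdn_trans; rewrite dvdn_mulr.
rewrite dvdn_pmul2r // mul1r -[(m2 * p * p)%N]mulnA mulnK // [(p * p * p)%N]mulnC.
rewrite divnMr // !expr1n !mul1r rmorphD addrC [(m2 * p)%N]mulnC; congr (_ + _).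
by case: ifP => _ //; rewrite rmorph0.
Qed.


(** [Some c] arises from [Some 0] by replacing r with rho^c r, which fixes eta' because rho^(p^2) =
    1. *)
Lemma prod_theta_line l : \prod_(i < h) tho l i.+1 = etap ^+ h.-1 * line_eta l.
Proof.
case: l => [c| ]; last exact: (prod_theta_none two0 ph p_pr p_gt3 om_prim).
pose c0 : 'I_p := Ordinal p_gt0.
have := prod_theta_zero two0 ph p_pr p_gt3 om_prim (erefl : (c0 : nat) = 0%N).
move/(congr1 (subst idfun (rho ^+ c) 1)).
rewrite substM // substX // subst_prod // => E.
have eta_subst A : (0 < A)%N ->
    subst idfun (rho ^+ c) 1 (eta_at 1 A : fps k) = eta_at (rho ^+ (c * A)) A.
  move=> A0; have pr : proper_exp (fun n => A * absz (6 * n + 1)%R ^ 2)%N.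
    by move=> n; have := eta_proper n; have := leq_pmull (absz (6 * n + 1)%R ^ 2) A0; lia.
  rewrite subst_zseries //; apply: eq_zseries2 => n; first by rewrite mul1n.
  by rewrite expr1n mulr1 -!exprM mulnA.
rewrite !eta_subst // [(c * p ^ 2)%N]mulnC [rho ^+ (p ^ 2 * c)]exprM in E.
rewrite (prim_expr_order rho_prim) expr1n in E.
rewrite -[RHS]E; apply: eq_bigr => i _.
rewrite subst_zseries //; last exact: qexp_proper.
apply: eq_zseries2 => n; first by rewrite mul1n.
rewrite /chi mul0n expr0; case: ifP => _ /=; last by rewrite mulr0.
case: ifP => _ /=; last by rewrite mulr0.
by rewrite mulr1 /om /qexp -!exprM; congr (_ ^+ _); ring.
Qed.

(** At u = 0 only m = p n survives, where the values of [chi] are 1, and 3 m^2 = p^2 (3 n^2). *)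
Lemma theta_half_line l : theta_half 3 (@chi k p om l) = etap ^+ 3.
Proof.
rewrite /etap -(subst_eta idfun) // -substX // -(eta3E two0) /eta3.
rewrite subst_zseries //; last exact: qexp_proper.
have pz : p%:Z != 0 by rewrite eqz_nat -lt0n.
have qpE n : qexp 3 (p%:Z * n) = (p ^ 2 * qexp 3 n)%N.
  by rewrite /qexp abszM /= expnMn mulnCA.
apply: (zseries_reindex (u := fun m => (m %/ p%:Z)%Z) (v := fun n => p%:Z * n)).
- exact: qexp_proper.
- move=> n; have := qexp_proper (isT : (0 < 3)%N) n; have := leq_pmull (qexp 3 n) p2_gt0.
  lia.
- move=> m; case: ifP => [/andP[om_ m0]| ]; last by rewrite eqxx.
  move=> c0; have pm : (p %| m)%Z.
    by apply: contraNT c0 => pm; rewrite /chi; case: l => [c| ]; rewrite ?subr0 ifN.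
  have mE : m = p%:Z * (m %/ p%:Z)%Z by rewrite mulrC divzK.
  rewrite -mE -qpE -mE; split=> //.
  have -> : odd (absz (m %/ p%:Z)%Z) && (0 < (m %/ p%:Z)%Z).
    apply/andP; split.
      by move: om_; rewrite {1}mE abszM oddM => /andP[].
    by move: m0; rewrite {1}mE pmulr_rgt0.
  rewrite expr1n mul1r /chi; case: l {c0} => [c| ]; rewrite ?subr0 pm; last by rewrite mul0r expr0z.
  rewrite mE abszM expnMn mulnCA exprM (prim_expr_order om_prim) expr1n.
  by [].
move=> n; rewrite expr1n mul1r; case: ifP => [/andP[on n0] _| ]; last by rewrite rmorph0 eqxx.
have po : odd p by rewrite ph /= odd_double.
rewrite mulKz // qpE abszM oddM on po pmulr_rgt0 // n0 rmorph1 /=; split=> //.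
rewrite /chi; case: l => [c| ]; rewrite ?subr0 dvdz_mulr //; last by rewrite mul0r expr0z.
by rewrite abszM expnMn mulnCA exprM (prim_expr_order om_prim) expr1n.
Qed.

Let Omega := {fraction fps k}.
Local Notation frac := (@FracField.tofrac (fps k)).

Let frac_inj : injective frac.
Proof. by move=> x y /eqP; rewrite tofrac_eq => /eqP. Qed.

Let two0O : 1 + 1 = 0 :> Omega.
Proof. by rewrite -(rmorph1 frac) -rmorphD (fps_two0 two0) rmorph0. Qed.

Lemma lead_etap : lead (p ^ 2) 1 etap.
Proof.
have := @eta_at_product k two0 (p ^ 2) (p ^ 2).+1 _ p2_gt0 (leqnn _) => E.
split=> [m mp| ]; rewrite E //; try exact: ltnW; rewrite coef_monoM.
  by rewrite leqNgt mp.
by rewrite leqnn mul1r subnn pochhammer_coef0 // muln_gt0.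
Qed.

Let etap_neq0 : etap != 0.
Proof. exact: lead_neq0 (oner_neq0 _) lead_etap. Qed.

Let delta : Omega := (frac etap)^-1.

Let fetap_neq0 : frac etap != 0. Proof. by rewrite tofrac_eq0. Qed.

Let cdelta : commr_rmorph (F2_embed two0O) delta.
Proof. by move=> x; apply: mulrC. Qed.

Let f : {rmorphism {poly 'F_2} -> Omega} := horner_morph cdelta.

Definition supp_poly (q : {poly 'F_2}) := [seq i <- index_iota 0 (size q) | q`_i != 0].

Lemma eval_delta (q : {poly 'F_2}) m : (size q <= m.+1)%N ->
  frac etap ^+ m * f q = frac (\sum_(i <- supp_poly q) etap ^+ (m - i)).
Proof.
move=> qm; have -> : f q = (map_poly (F2_embed two0O) q).[delta] by [].
rewrite (@horner_coef_wide _ (size q)); last exact: size_poly.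
rewrite rmorph_sum big_filter big_mkord [RHS]big_mkcond /=.
rewrite mulr_sumr; apply: eq_bigr => i _; rewrite coef_map /=.
have [->|/F2_neq0 ->] := eqVneq q`_i 0; first by rewrite rmorph0 mul0r mulr0.
rewrite rmorph1 mul1r rmorphXn /delta.
have im : (i <= m)%N by rewrite -ltnS (leq_trans (ltn_ord i)).
have -> : frac etap ^+ m = frac etap ^+ (m - i) * frac etap ^+ i by rewrite -exprD subnK.
by rewrite exprVn mulfK // expf_neq0.
Qed.

Lemma coef0_sum_etap (r : seq nat) m : uniq r -> m \in r -> (forall i, i \in r -> (i <= m)%N) ->
  (\sum_(i <- r) etap ^+ (m - i)).[|0|] = 1.
Proof.
move=> ur mr rm; rewrite fcoef_sum (bigD1_seq m) //= subnn expr0 big1_seq ?addr0 //.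
move=> i /andP[im ir]; apply: (lead_exp (m - i) lead_etap).1.
by rewrite muln_gt0 p2_gt0 subn_gt0 ltn_neqAle im rm.
Qed.

Lemma supp_poly_uniq q : uniq (supp_poly q).
Proof. by rewrite filter_uniq ?iota_uniq. Qed.

Lemma supp_poly_max q i : i \in supp_poly q -> (i <= (size q).-1)%N.
Proof. by rewrite mem_filter mem_index_iota => /andP[_]; lia. Qed.

Lemma supp_poly_lead (q : {poly 'F_2}) : q != 0 -> (size q).-1 \in supp_poly q.
Proof.
move=> q0; rewrite mem_filter -/(lead_coef q) lead_coef_eq0 q0 mem_index_iota /=.
by rewrite prednK ?size_poly_gt0.
Qed.

(** 1 / eta' is transcendental over F_2: for q of degree m, eta'^m q(1/eta') has constant term 1,
    coming from the top monomial alone. *)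
Let f_inj : injective f.
Proof.
move=> q q' E; apply/eqP; rewrite -subr_eq0; apply/negPn/negP => d0.
have := eval_delta (leqSpred (size (q - q')%R)).
rewrite rmorphB /= E subrr mulr0 => /esym/eqP; rewrite tofrac_eq0 => /eqP E0.
have := coef0_sum_etap (supp_poly_uniq _) (supp_poly_lead d0) (@supp_poly_max _).
by rewrite E0 fcoef0 => /esym/eqP; rewrite oner_eq0.
Qed.

Lemma hecke_delta_poly n : exists q,
  frac (subst phi 1 (p ^ 2) (T p (D ^+ n))) = frac etap ^+ n * f q.
Proof.
pose E (l : option 'I_p) a : Omega := frac (the l a).
pose T' (l : option 'I_p) a : Omega := frac (tho l a).
have w0 : (0 < 3)%N by [].
have fX : f 'X = delta by exact: horner_morphX.
have d3 l a : tho l a.*2 * etap ^+ 3 = tho l a ^+ 2 * the l a ^+ 2.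
  rewrite -(theta_half_line l) -addnn PoszD.
  apply: theta_odd_double => //; [exact: (chi_add ph p_pr om_prim) | exact: chi0N].
have [q Hq] : exists q, \sum_l (f 'X ^+ h * \prod_(i < h) T' l i.+1) ^+ n = f q.
  apply: (@theta_descent p h _ _ f (option 'I_p) E T') => //.
  - by rewrite card_option card_ord ph.
  - move=> l a b ab; have [e1 e2] := theta_periodic p_pr w0 om_prim l ab.
    by rewrite /E /T' e1 e2.
  - move=> l; rewrite /E theta_even0 ?rmorph1 //; [exact: chi00 | exact: chi0N].
  - by move=> l a pa; rewrite /E tofrac_eq0; apply: (theta_even_neq0 ph).
  - by move=> l a pa; rewrite /T' tofrac_eq0; apply: (theta_odd_neq0 two0 ph).
  - move=> l a; rewrite fX /delta; apply: (mulIf (expf_neq0 3 fetap_neq0)).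
    rewrite /T' -rmorphXn -rmorphM d3 rmorphM !rmorphXn /E.
    exact: expV3_mulK.
  - move=> l a b ba; rewrite /T' /E -!rmorphXn -!rmorphM -rmorphD PoszD -subzn //.
    by congr frac; apply: theta_odd_add => //; apply: (chi_add ph p_pr om_prim).
  - move=> l a b ba; rewrite /T' /E -!rmorphXn -!rmorphM -rmorphD PoszD -subzn //.
    by congr frac; apply: theta_even_add => //; apply: (chi_add ph p_pr om_prim).
  - move=> x y /eqP; rewrite eqr_div ?tofrac_eq0; last 2 first.
    + exact: (theta_odd_neq0 two0 ph).
    + exact: (theta_odd_neq0 two0 ph).
    rewrite -!rmorphM => /eqP/frac_inj.
    exact: (theta_ratio_inj two0 ph).
  move=> l; have en (i : 'I_h) : E l i.+1 != 0.
    by rewrite /E tofrac_eq0; apply: (theta_even_neq0 ph).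
  have := theta_trace_neq0 two0 ph p_pr p_gt3 w0 om_prim l; rewrite -tofrac_eq0.
  apply: contraNneq => S0; apply/eqP; rewrite rmorph_sum /=.
  transitivity ((\sum_(i < h) T' l i.+1 / E l i.+1) * \prod_(j < h) E l j.+1).
    rewrite mulr_suml; apply: eq_bigr => i _.
    by rewrite rmorphM rmorph_prod [in RHS](bigD1 i) //= mulrA divfK.
  by rewrite S0 mul0r.
exists q; rewrite -Hq -sum_line_eta rmorph_sum mulr_sumr; apply: eq_bigr => l _.
rewrite /T' -rmorph_prod prod_theta_line fX /delta rmorphXn -exprMn rmorphM rmorphXn.
by rewrite mul_expV_predK.
Qed.

Lemma hecke_sum n : exists r : seq nat,
  (forall i, i \in r -> (i <= n)%N) /\ T p (D ^+ n) = \sum_(i <- r) D ^+ i.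
Proof.
have [q Hq] := hecke_delta_poly n.
have subst_inj : injective (subst phi 1 (p ^ 2)).
  move=> g g' E; apply/fpsP => m; have := congr1 (fun u => u.[|m * p ^ 2|]) E.
  by rewrite /= dvdn_mull // mulnK // expr1n !mul1r => /fmorph_inj.
have etapE : etap = subst phi 1 (p ^ 2) D by rewrite D_eta subst_eta.
have [Ln|nL] := leqP (size q) n.+1.
  exists [seq n - i | i <- supp_poly q]%N; split.
    by move=> _ /mapP[i _ ->]; apply: leq_subr.
  apply: subst_inj; apply: frac_inj; rewrite Hq eval_delta //.
  rewrite big_map subst_sum; congr (frac _); apply: eq_bigr => i _.
  by rewrite etapE substX.
(* Were the degree L of q larger than n, multiplication by eta'^(L-n) would equate a series without
   constant term to one with constant term 1. *)
pose L := (size q).-1; have Ln : (n < L)%N by rewrite /L; lia.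
have q0 : q != 0 by rewrite -size_poly_gt0 (leq_trans _ nL).
have : etap ^+ (L - n) * subst phi 1 (p ^ 2) (T p (D ^+ n)) =
    \sum_(i <- supp_poly q) etap ^+ (L - i).
  apply: frac_inj; apply: etrans (rmorphM _ _ _) _.
  apply: etrans (congr1 (fun x => frac (etap ^+ (L - n)) * x) Hq) _.
  rewrite rmorphXn mulrA -exprD subnK 1?ltnW //.
  by rewrite eval_delta // leqSpred.
move/(congr1 (fun u => u.[|0|])); rewrite fcoefM big_ord1.
rewrite (coef0_sum_etap (supp_poly_uniq q) (supp_poly_lead q0) (@supp_poly_max q)).
rewrite (lead_exp (L - n) lead_etap).1 ?muln_gt0 ?p_gt0 ?subn_gt0 ?Ln //.
by rewrite mul0r => /esym/eqP; rewrite oner_eq0.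
Qed.

End Hecke.

Theorem theorem2p17 (n p : nat) (n_gt0 : (0 < n)%N) (n_coprime6 : coprime n 6)
    (p_gt3 : (3 < p)%N) (p_prime : prime p) :
  exists s : seq nat,
    (forall k : nat, k \in s -> (k = p * n %[mod 24])%N /\ (k <= n)%N) /\
    T p (D ^+ n) = \sum_(k <- s) D ^+ k.
Proof.
have p_odd : odd p.
  by case: (even_prime p_prime) => // p2; rewrite p2 in p_gt3.
have ph : p = p./2.*2.+1 by rewrite -[LHS]odd_double_half p_odd.
have [k [z [two0 z_prim]]] : exists (F : fieldType) (z : F),
    1 + 1 = 0 :> F /\ (p ^ 2).-primitive_root z.
  by apply: exists_prim_root; rewrite oddX p_odd orbT.
have [r [rn Tr]] := hecke_sum two0 ph p_prime p_gt3 z_prim n.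
(* D^i is supported in the class of i modulo 24 and T_p(D^n) in that of p n, so the discarded powers
   contribute nothing in this class, and the kept ones nothing outside it. *)
exists [seq i <- r | i == p * n %[mod 24]]; split.
  by move=> i; rewrite mem_filter => /andP[/eqP imod /rn].
have eD i : exponents_mod i (D ^+ i).
  by rewrite -[X in exponents_mod X _]mul1n D_eta; apply/exponents_modX/eta_exponents.
have eT := T_exponents p_prime p_gt3 (eD n).
apply/fpsP => m; rewrite fcoef_sum big_filter.
have [mod_m|mod_m] := eqVneq (m %% 24)%N (p * n %% 24)%N.
  rewrite Tr fcoef_sum [RHS]big_mkcond; apply: eq_bigr => i _.
  case: ifP => // /negP ipn; apply/eqP/negPn/negP => mi.
  by apply: ipn; rewrite -(eD i m mi) mod_m.
transitivity (0 : 'F_2).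
  by apply/eqP; apply: contraNT mod_m => mT; rewrite (eT m mT).
rewrite big1 // => i /eqP ipn; apply/eqP.
by apply: contraNT mod_m => mi; rewrite (eD i m mi) ipn.
Qed.
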